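(* Let $M$ be a compact connected oriented $5$-manifold and let $\rho=(\rho_1,\rho_2)\in\Omega^{ev}(M)\otimes\mathbf R^2$ lie at each point in the open orbit with $f(\rho)>0$, and be a solution of the variational equations $d\rho=0=d\hat\rho$ such that the degree zero component of $\rho$ is non-zero. Then, up to the action of $SL(2,\mathbf R)$ and a closed $2$-form $B$, the structure is equivalent to: (1) a closed $2$-form $\omega$ and a volume form $\phi$ on $M$; (2) two commuting vector fields $Y_1,Y_2$, preserving $\omega$ and $\phi$, such that (3) $\omega(Y_1,Y_2)=-1/8$. The form $\rho$ then has the invariant volume form $\phi$ (i.e. $\phi(\rho)=\phi$), and is defined by $$\rho_1=\omega+i_{Y_1}\phi,\qquad \rho_2=1+i_{Y_2}\phi.$$
   Context: $T\oplus T^*$ has the inner product with $(X+\xi,X+\xi)=i_X\xi$ (so $(X+\xi,Y+\eta)=\frac12(i_X\eta+i_Y\xi)$) and acts on forms by Clifford multiplication $(X+\xi)\cdot\varphi=i_X\varphi+\xi\wedge\varphi$. The half-spin spaces of $Spin(T\oplus T^* )\cong Spin(5,5)$ are $S=\Lambda^{ev}T^*$ and $S^*=\Lambda^{od}T^*$, with the Mukai pairing $\langle\varphi_1,\varphi_2\rangle=[\varphi_1\wedge\sigma(\varphi_2)]_5\in\Lambda^5T^*$, where $\sigma(\alpha)=(-1)^m\alpha$ for $\alpha$ of degree $2m$ or $2m+1$. For even forms $\varphi$, $Q(\varphi)\in\Lambda^5T^*\otimes(T\oplus T^* )$ is defined by $(Q(\varphi),v)=\langle v\cdot\varphi,\varphi\rangle$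 for all $v\in T\oplus T^*$. For $\rho=(\rho_1,\rho_2)\in\Lambda^{ev}T^*\otimes\mathbf R^2$ put $f(\rho)=(Q(\rho_1),Q(\rho_2))\in(\Lambda^5T^* )^2$. The group $Spin(5,5)\times GL(2,\mathbf R)$ acts on $\Lambda^{ev}T^*\otimes\mathbf R^2$ at each point with open orbits, on which $f\ne0$. For $f(\rho)>0$ (positivity in $(\Lambda^5T^* )^2$ is well defined), $\phi(\rho)=f(\rho)^{1/2}$ is the positive square root with respect to the orientation, a volume form. The form $\hat\rho=(\hat\rho_1,\hat\rho_2)\in\Omega^{od}(M)\otimes\mathbf R^2$ is defined by the derivative of $\phi$ at $\rho$: $D\phi(\dot\rho)=\langle\hat\rho_2,\dot\rho_1\rangle-\langle\hat\rho_1,\dot\rho_2\rangle$ for all $\dot\rho$. $SL(2,\mathbf R)$ acts (by constant matrices) on the $\mathbf R^2$ factor of $\Omega^{ev}(M)\otimes\mathbf R^2$; a closed $2$-form $B$ acts by $\rho_A\mapsto e^B\wedge\rho_A$. ''Preserving'' means the Lie derivatives $\mathcal L_{Y_A}\omega$ and $\mathcal L_{Y_A}\phi$ vanish. ''Equivalent to'' means that every such $\rho$ can be brought by these actions to the displayed form for some data $(\omega,\phi,Y_1,Y_2)$ as in (1)-(3), and conversely such data (with $\phi$ positive) define such a solution. *)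

(* Defs.v *)
From HB Require Import structures.
From mathcomp Require Import all_boot all_order all_algebra.
From mathcomp Require Import all_classical all_reals all_analysis.

Set Implicit Arguments.
Unset Strict Implicit.
Unset Printing Implicit Defensive.

Import Order.TTheory GRing.Theory Num.Theory.
Import numFieldNormedType.Exports.

Local Open Scope classical_set_scope.
Local Open Scope ring_scope.

(* The space of all exterior forms on R^n.  The coordinate of alpha along
   dx^{i_1} /\ ... /\ dx^{i_k}, i_1 < ... < i_k, is indexed by the set
   {i_1, ..., i_k}; row vectors are used because they are a normed module. *)
Notation form R n := 'rV[R]_#|{set 'I_n}|.

Section ExteriorAlgebra.
Context {R : realType} {n : nat}.
Implicit Types (alpha beta : form R n) (I J : {set 'I_n}) (X : 'rV[R]_n).

Definition coef alpha I : R := alpha ord0 (enum_rank I).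

Definition mkform (F : {set 'I_n} -> R) : form R n := \row_k F (enum_val k).

Lemma coef_mkform F I : coef (mkform F) I = F I.
Proof. by rewrite /coef mxE enum_rankK. Qed.

Lemma coefD alpha beta I : coef (alpha + beta) I = coef alpha I + coef beta I.
Proof. by rewrite /coef mxE. Qed.

Lemma coefZ a alpha I : coef (a *: alpha) I = a * coef alpha I.
Proof. by rewrite /coef mxE. Qed.

Definition homog k alpha := forall I, #|I| != k -> coef alpha I = 0.
Definition even_form alpha := forall I, odd #|I| -> coef alpha I = 0.
Definition odd_form alpha := forall I, ~~ odd #|I| -> coef alpha I = 0.

(* dx^J /\ dx^K = shuffle_sign J K * dx^(J U K) when J and K are disjoint. *)
Definition shuffle_sign (J K : {set 'I_n}) : R :=
  (-1) ^+ #|[pred p : 'I_n * 'I_n | [&& p.1 \in J, p.2 \in K & (p.2 < p.1)%N]]|.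

Definition wedge alpha beta : form R n :=
  mkform (fun I => \sum_(J : {set 'I_n} | J \subset I)
    shuffle_sign J (I :\: J) * coef alpha J * coef beta (I :\: J)).

Definition unit_form : form R n := mkform (fun I => (I == finset.set0)%:R).

Definition dx (k : 'I_n) : form R n := mkform (fun I => (I == [set k]%SET)%:R).

Definition covector (xi : 'rV[R]_n) : form R n := \sum_k xi ord0 k *: dx k.

Definition iprod X alpha : form R n :=
  mkform (fun I => \sum_(k | k \notin I)
    shuffle_sign [set k]%SET I * X ord0 k * coef alpha (k |: I)%SET).

(* L^* alpha; (L^* dx^k) = \sum_j (L e_j)_k dx^j, and enum I is increasing. *)
Definition pullback (L : 'rV[R]_n -> 'rV[R]_n) alpha : form R n :=
  \sum_(I : {set 'I_n}) coef alpha I *: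
    \big[wedge/unit_form]_(k <- enum I)
       covector (\row_j L (delta_mx ord0 j) ord0 k).

(* e^B, for B of degree 2: the powers beyond n vanish. *)
Definition exp_form (B : form R n) : form R n :=
  \sum_(k < n.+1) (k`!%:R)^-1 *: iter k (wedge B) unit_form.

End ExteriorAlgebra.

Section LocalCalculus.
Context {R : realType} {n : nat}.
Implicit Types (U : set 'rV[R]_n) (X Y : 'rV[R]_n -> 'rV[R]_n)
  (alpha : 'rV[R]_n -> form R n).

Definition partial {V : normedModType R} (k : 'I_n) (F : 'rV[R]_n -> V) :
  'rV[R]_n -> V := fun x => 'D_(delta_mx ord0 k) F x.

(* C^infinity on U (used for U open): all iterated partial derivatives are
   differentiable at the points of U. *)
Definition smooth_on {V : normedModType R} U (F : 'rV[R]_n -> V) :=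
  forall (s : seq 'I_n) x, U x -> differentiable (foldr partial F s) x.

Definition extd alpha : 'rV[R]_n -> form R n :=
  fun x => \sum_k wedge (dx k) (partial k alpha x).

Definition bracket X Y : 'rV[R]_n -> 'rV[R]_n :=
  fun x => 'D_(X x) Y x - 'D_(Y x) X x.

(* The derivation of the exterior algebra with L_Y h = Y h on functions and
   L_Y dx^j = dY^j = \sum_k (d_k Y^j) dx^k. *)
Definition lie Y alpha : 'rV[R]_n -> form R n :=
  fun x => 'D_(Y x) alpha x
           + \sum_k wedge (dx k) (iprod (partial k Y x) (alpha x)).

End LocalCalculus.

(* A smooth oriented n-manifold without boundary, presented by an oriented
   smooth atlas.  [coords i] is a homeomorphism from the open set [dom i] onto
   the open set [im i] of R^n, with inverse [param i]; the values of [coords i]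
   and [param i] outside these sets are irrelevant. *)
Record omanifold (R : realType) (n : nat) := OManifold {
  points :> topologicalType ;
  points_hausdorff : hausdorff_space points ;
  points_second_countable : @second_countable points ;
  chart : Type ;
  dom : chart -> set points ;
  im : chart -> set 'rV[R]_n ;
  coords : chart -> points -> 'rV[R]_n ;
  param : chart -> 'rV[R]_n -> points ;
  dom_open : forall i, open (dom i) ;
  im_open : forall i, open (im i) ;
  dom_cover : forall p, exists i, dom i p ;
  coords_im : forall i p, dom i p -> im i (coords i p) ;
  param_dom : forall i x, im i x -> dom i (param i x) ;
  coordsK : forall i p, dom i p -> param i (coords i p) = p ;
  paramK : forall i x, im i x -> coords i (param i x) = x ;
  coords_continuous : forall i p, dom i p -> {for p, continuous (coords i)} ;
  param_continuous : forall i x, im i x -> {for x, continuous (param i)} ;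
  transition_smooth : forall i j,
    smooth_on (im i `&` param i @^-1` dom j) (coords j \o param i) ;
  transition_oriented : forall i j x, im i x -> dom j (param i x) ->
    0 < \det (jacobian (coords j \o param i) x)
}.

Section TensorFields.
Context {R : realType} {n : nat} (M : omanifold R n).

(* Tensor fields are given by their coordinate expressions in the charts;
   only the values on [im i] are meaningful. *)
Definition form_field := chart M -> 'rV[R]_n -> form R n.
Definition vector_field := chart M -> 'rV[R]_n -> 'rV[R]_n.

Definition pointwise (P : chart M -> 'rV[R]_n -> Prop) :=
  forall i x, im i x -> P i x.

Definition transition (i j : chart M) : 'rV[R]_n -> 'rV[R]_n :=
  coords j \o param i.

Definition smooth_form (alpha : form_field) :=
  (forall i, smooth_on (im i) (alpha i)) /\
  (forall i j x, im i x -> dom j (param i x) ->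
     alpha i x = pullback ('d (transition i j) x) (alpha j (transition i j x))).

Definition smooth_vector_field (Y : vector_field) :=
  (forall i, smooth_on (im i) (Y i)) /\
  (forall i j x, im i x -> dom j (param i x) ->
     Y j (transition i j x) = 'd (transition i j) x (Y i x)).

Definition closed_form (alpha : form_field) :=
  pointwise (fun i x => extd (alpha i) x = 0).

Definition smooth_homog_form k (alpha : form_field) :=
  smooth_form alpha /\ pointwise (fun i x => homog k (alpha i x)).
Definition smooth_even_form (alpha : form_field) :=
  smooth_form alpha /\ pointwise (fun i x => even_form (alpha i x)).
Definition smooth_odd_form (alpha : form_field) :=
  smooth_form alpha /\ pointwise (fun i x => odd_form (alpha i x)).

Definition positive_volume_form (phi : form_field) :=
  smooth_homog_form n phi /\ pointwise (fun i x => 0 < coef (phi i x) [set: 'I_n]%SET).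

Definition preserves (Y : vector_field) (alpha : form_field) :=
  pointwise (fun i x => lie (Y i) (alpha i) x = 0).

Definition commuting (Y Z : vector_field) :=
  pointwise (fun i x => bracket (Y i) (Z i) x = 0).

End TensorFields.

(* The algebra of the fibre: T = R^5, elements of T + T^* are pairs (X, xi),
   and Lambda^5 T^* is identified with R by the basis dx^1 /\ ... /\ dx^5. *)
Section Spinors.
Context {R : realType}.
Local Notation E := 'rV[R]_5.
Local Notation L := (form R 5).
Implicit Types (v w : E * E) (phi psi : L) (rho : L * L).

Definition inner v w : R :=
  2^-1 * (\sum_k v.1 ord0 k * w.2 ord0 k + \sum_k w.1 ord0 k * v.2 ord0 k).

Definition clifford v phi : L :=
  iprod v.1 phi + wedge (covector v.2) phi.

Definition sigma phi : L := mkform (fun I => (-1) ^+ (#|I| ./2) * coef phi I).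

Definition mukai phi psi : R := coef (wedge phi (sigma psi)) [set: 'I_5]%SET.

(* See Q_spec for the defining property. *)
Definition Q phi : E * E :=
  (\row_k (2 * mukai (clifford (0, delta_mx ord0 k) phi) phi),
   \row_k (2 * mukai (clifford (delta_mx ord0 k, 0) phi) phi)).

Definition quartic rho : R := inner (Q rho.1) (Q rho.2).

Definition vol_density rho : R := Num.sqrt (quartic rho).

Definition vol rho : L := vol_density rho *: mkform (fun I => (I == [set: 'I_5]%SET)%:R).

(* Spin(5,5) consists of the products of an even number of vectors of norm 1
   or -1. *)
Definition spin_word (vs : seq (E * E)) :=
  ~~ odd (size vs) /\ (forall v, v \in vs -> inner v v = 1 \/ inner v v = -1).

Definition spin_act (vs : seq (E * E)) phi : L := foldr clifford phi vs.

Definition mix (A : 'M[R]_2) rho : L * L :=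
  (A 0 0 *: rho.1 + A 0 1 *: rho.2, A 1 0 *: rho.1 + A 1 1 *: rho.2).

Definition even_pairs : set (L * L) :=
  [set rho | even_form rho.1 /\ even_form rho.2].

Definition spin_gl2_orbit rho : set (L * L) :=
  [set rho' | exists vs (A : 'M[R]_2), [/\ spin_word vs, A \in unitmx &
     rho' = mix A (spin_act vs rho.1, spin_act vs rho.2)]].

(* rho belongs to an orbit which is open for the subspace topology of
   Lambda^ev (x) R^2. *)
Definition in_open_orbit rho :=
  even_pairs rho /\
  exists2 U : set (L * L), open U & spin_gl2_orbit rho = U `&` even_pairs.

(* The derivative of the volume at rho is
   rho' |-> <h.2, rho'.1> - <h.1, rho'.2>. *)
Definition is_hat rho (h : L * L) :=
  forall rho', even_pairs rho' ->
    is_derive rho rho' vol_density (mukai h.2 rho'.1 - mukai h.1 rho'.2).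

End Spinors.

Section QSpec.
Context {R : realType}.

Let iprod_sum (X : 'rV[R]_5) (phi : form R 5) :
  iprod X phi = \sum_k X ord0 k *: iprod (delta_mx ord0 k) phi.
Proof.
apply/rowP => c; rewrite summxE mxE [LHS]big_mkcond; apply: eq_bigr => k _.
rewrite !mxE; case: ifP => kI; last first.
  rewrite big1 ?mulr0// => j jI; rewrite !mxE eqxx/=.
  by case: eqP jI => [->|]; rewrite ?kI// mulr0 mul0r.
rewrite (bigD1 k) ?kI//= big1 ?addr0 => [|j /andP[_ jk]].
  by rewrite mxE !eqxx mulr1 mulrCA mulrA.
by rewrite mxE eqxx (negPf jk) mulr0 mul0r.
Qed.

Let covector_delta (k : 'I_5) : covector (delta_mx ord0 k) = dx k :> form R 5.
Proof.
rewrite /covector (bigD1 k)//= big1 ?addr0 => [|j jk].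
  by rewrite mxE !eqxx scale1r.
by rewrite mxE eqxx (negPf jk) scale0r.
Qed.

Let wedge_lin n (a b c : form R n) s :
  wedge (s *: a + b) c = s *: wedge a c + wedge b c.
Proof.
apply/rowP => i; rewrite !mxE mulr_sumr -big_split; apply: eq_bigr => J _ /=.
by rewrite coefD coefZ mulrDr mulrDl; congr (_ + _); rewrite !mulrA (mulrC _ s).
Qed.

Let iprod0 (phi : form R 5) : iprod 0 phi = 0.
Proof.
by apply/rowP => i; rewrite !mxE big1// => k _; rewrite mxE mulr0 mul0r.
Qed.

Let covector0 : covector (0 : 'rV[R]_5) = 0.
Proof. by rewrite /covector big1// => k _; rewrite mxE scale0r. Qed.

Let wedge0 n (c : form R n) : wedge 0 c = 0.
Proof.
by apply/rowP => i; rewrite !mxE big1// => k _; rewrite /coef mxE mulr0 mul0r.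
Qed.

(* Q phi is determined by this, the inner product being nondegenerate. *)
Lemma Q_spec (phi : form R 5) v :
  inner (Q phi) v = mukai (clifford v phi) phi.
Proof.
have mukai_lin s (a b : form R 5) :
    mukai (s *: a + b) phi = s * mukai a phi + mukai b phi.
  by rewrite /mukai wedge_lin coefD coefZ.
have mukai0 : mukai 0 phi = 0 by rewrite /mukai wedge0 /coef mxE.
have mukai_sum (F : 'I_5 -> form R 5) (s : 'I_5 -> R) :
    mukai (\sum_k s k *: F k) phi = \sum_k s k * mukai (F k) phi.
  elim/big_ind2: _ => // [a x b y <- <-|k _].
    by have := mukai_lin 1 x y; rewrite scale1r mul1r.
  by have := mukai_lin (s k) (F k) 0; rewrite mukai0 !addr0.
have wedge_sum (F : 'I_5 -> form R 5) (s : 'I_5 -> R) :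
    wedge (\sum_k s k *: F k) phi = \sum_k s k *: wedge (F k) phi.
  elim/big_ind2: _ => [|a x b y <- <-|k _]; first exact: wedge0.
    by have := wedge_lin x y phi 1; rewrite !scale1r.
  by have := wedge_lin (F k) 0 phi (s k); rewrite wedge0 !addr0.
have -> : mukai (clifford v phi) phi =
    mukai (iprod v.1 phi) phi + mukai (wedge (covector v.2) phi) phi.
  by have := mukai_lin 1 (iprod v.1 phi) (wedge (covector v.2) phi);
     rewrite scale1r mul1r.
rewrite iprod_sum mukai_sum /covector wedge_sum mukai_sum /inner addrC.
rewrite mulrDr !mulr_sumr /=; congr (_ + _); apply: eq_bigr => k _;
  rewrite !mxE /clifford /= ?covector_delta ?covector0 ?wedge0 ?iprod0
    ?addr0 ?add0r.
- by rewrite mulrCA mulKf ?pnatr_eq0.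
- by rewrite -mulrA mulKf ?pnatr_eq0// mulrC.
Qed.

End QSpec.

Section Structures.
Context {R : realType} (M : omanifold R 5).
Implicit Types (omega phi : form_field M) (Y : vector_field M).

Definition stable_positive (rho1 rho2 : form_field M) :=
  pointwise (fun i x => in_open_orbit (rho1 i x, rho2 i x)
                        /\ 0 < quartic (rho1 i x, rho2 i x)).

Definition variational_solution (rho1 rho2 : form_field M) :=
  [/\ closed_form rho1, closed_form rho2 &
    exists h1 h2 : form_field M,
      [/\ smooth_odd_form h1, smooth_odd_form h2,
          pointwise (fun i x => is_hat (rho1 i x, rho2 i x) (h1 i x, h2 i x)),
          closed_form h1 & closed_form h2]].

Definition degree0_nonzero (rho1 rho2 : form_field M) :=
  exists i x, im i x /\
    (coef (rho1 i x) finset.set0 != 0 \/ coef (rho2 i x) finset.set0 != 0).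

Definition critical_structure (rho1 rho2 : form_field M) :=
  [/\ smooth_even_form rho1, smooth_even_form rho2, stable_positive rho1 rho2,
      variational_solution rho1 rho2 & degree0_nonzero rho1 rho2].

(* omega(Y1, Y2) is the degree 0 part of i_{Y2} i_{Y1} omega. *)
Definition reduced_data omega phi (Y1 Y2 : vector_field M) :=
  [/\ [/\ smooth_homog_form 2%N omega, closed_form omega
        & positive_volume_form phi],
      [/\ smooth_vector_field Y1, smooth_vector_field Y2 & commuting Y1 Y2],
      [/\ preserves Y1 omega, preserves Y2 omega,
          preserves Y1 phi & preserves Y2 phi]
    & pointwise (fun i x =>
        coef (iprod (Y2 i x) (iprod (Y1 i x) (omega i x))) finset.set0
        = - (1 / 8))].

Definition std1 omega phi Y : form_field M :=
  fun i x => omega i x + iprod (Y i x) (phi i x).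

Definition std2 phi Y : form_field M :=
  fun i x => unit_form + iprod (Y i x) (phi i x).

(* The action of A in SL(2,R), followed by that of the 2-form B. *)
Definition transform (A : 'M[R]_2) (B rho1 rho2 : form_field M)
    (i : chart M) (x : 'rV[R]_5) : form R 5 * form R 5 :=
  let r := mix A (rho1 i x, rho2 i x) in
  (wedge (exp_form (B i x)) r.1, wedge (exp_form (B i x)) r.2).

End Structures.

(* Main.v *)
(* Everything reduces to the linear algebra of the half-spin representation.
   The derivative of the volume is hat rho_1 = - Q(rho_1).rho_2 / phi and
   hat rho_2 = Q(rho_2).rho_1 / phi.  As d rho = 0, the degree zero parts of
   rho are constants, so an element of SL(2,R) turns them into (0, 1), and
   B = - (degree 2 part of rho_2) is closed and brings rho to the form
   (omega + i_{Y1} phi, 1 + i_{Y2} phi).  There the quartic invariant equals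
   - 8 omega(Y1, Y2) phi^2, whence the value - 1/8, and
     hat rho_1 = 4 i_{Y1} omega - 2 i_{Y2} (omega /\ omega) - phi / 2,
     hat rho_2 = 4 (i_{Y2} omega + i_{Y2} i_{Y1} phi).
   By Cartan's formula, closedness of the homogeneous components of rho and
   hat rho says exactly that Y1 and Y2 preserve omega and phi and that
   i_{[Y1, Y2]} phi = 0, that is [Y1, Y2] = 0.
   The orbits in question are open because any even pair with positive quartic
   invariant and nonzero degree zero part of rho_2 is in the orbit of one
   canonical pair; these conditions, imposed on some translate, are open. *)

Require Import Defs.
From HB Require Import structures.
From mathcomp Require Import all_boot all_order all_algebra.
From mathcomp Require Import all_classical all_reals all_analysis.
From mathcomp Require Import fingroup perm ring lra zify.
Require Import Defs.

Set Implicit Arguments.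
Unset Strict Implicit.
Unset Printing Implicit Defensive.

Import Order.TTheory GRing.Theory Num.Theory.
Import numFieldNormedType.Exports.

Local Open Scope classical_set_scope.
Local Open Scope ring_scope.

(** The hats of a solution are given only through derivatives of [vol_density] along even pairs, so
    they must be identified before their closedness can be used. [mukai_nondegenerate] makes odd
    hats unique, and invariance of the volume under matrices of determinant 1 and under [exp_form]
    transports them to the normal form, where they are explicit. The GL(2) covariance of the quartic
    comes from a single fact: [Q phi] is null for every even [phi], because a 2-form in dimension 5
    has zero cube; polarising this identity yields the factor [\det A] squared. The vector fields
    are recovered by inverting contraction with the volume. Their transformation law needs the
    quartic to scale by the square of the Jacobian determinant, and its root to scale by the
    determinant itself, which is where the orientation enters. The degree zero condition on the
    second form is not invariant under the spin group; openness of the orbit therefore uses a union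
    over translates. The canonical pair is reached by shears, one bivector, and a torus. *)

(** * Exterior algebra in coordinates: wedge, contraction, degree, top forms *)

Section Exterior.
Context {R : realType} {n : nat}.
Implicit Types (a b c : form R n) (I J K : {set 'I_n}) (X Y : 'rV[R]_n).

Lemma formP a b : (forall I, coef a I = coef b I) -> a = b.
Proof.
by move=> ab; apply/rowP => i; have := ab (enum_val i); rewrite /coef enum_valK.
Qed.

Lemma coef0 I : coef (0 : form R n) I = 0. Proof. by rewrite /coef mxE. Qed.

Lemma coefN a I : coef (- a) I = - coef a I. Proof. by rewrite /coef mxE. Qed.

Lemma coefB a b I : coef (a - b) I = coef a I - coef b I.
Proof. by rewrite coefD coefN. Qed.

Lemma coef_sum (T : Type) (r : seq T) (P : pred T) (F : T -> form R n) I :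
  coef (\sum_(i <- r | P i) F i) I = \sum_(i <- r | P i) coef (F i) I.
Proof. by rewrite /coef summxE. Qed.

Lemma coef_wedge a b I : coef (wedge a b) I =
  \sum_(J : {set 'I_n} | J \subset I)
    shuffle_sign J (I :\: J) * coef a J * coef b (I :\: J).
Proof. exact: coef_mkform. Qed.

Lemma coef_iprod X a I : coef (iprod X a) I =
  \sum_(k | k \notin I) shuffle_sign [set k]%SET I * X ord0 k * coef a (k |: I)%SET.
Proof. exact: coef_mkform. Qed.

Lemma coef_unit I : coef (unit_form : form R n) I = (I == finset.set0)%:R.
Proof. exact: coef_mkform. Qed.

Lemma coef_dx k I : coef (dx k : form R n) I = (I == [set k]%SET)%:R.
Proof. exact: coef_mkform. Qed.

Lemma wedgeDl a b c : wedge (a + b) c = wedge a c + wedge b c.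
Proof.
apply/formP => I; rewrite coefD !coef_wedge -big_split; apply: eq_bigr => J _ /=.
by rewrite coefD mulrDr mulrDl.
Qed.

Lemma wedgeDr a b c : wedge a (b + c) = wedge a b + wedge a c.
Proof.
apply/formP => I; rewrite coefD !coef_wedge -big_split; apply: eq_bigr => J _ /=.
by rewrite coefD mulrDr.
Qed.

Lemma wedgeZl t a b : wedge (t *: a) b = t *: wedge a b.
Proof.
apply/formP => I; rewrite coefZ !coef_wedge mulr_sumr; apply: eq_bigr => J _ /=.
by rewrite coefZ !mulrA (mulrC _ t).
Qed.

Lemma wedgeZr t a b : wedge a (t *: b) = t *: wedge a b.
Proof.
apply/formP => I; rewrite coefZ !coef_wedge mulr_sumr; apply: eq_bigr => J _ /=.
by rewrite coefZ mulrCA.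
Qed.

Fact wedge_is_linear a : linear (wedge a).
Proof. by move=> t x y; rewrite wedgeDr wedgeZr. Qed.
HB.instance Definition _ a :=
  GRing.isLinear.Build R (form R n) (form R n) *:%R (wedge a) (wedge_is_linear a).

Definition wedgel b a := wedge a b.
Fact wedgel_is_linear b : linear (wedgel b).
Proof. by move=> t x y; rewrite /wedgel wedgeDl wedgeZl. Qed.
HB.instance Definition _ b :=
  GRing.isLinear.Build R (form R n) (form R n) *:%R (wedgel b) (wedgel_is_linear b).

Fact iprod_is_linear X : linear (iprod X : form R n -> form R n).
Proof.
move=> t x y; apply/formP => I; rewrite coefD coefZ !coef_iprod mulr_sumr -big_split.
by apply: eq_bigr => k _ /=; rewrite coefD coefZ mulrDr mulrCA.
Qed.
HB.instance Definition _ X :=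
  GRing.isLinear.Build R (form R n) (form R n) *:%R (iprod X) (iprod_is_linear X).

Definition iprodl a X : form R n := iprod X a.
Fact iprodl_is_linear a : linear (iprodl a).
Proof.
move=> t x y; apply/formP => I; rewrite coefD coefZ !coef_iprod mulr_sumr -big_split.
apply: eq_bigr => k _ /=; rewrite !mxE mulrDr mulrDl; congr (_ + _).
by rewrite !mulrA (mulrC _ t).
Qed.
HB.instance Definition _ a :=
  GRing.isLinear.Build R 'rV[R]_n (form R n) *:%R (iprodl a) (iprodl_is_linear a).

Lemma wedge0l b : wedge 0 b = 0. Proof. exact: (linear0 (wedgel b)). Qed.
Lemma wedgeNl a b : wedge (- a) b = - wedge a b. Proof. exact: (linearN (wedgel b)). Qed.
Lemma wedge_suml (T : Type) (r : seq T) (P : pred T) (F : T -> form R n) b :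
  wedge (\sum_(i <- r | P i) F i) b = \sum_(i <- r | P i) wedge (F i) b.
Proof. exact: (linear_sum (wedgel b)). Qed.

Lemma iprodDl X Y a : iprod (X + Y) a = iprod X a + iprod Y a.
Proof. exact: (linearD (iprodl a)). Qed.
Lemma iprodZl t X a : iprod (t *: X) a = t *: iprod X a.
Proof. exact: (linearZ_LR (iprodl a)). Qed.
Lemma iprodNl X a : iprod (- X) a = - iprod X a.
Proof. exact: (linearN (iprodl a)). Qed.
Lemma iprod0l a : iprod 0 a = 0. Proof. exact: (linear0 (iprodl a)). Qed.
Lemma iprod_suml (T : Type) (r : seq T) (P : pred T) (F : T -> 'rV[R]_n) a :
  iprod (\sum_(i <- r | P i) F i) a = \sum_(i <- r | P i) iprod (F i) a.
Proof. exact: (linear_sum (iprodl a)). Qed.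

Lemma wedge0r a : wedge a 0 = 0. Proof. exact: linear0. Qed.
Lemma wedgeNr a b : wedge a (- b) = - wedge a b. Proof. exact: linearN. Qed.
Lemma wedge_sumr (T : Type) (r : seq T) (P : pred T) (F : T -> form R n) a :
  wedge a (\sum_(i <- r | P i) F i) = \sum_(i <- r | P i) wedge a (F i).
Proof. exact: linear_sum. Qed.

Lemma iprodDr X a b : iprod X (a + b) = iprod X a + iprod X b.
Proof. exact: linearD. Qed.
Lemma iprodZr X t a : iprod X (t *: a) = t *: iprod X a.
Proof. exact: linearZ_LR. Qed.
Lemma iprod0r X : iprod X 0 = 0 :> form R n. Proof. exact: linear0. Qed.
Lemma iprodNr X a : iprod X (- a) = - iprod X a. Proof. exact: linearN. Qed.
Lemma iprod_sumr (T : Type) (r : seq T) (P : pred T) (F : T -> form R n) X :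
  iprod X (\sum_(i <- r | P i) F i) = \sum_(i <- r | P i) iprod X (F i).
Proof. exact: linear_sum. Qed.

Fact covector_is_linear : linear (@covector R n).
Proof.
move=> t x y; rewrite /covector scaler_sumr -big_split; apply: eq_bigr => k _ /=.
by rewrite !mxE scalerDl scalerA.
Qed.
HB.instance Definition _ := GRing.isLinear.Build R 'rV[R]_n (form R n) *:%R
  (@covector R n) covector_is_linear.

Lemma covector_delta k : covector (delta_mx ord0 k) = dx k :> form R n.
Proof.
rewrite /covector (bigD1 k)//= big1 ?addr0 => [|j jk].
  by rewrite mxE !eqxx scale1r.
by rewrite mxE eqxx (negPf jk) scale0r.
Qed.

Lemma iprod_coord X a : iprod X a = \sum_k X ord0 k *: iprod (delta_mx ord0 k) a.
Proof.
rewrite {1}(row_sum_delta X) iprod_suml; apply: eq_bigr => k _.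
by rewrite iprodZl.
Qed.

Lemma wedge_covector_coord X a :
  wedge (covector X) a = \sum_k X ord0 k *: wedge (dx k) a.
Proof. by rewrite wedge_suml; apply: eq_bigr => k _; rewrite wedgeZl. Qed.

(** ** Signs *)

Definition lesser k I := #|[pred j in I | (j < k)%N]|.

(** Moving [dx k] to its place costs one sign for each smaller index of [I]. *)
Lemma shuffle_sign1 k I : shuffle_sign [set k]%SET I = (-1) ^+ lesser k I :> R.
Proof.
rewrite /shuffle_sign /lesser; congr (_ ^+ _).
rewrite -[RHS](@fintype.card_image _ _ (fun j => (k, j))); last by move=> i j [].
apply: fintype.eq_card => -[p q]; rewrite !inE /=.
apply/idP/fintype.imageP => [/and3P[/eqP-> qI lt]|[j]].
  by exists q => //; rewrite !inE qI.
by rewrite !inE => /andP[jI lt] [-> ->]; rewrite eqxx jI.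
Qed.

Lemma coef_dx_wedge k a I : coef (wedge (dx k) a) I =
  if k \in I then (-1) ^+ lesser k I * coef a (I :\ k)%SET else 0.
Proof.
rewrite coef_wedge; case: ifP => kI.
  rewrite (bigD1 [set k]%SET) ?finset.sub1set //= big1 ?addr0 => [|J /andP[_ Jk]].
    rewrite coef_dx eqxx mulr1 shuffle_sign1; congr (_ ^+ _ * _).
    apply: fintype.eq_card => j; rewrite !inE; case: eqP => [->|//].
    by rewrite ltnn !andbF.
  by rewrite coef_dx (negPf Jk) mulr0 mul0r.
rewrite big1 // => J JI; rewrite coef_dx; case: eqP => [Jk|]; last by rewrite mulr0 mul0r.
by move: JI; rewrite Jk finset.sub1set kI.
Qed.

Lemma coef_iprod_delta k a I : coef (iprod (delta_mx ord0 k) a) I =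
  if k \in I then 0 else (-1) ^+ lesser k I * coef a (k |: I)%SET.
Proof.
rewrite coef_iprod; case: ifPn => kI.
  rewrite big1 // => j jI; rewrite mxE eqxx /=; case: eqP => [jk|]; last by rewrite mulr0 mul0r.
  by rewrite -jk (negPf jI) in kI.
rewrite (bigD1 k) //= big1 ?addr0 => [|j /andP[_ jk]].
  by rewrite mxE !eqxx mulr1 shuffle_sign1.
by rewrite mxE eqxx (negPf jk) mulr0 mul0r.
Qed.

Lemma lesserD1 k l I : l \in I -> lesser k I = ((l < k)%N + lesser k (I :\ l)%SET)%N.
Proof.
move=> lI; rewrite /lesser; case: (boolP (l < k)%N) => lk; last first.
  apply: fintype.eq_card => j; rewrite !inE; case: (eqVneq j l) => [->|//].
  by rewrite (negPf lk) !andbF.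
rewrite (cardD1 l) !inE lI lk /=; congr addn.
by apply: fintype.eq_card => j; rewrite !inE; case: eqP.
Qed.

Lemma lesserU1 k l I : l \notin I -> lesser k (l |: I)%SET = ((l < k)%N + lesser k I)%N.
Proof.
by move=> lI; rewrite (@lesserD1 k l) ?setU11 // finset.setU1K.
Qed.

(** Exactly one of the two comparisons holds; this is the source of every anticommutation sign
    below. *)
Lemma signltC (k l : 'I_n) : k != l -> (-1) ^+ (k < l)%N = - (-1) ^+ (l < k)%N :> R.
Proof.
move=> kl; have [lt|lt|e] := ltngtP k l; last by rewrite (val_inj e) eqxx in kl.
  by rewrite expr0 expr1.
by rewrite expr0 expr1 opprK.
Qed.

Lemma dxC k l a : wedge (dx k) (wedge (dx l) a) = - wedge (dx l) (wedge (dx k) a).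
Proof.
apply/formP => I; rewrite coefN !coef_dx_wedge !inE.
have [->|kl] := eqVneq k l; first by rewrite ?eqxx /= mulr0 !if_same oppr0.
rewrite /=; case kI: (k \in I); case lI: (l \in I); rewrite ?mulr0 ?oppr0 //.
rewrite (@lesserD1 k l I lI) (@lesserD1 l k I kI) finset.setDDl finset.setUC -finset.setDDl.
rewrite !exprD (signltC kl) -!mulrA mulNr opprK; congr (_ * _).
by rewrite mulrCA.
Qed.

Lemma dxx k a : wedge (dx k) (wedge (dx k) a) = 0.
Proof. by apply/formP => I; rewrite coef0 !coef_dx_wedge !inE eqxx /= mulr0 if_same. Qed.

Lemma deltaC k l a : iprod (delta_mx ord0 k) (iprod (delta_mx ord0 l) a) =
  - iprod (delta_mx ord0 l) (iprod (delta_mx ord0 k) a).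
Proof.
apply/formP => I; rewrite coefN !coef_iprod_delta !inE.
have [->|kl] := eqVneq k l; first by rewrite ?eqxx /= mulr0 !if_same oppr0.
rewrite /=.
case kI: (k \in I); case lI: (l \in I); rewrite ?mulr0 ?oppr0 //=.
rewrite (@lesserU1 l k) ?kI // (@lesserU1 k l) ?lI // finset.setUCA.
by rewrite !exprD (signltC kl); ring.
Qed.

Lemma dx_delta k l a : iprod (delta_mx ord0 k) (wedge (dx l) a) =
  (k == l)%:R *: a - wedge (dx l) (iprod (delta_mx ord0 k) a).
Proof.
apply/formP => I; rewrite coefB coefZ coef_iprod_delta !coef_dx_wedge coef_iprod_delta !inE.
have [->|kl] := eqVneq k l.
  rewrite ?eqxx /= mul1r; case: ifPn => lI.
    rewrite (@lesserD1 l l I lI) ltnn add0n finset.setD1K //.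
    by rewrite mulrA -exprD -signr_odd oddD addbb expr0 mul1r subrr.
  rewrite lesserU1 // ltnn subr0 finset.setU1K //.
  by rewrite mulrA -exprD -signr_odd oddD addbb expr0 mul1r.
rewrite /= mul0r sub0r.
case kI: (k \in I); case lI: (l \in I); rewrite ?mulr0 ?oppr0 //=.
rewrite (@lesserU1 l k) ?kI // (@lesserD1 k l I lI).
rewrite !exprD (signltC kl).
have -> : ((k |: I) :\ l = k |: I :\ l)%SET.
  by apply/setP => j; rewrite !inE; case: eqP => [->|]; rewrite ?(eq_sym l k) ?(negPf kl).
have e2 : (-1) ^+ (l < k)%N * (-1) ^+ (l < k)%N = 1 :> R.
  by rewrite -exprD addnn -mul2n exprM sqrrN !expr1n.
by rewrite -[RHS]mul1r -[X in _ = X * _]e2; ring.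
Qed.

Definition dot (x y : 'rV[R]_n) : R := \sum_k x ord0 k * y ord0 k.

Lemma dotC x y : dot x y = dot y x.
Proof. by apply: eq_bigr => k _; rewrite mulrC. Qed.

Fact dot_is_linear x : linear_for *%R (dot x).
Proof.
move=> t y z; rewrite /dot mulr_sumr -big_split; apply: eq_bigr => k _ /=.
by rewrite !mxE mulrDr mulrCA.
Qed.
HB.instance Definition _ x :=
  GRing.isLinear.Build R 'rV[R]_n R *%R (dot x) (dot_is_linear x).

Lemma dot_delta x k : dot x (delta_mx ord0 k) = x ord0 k.
Proof.
rewrite /dot (bigD1 k) //= big1 ?addr0 => [|j jk]; first by rewrite mxE !eqxx mulr1.
by rewrite mxE eqxx (negPf jk) mulr0.
Qed.

Lemma covectorC x y a : wedge (covector x) (wedge (covector y) a) =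
  - wedge (covector y) (wedge (covector x) a).
Proof.
have dy k : wedge (dx k) (wedge (covector y) a) = - wedge (covector y) (wedge (dx k) a).
  rewrite !wedge_covector_coord wedge_sumr -sumrN; apply: eq_bigr => l _.
  by rewrite !wedgeZr dxC scalerN.
rewrite [LHS]wedge_covector_coord (wedge_covector_coord x a) wedge_sumr -sumrN.
by apply: eq_bigr => k _; rewrite dy wedgeZr scalerN.
Qed.

Lemma eqN0 (V : lmodType R) (v : V) : v = - v -> v = 0.
Proof.
move=> /eqP; rewrite -subr_eq0 opprK -mulr2n -scaler_nat scaler_eq0 pnatr_eq0 /=.
by move/eqP.
Qed.

Lemma covector_sqr x a : wedge (covector x) (wedge (covector x) a) = 0.
Proof. by apply: eqN0; apply: covectorC. Qed.

Lemma iprodC X Y a : iprod X (iprod Y a) = - iprod Y (iprod X a).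
Proof.
have dy k : iprod (delta_mx ord0 k) (iprod Y a) = - iprod Y (iprod (delta_mx ord0 k) a).
  rewrite !(iprod_coord Y) iprod_sumr -sumrN; apply: eq_bigr => l _.
  by rewrite iprodZr deltaC scalerN.
rewrite [LHS]iprod_coord (iprod_coord X a) iprod_sumr -sumrN.
by apply: eq_bigr => k _; rewrite dy iprodZr scalerN.
Qed.

Lemma iprod_sqr X a : iprod X (iprod X a) = 0.
Proof. by apply: eqN0; apply: iprodC. Qed.

Lemma iprod_covector X y a : iprod X (wedge (covector y) a) =
  dot X y *: a - wedge (covector y) (iprod X a).
Proof.
have dX l : iprod X (wedge (dx l) a) = X ord0 l *: a - wedge (dx l) (iprod X a).
  rewrite (iprod_coord X (wedge _ _)) (iprod_coord X a) wedge_sumr.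
  transitivity (\sum_k ((X ord0 k * (k == l)%:R) *: a
                        - wedge (dx l) (X ord0 k *: iprod (delta_mx ord0 k) a))).
    by apply: eq_bigr => k _; rewrite dx_delta scalerBr scalerA wedgeZr.
  rewrite sumrB -scaler_suml; congr (_ *: _ - _).
  rewrite (bigD1 l) //= eqxx mulr1 big1 ?addr0 // => k kl.
  by rewrite (negPf kl) mulr0.
rewrite (wedge_covector_coord y a) (wedge_covector_coord y (iprod _ _)) iprod_sumr.
rewrite /dot scaler_suml -sumrB; apply: eq_bigr => l _ /=.
by rewrite iprodZr dX scalerBr scalerA mulrC.
Qed.

Lemma iprod_dx X k a : iprod X (wedge (dx k) a) = X ord0 k *: a - wedge (dx k) (iprod X a).
Proof. by rewrite -covector_delta iprod_covector dot_delta. Qed.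

Definition basis_form I : form R n := mkform (fun J => (J == I)%:R).

Lemma coef_basis I J : coef (basis_form I) J = (J == I)%:R.
Proof. exact: coef_mkform. Qed.

Lemma form_basis a : a = \sum_(I : {set 'I_n}) coef a I *: basis_form I.
Proof.
apply/formP => J; rewrite coef_sum (bigD1 J) //= big1 ?addr0 => [|I IJ].
  by rewrite coefZ coef_basis eqxx mulr1.
by rewrite coefZ coef_basis eq_sym (negPf IJ) mulr0.
Qed.

Lemma basis_formD1 k I : k \in I ->
  basis_form I = (-1) ^+ lesser k I *: wedge (dx k) (basis_form (I :\ k)%SET).
Proof.
move=> kI; apply/formP => J; rewrite coefZ coef_dx_wedge !coef_basis.
case: eqVneq => [->|JI].
  by rewrite kI eqxx mulr1 -exprD addnn -mul2n exprM sqrrN !expr1n.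
case: ifP => kJ; last by rewrite mulr0.
case: eqP => [e|]; last by rewrite !mulr0.
by rewrite -(finset.setD1K kJ) e finset.setD1K ?eqxx in JI.
Qed.

Lemma basis_form0 : basis_form finset.set0 = unit_form.
Proof. by []. Qed.

(** Basis forms are iterated products of the [dx k] up to sign, so a statement linear in one form
    reduces to [unit_form] and to an extra factor [dx k]. Associativity, the Leibniz rules and
    naturality of pullback are all proved this way, without handling general shuffle signs. *)
Lemma form_ind (P : form R n -> Prop) :
  (forall t a b, P a -> P b -> P (t *: a + b)) -> P unit_form ->
  (forall k a, P a -> P (wedge (dx k) a)) -> forall a, P a.
Proof.
move=> Plin P1 Pdx a.
have P0 : P 0 by have := Plin (-1) _ _ P1 P1; rewrite scaleN1r addNr.
rewrite (form_basis a); elim/big_rec: _ => // I b _; apply: (Plin).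
have [m] := ubnP #|I|; elim: m I => // m IH I Im.
have [->|/set0Pn[k kI]] := eqVneq I finset.set0; first by rewrite basis_form0.
rewrite (basis_formD1 kI) -[X in P X]addr0; apply: Plin => //; apply: Pdx; apply: IH.
by rewrite (cardsD1 k) kI in Im.
Qed.

Lemma shuffle_signE J K : shuffle_sign J K = (-1) ^+ (\sum_(j in J) lesser j K) :> R.
Proof.
rewrite /shuffle_sign; congr (_ ^+ _); rewrite -sum1_card.
under [RHS]eq_bigr => j _ do rewrite /lesser -sum1_card.
by rewrite pair_big_dep; apply: eq_bigl => -[p q]; rewrite !inE.
Qed.

Lemma shuffle_signU1 k J K : k \notin J ->
  shuffle_sign (k |: J)%SET K = (-1) ^+ lesser k K * shuffle_sign J K :> R.
Proof. by move=> kJ; rewrite !shuffle_signE big_setU1 //= exprD. Qed.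

Lemma lesser_split k I J : J \subset I ->
  lesser k I = (lesser k J + lesser k (I :\: J))%N.
Proof.
move=> JI; rewrite /lesser -!sum1_card [LHS](bigID (mem J)) /=; congr addn.
  apply: eq_bigl => j; rewrite !inE; case jJ: (j \in J); last by rewrite andbF.
  by rewrite (fintype.subsetP JI _ jJ) andbT.
by apply: eq_bigl => j; rewrite !inE; case: (j \in J); rewrite ?andbF ?andbT.
Qed.

(** The one case of associativity checked on coefficients. The signs agree because the indices of
    [I] below [k] split between the two factors ([lesser_split]). *)
Lemma dx_wedgeA k a b : wedge (wedge (dx k) a) b = wedge (dx k) (wedge a b).
Proof.
apply/formP => I; rewrite coef_dx_wedge coef_wedge; case: ifPn => kI; last first.
  rewrite big1 // => J JI; rewrite coef_dx_wedge ifN ?mulr0 ?mul0r //.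
  by apply: contra kI; apply: (fintype.subsetP JI).
rewrite coef_wedge mulr_sumr.
rewrite (bigID (fun J : {set 'I_n} => k \in J)) /= [X in _ + X]big1 ?addr0; last first.
  by move=> J /andP[_ kJ]; rewrite coef_dx_wedge (negPf kJ) mulr0 mul0r.
(* Only subsets containing [k] contribute on the left; removing [k] matches them with the subsets of
   [I] minus [k]. *)
rewrite (reindex_onto (fun J => k |: J)%SET (fun J => J :\ k)%SET) /=; last first.
  by move=> J /andP[_ kJ]; rewrite finset.setD1K.
apply: eq_big => [J|J].
  rewrite finset.setU11 andbT finset.subUset finset.sub1set kI /= finset.subsetD1.
  case kJ: (k \in J); last by rewrite finset.setU1K ?kJ // eqxx.
  rewrite !andbF; apply/negbTE/negP => /andP[_ /eqP e].
  by have := setD11 k (k |: J)%SET; rewrite e kJ.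
rewrite finset.setU11 andbT => /andP[JI /eqP e].
have kJ : k \notin J by rewrite -e setD11.
rewrite coef_dx_wedge finset.setU11 e shuffle_signU1 // -finset.setDDl.
have -> : lesser k I = (lesser k (k |: J)%SET + lesser k (I :\ k :\: J)%SET)%N.
  by rewrite finset.setDDl; apply: lesser_split.
by rewrite exprD; ring.
Qed.

Lemma wedge1l a : wedge unit_form a = a.
Proof.
apply/formP => I; rewrite coef_wedge (bigD1 finset.set0) ?finset.sub0set //= big1 => [|J].
  by rewrite coef_unit eqxx shuffle_signE finset.big_set0 finset.setD0 !mul1r addr0.
by case/andP=> _ J0; rewrite coef_unit (negPf J0) mulr0 mul0r.
Qed.

Lemma wedgeA a b c : wedge (wedge a b) c = wedge a (wedge b c).
Proof.
elim/form_ind: a => [t a a' IH IH'||k a IH]; last by rewrite !dx_wedgeA IH.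
  by rewrite !wedgeDl !wedgeZl IH IH'.
by rewrite !wedge1l.
Qed.

Lemma wedge1r a : wedge a unit_form = a.
Proof.
elim/form_ind: a => [t a a' IH IH'||k a IH]; last by rewrite dx_wedgeA IH.
  by rewrite wedgeDl wedgeZl IH IH'.
by rewrite wedge1l.
Qed.

Lemma iprod1 X : iprod X unit_form = 0.
Proof.
apply/formP => I; rewrite coef0 coef_iprod big1 // => k _; rewrite coef_unit.
case: eqP => [e|]; last by rewrite mulr0.
by have := finset.setU11 k I; rewrite e finset.in_set0.
Qed.

(** ** Degree *)

Definition dscale (g : nat -> R) a : form R n := mkform (fun I => g #|I| * coef a I).

Lemma coef_dscale g a I : coef (dscale g a) I = g #|I| * coef a I.
Proof. exact: coef_mkform. Qed.

Fact dscale_is_linear g : linear (dscale g).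
Proof.
by move=> t a b; apply/formP => I; rewrite !(coefD, coefZ, coef_dscale) mulrDr mulrCA.
Qed.
HB.instance Definition _ g :=
  GRing.isLinear.Build R (form R n) (form R n) *:%R (dscale g) (dscale_is_linear g).

Lemma dscaleP g t a b : dscale g (t *: a + b) = t *: dscale g a + dscale g b.
Proof. exact: linearP. Qed.

(** One operator covers the projection to a degree, the grading involution and [sigma]; an operation
    that changes the degree by one merely shifts [g]. *)
Lemma dscale_dx g k a : dscale g (wedge (dx k) a) = wedge (dx k) (dscale (g \o succn) a).
Proof.
apply/formP => I; rewrite coef_dscale !coef_dx_wedge coef_dscale.
case: ifP => kI; last by rewrite mulr0.
by rewrite /= (cardsD1 k I) kI add1n mulrCA.
Qed.

Lemma dscale_iprod g X a : iprod X (dscale g a) = dscale (g \o succn) (iprod X a).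
Proof.
apply/formP => I; rewrite coef_dscale !coef_iprod mulr_sumr; apply: eq_bigr => k kI.
by rewrite coef_dscale finset.cardsU1 kI add1n /= mulrCA.
Qed.

Lemma dscale_unit g : dscale g unit_form = g 0%N *: unit_form.
Proof.
apply/formP => I; rewrite coef_dscale coefZ coef_unit.
by case: eqP => [->|]; rewrite ?finset.cards0 // !mulr0.
Qed.

Lemma eq_dscale g h a : g =1 h -> dscale g a = dscale h a.
Proof. by move=> gh; apply/formP => I; rewrite !coef_dscale gh. Qed.

Lemma dscaleM g h a : dscale g (dscale h a) = dscale (fun p => g p * h p) a.
Proof. by apply/formP => I; rewrite !coef_dscale mulrA. Qed.

Lemma dscaleZ t g a : dscale (fun p => t * g p) a = t *: dscale g a.
Proof. by apply/formP => I; rewrite coefZ !coef_dscale mulrA. Qed.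

Lemma dscale1 a : dscale (fun=> 1) a = a.
Proof. by apply/formP => I; rewrite coef_dscale mul1r. Qed.

Lemma homogP p a : homog p a <-> dscale (fun q => (q == p)%:R) a = a.
Proof.
split=> [ha|<- I Ip]; last by rewrite coef_dscale (negPf Ip) mul0r.
apply/formP => I; rewrite coef_dscale; case: eqP => [_|/eqP Ip]; first by rewrite mul1r.
by rewrite ha ?mulr0.
Qed.

Lemma homog_dscale p g a : homog p a -> dscale g a = g p *: a.
Proof.
move=> ha; apply/formP => I; rewrite coef_dscale coefZ.
by have [->//|Ip] := eqVneq #|I| p; rewrite ha ?mulr0.
Qed.

Lemma dscale_homogl p g a b : homog p a ->
  dscale g (wedge a b) = wedge a (dscale (fun q => g (p + q)%N) b).
Proof.
move=> ha; apply/formP => I; rewrite coef_dscale !coef_wedge mulr_sumr.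
apply: eq_bigr => J JI; rewrite coef_dscale.
have [Jp|Jp] := eqVneq #|J| p; last by rewrite ha // !(mulr0, mul0r).
have -> : #|I| = (p + #|I :\: J|)%N.
  by rewrite -Jp -(cardsID J I) (finset.setIidPr JI).
by rewrite mulrCA.
Qed.

Lemma homog_wedge p q a b : homog p a -> homog q b -> homog (p + q)%N (wedge a b).
Proof.
move=> ha hb; apply/homogP; rewrite (dscale_homogl _ _ ha) (homog_dscale _ hb).
by rewrite eqxx scale1r.
Qed.

Lemma homog_iprod p X a : homog p.+1 a -> homog p (iprod X a).
Proof.
move=> /homogP ha; apply/homogP; rewrite -[in RHS]ha dscale_iprod.
by apply: eq_dscale => q; rewrite /= eqSS.
Qed.

Lemma homog0 p : homog p (0 : form R n). Proof. by move=> I _; rewrite coef0. Qed.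

Lemma homogD p a b : homog p a -> homog p b -> homog p (a + b).
Proof. by move=> ha hb I Ip; rewrite coefD ha ?hb ?addr0. Qed.

Lemma homogZ p t a : homog p a -> homog p (t *: a).
Proof. by move=> ha I Ip; rewrite coefZ ha ?mulr0. Qed.

Lemma homogN p a : homog p a -> homog p (- a).
Proof. by move=> ha I Ip; rewrite coefN ha ?oppr0. Qed.

Lemma homog_unit : homog 0%N (unit_form : form R n).
Proof. by move=> I; rewrite coef_unit cards_eq0 => /negPf->. Qed.

Lemma homog_dx k : homog 1%N (dx k : form R n).
Proof. by move=> I; rewrite coef_dx; case: (I =P _) => [->|//]; rewrite finset.cards1. Qed.

Lemma homog_covector (x : 'rV[R]_n) : homog 1%N (covector x).
Proof.
rewrite /covector; elim/big_rec: _ => [|k a _]; first exact: homog0.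
by apply: homogD; apply: homogZ; apply: homog_dx.
Qed.

Lemma homog_gt p a : (n < p)%N -> homog p a -> a = 0.
Proof.
move=> np ha; apply/formP => I; rewrite coef0 ha // neq_ltn.
by rewrite (leq_ltn_trans _ np) // -[X in (_ <= X)%N]card_ord max_card.
Qed.

(** The grading involution. With it the graded Leibniz rules hold for forms of mixed degree. *)
Definition parity := dscale (fun p => (-1) ^+ p).

Lemma parity_dx k a : parity (wedge (dx k) a) = - wedge (dx k) (parity a).
Proof.
rewrite /parity dscale_dx -wedgeNr; congr wedge; apply/formP => I.
by rewrite coefN !coef_dscale /= exprS mulN1r mulNr.
Qed.

Lemma parity_even a : even_form a -> parity a = a.
Proof.
move=> ha; apply/formP => I; rewrite coef_dscale -signr_odd.
by case: (boolP (odd _)) => [/ha->|_]; rewrite ?mulr0 ?mul1r.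
Qed.

Lemma wedge_dx a k b : wedge a (wedge (dx k) b) = wedge (dx k) (wedge (parity a) b).
Proof.
elim/form_ind: a => [t a a' IH IH'||l a IH].
- by rewrite /parity !dscaleP !wedgeDl !wedgeZl IH IH' wedgeDr wedgeZr.
- by rewrite /parity dscale_unit expr0 scale1r !wedge1l.
- by rewrite parity_dx wedgeNl !dx_wedgeA IH wedgeNr dxC.
Qed.

Lemma iprod_wedge X a b :
  iprod X (wedge a b) = wedge (iprod X a) b + wedge (parity a) (iprod X b).
Proof.
elim/form_ind: a => [t a a' IH IH'||l a IH].
- rewrite wedgeDl wedgeZl !iprodDr !iprodZr IH IH' /parity dscaleP !wedgeDl !wedgeZl.
  by rewrite scalerDr addrACA.
- by rewrite /parity dscale_unit expr0 scale1r !wedge1l iprod1 wedge0l add0r.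
- rewrite dx_wedgeA !iprod_dx IH parity_dx wedgeDr wedgeDl wedgeZl !wedgeNl !dx_wedgeA.
  by rewrite opprD addrA.
Qed.

Lemma wedgeC_even a b : even_form a -> wedge a b = wedge b a.
Proof.
move=> ha; elim/form_ind: b => [t b b' IH IH'||l b IH].
- by rewrite wedgeDr wedgeZr wedgeDl wedgeZl IH IH'.
- by rewrite wedge1l wedge1r.
- by rewrite wedge_dx parity_even // IH dx_wedgeA.
Qed.

Lemma homog_even p a : ~~ odd p -> homog p a -> even_form a.
Proof. by move=> op ha I oI; apply: ha; apply: contraNneq op => <-. Qed.

Lemma homog_odd p a : odd p -> homog p a -> odd_form a.
Proof. by move=> op ha I oI; apply: ha; apply: contraNneq oI => ->. Qed.

(** ** Forms of top degree *)

Definition top_form : form R n := basis_form [set: 'I_n]%SET.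

Lemma homog_top : homog n top_form.
Proof.
move=> I; rewrite coef_basis; case: (I =P _) => [->|//].
by rewrite finset.cardsT card_ord eqxx.
Qed.

Lemma coef_top : coef top_form [set: 'I_n]%SET = 1.
Proof. by rewrite coef_basis eqxx. Qed.

Lemma topE a : homog n a -> a = coef a [set: 'I_n]%SET *: top_form.
Proof.
move=> ha; apply/formP => I; rewrite coefZ coef_basis.
case: eqVneq => [->|IT]; first by rewrite mulr1.
rewrite mulr0 ha // -[X in _ != X]card_ord -finset.cardsT; apply: contra IT => /eqP c.
by rewrite eqEcard finset.subsetT c leqnn.
Qed.

Lemma dx_top k : wedge (dx k) top_form = 0.
Proof.
exact: homog_gt (ltnSn n) (homog_wedge (homog_dx k) homog_top).
Qed.

Lemma covector_top x : wedge (covector x) top_form = 0.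
Proof. by rewrite wedge_covector_coord big1 // => k _; rewrite dx_top scaler0. Qed.

Lemma covector_iprod_top x X :
  wedge (covector x) (iprod X top_form) = dot X x *: top_form.
Proof.
by apply/eqP; rewrite eq_sym -subr_eq0 -iprod_covector covector_top iprod0r.
Qed.

(** On the coefficient at [I] each index outside [I] contributes once, its two signs cancelling, so
    the sum counts the missing indices. *)
Lemma sum_delta_dx a :
  \sum_k iprod (delta_mx ord0 k) (wedge (dx k) a) = dscale (fun p => (n - p)%:R) a.
Proof.
apply/formP => I; rewrite coef_sum coef_dscale.
transitivity (\sum_(k | k \notin I) coef a I).
  rewrite [RHS]big_mkcond; apply: eq_bigr => k _ /=.
  rewrite coef_iprod_delta coef_dx_wedge finset.setU11; case: ifPn => //= kI.
  rewrite lesserU1 // ltnn add0n finset.setU1K // mulrA -exprD addnn -mul2n exprM.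
  by rewrite sqrrN !expr1n mul1r.
rewrite sumr_const mulr_natl; congr (_ *+ _).
have -> : #|(fun i : 'I_n => i \notin I)| = #|~: I|%SET.
  by apply: fintype.eq_card => k; rewrite !inE.
by have := cardsC I; rewrite card_ord; lia.
Qed.

(** One index is missing in degree n - 1, so [sum_delta_dx] returns [a] itself, as a sum of
    contractions of top forms. This inverts contraction into the volume and turns 4-forms into
    vectors in dimension 5. *)
Lemma iprod_topE p a : p.+1 = n -> homog p a ->
  a = iprod (\row_k coef (wedge (dx k) a) [set: 'I_n]%SET) top_form.
Proof.
move=> pn ha; have := sum_delta_dx a; rewrite (homog_dscale _ ha).
have -> : (n - p = 1)%N by lia.
rewrite scale1r => {1}<-.
rewrite iprod_coord; apply: eq_bigr => k _; rewrite mxE -iprodZr; congr iprod.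
apply: topE => I In; apply: (homog_wedge (homog_dx k) ha).
by rewrite add1n pn.
Qed.

Lemma iprod_top_inj X Y : iprod X top_form = iprod Y top_form -> X = Y.
Proof.
move=> XY; apply/rowP => k.
have := congr1 (fun a => coef (wedge (dx k) a) [set: 'I_n]%SET) XY.
by rewrite -covector_delta !covector_iprod_top !coefZ coef_top !mulr1 !dot_delta.
Qed.

End Exterior.

(** * Pullback by linear maps, and the determinant in top degree *)

Section Pullback.
Context {R : realType} {n : nat}.
Implicit Types (a b c : form R n) (I J K : {set 'I_n}) (X Y : 'rV[R]_n).

HB.instance Definition _ := Monoid.isLaw.Build (form R n) unit_form (@wedge R n)
  (fun a b c => esym (wedgeA a b c)) wedge1l wedge1r.
HB.instance Definition _ := Monoid.isMulLaw.Build (form R n) 0 (@wedge R n)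
  wedge0l wedge0r.

(** A named copy of addition carrying the monoid structures with which [bigA_distr_bigA] expands a
    product of sums. *)
Let form_add (a b : form R n) := a + b.
HB.instance Definition _ := Monoid.isComLaw.Build (form R n) 0 form_add
  (@addrA _) (@addrC _) (@add0r _).
HB.instance Definition _ := Monoid.isAddLaw.Build (form R n) (@wedge R n) form_add
  (fun a b c => wedgeDl a b c) wedgeDr.

Lemma wedge_distr (F : 'I_n -> 'I_n -> form R n) :
  \big[wedge/unit_form]_k \sum_j F k j =
  \sum_(f : {ffun 'I_n -> 'I_n}) \big[wedge/unit_form]_k F k (f k).
Proof. exact: (@bigA_distr_bigA _ _ _ (@wedge R n) form_add). Qed.

Section WedgeList.
Variable x : 'I_n -> 'rV[R]_n.

Definition wedge_list (s : seq 'I_n) := \big[wedge/unit_form]_(k <- s) covector (x k).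

Lemma wedge_list_cons k s : wedge_list (k :: s) = wedge (covector (x k)) (wedge_list s).
Proof. by rewrite /wedge_list big_cons. Qed.

Lemma wedge_list_mem k s : k \in s -> wedge (covector (x k)) (wedge_list s) = 0.
Proof.
elim: s => // l s IH; rewrite inE wedge_list_cons => /predU1P[->|/IH e].
  by rewrite covector_sqr.
by rewrite covectorC e wedge0r oppr0.
Qed.

Lemma wedge_list_mid s1 k s2 : wedge_list (s1 ++ k :: s2) =
  (-1) ^+ size s1 *: wedge (covector (x k)) (wedge_list (s1 ++ s2)).
Proof.
elim: s1 => [|l s1 IH]; first by rewrite expr0 scale1r -wedge_list_cons.
rewrite !cat_cons !wedge_list_cons IH wedgeZr covectorC exprS mulN1r scaleNr.
by rewrite scalerN.
Qed.

Lemma wedge_list_nuniq s : ~~ uniq (map x s) -> wedge_list s = 0.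
Proof.
elim: s => //= k s IH; rewrite negb_and wedge_list_cons => /orP[|/IH->]; last exact: wedge0r.
by rewrite negbK => /mapP[l ls ->]; apply: wedge_list_mem.
Qed.

End WedgeList.

Lemma wedge_list_map (x : 'I_n -> 'rV[R]_n) (f : 'I_n -> 'I_n) s :
  wedge_list x (map f s) = wedge_list (x \o f) s.
Proof. by rewrite /wedge_list big_map. Qed.

(** Since [enum] is increasing, [k] is inserted after exactly [lesser k J] elements. This links the
    order of the factors in [pullback] with the sign convention of [wedge]. *)
Lemma enum_setU1_split k J : k \notin J -> exists s1 s2,
  [/\ enum (k |: J)%SET = s1 ++ k :: s2, enum J = s1 ++ s2 & size s1 = lesser k J].
Proof.
move=> kJ; set e := enum 'I_n.
have ke : (k < size e)%N by rewrite size_enum_ord.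
have nthk : nth k e k = k by rewrite nth_ord_enum.
have ek : e = take k e ++ k :: drop k.+1 e.
  by rewrite -{1}(cat_take_drop k e) (drop_nth k ke) nthk.
have lt_take j : (j \in take k e) = (j < k)%N.
  by rewrite in_take ?mem_enum // index_enum_ord.
have gt_drop j : j \in drop k.+1 e -> (k < j)%N.
  move=> jd; rewrite ltnNge -ltnS -[j in (j < _)%N]index_enum_ord -in_take ?mem_enum //.
  have := enum_uniq 'I_n; rewrite -/e -{1}(cat_take_drop k.+1 e) cat_uniq.
  by case/and3P=> _ /hasPn h _; apply: h.
have enumE (A : {set 'I_n}) : enum A = [seq j <- e | j \in A] by rewrite /e !enumT.
exists [seq j <- take k e | j \in J], [seq j <- drop k.+1 e | j \in J]; split.
- rewrite enumE {1}ek filter_cat /= finset.setU11; congr (_ ++ _ :: _).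
    apply: eq_in_filter => j; rewrite lt_take !inE; case: eqP => [->|//].
    by rewrite ltnn.
  apply: eq_in_filter => j /gt_drop; rewrite !inE; case: eqP => [->|//].
  by rewrite ltnn.
- by rewrite enumE {1}ek filter_cat /= (negPf kJ).
- have -> : lesser k J = count (fun j => (j \in J) && (j < k)%N) e.
    by rewrite /lesser cardE /enum_mem size_filter -enumT.
  rewrite [in RHS]ek count_cat /= (negPf kJ) /= add0n size_filter -[LHS]addn0; congr addn.
    by apply: eq_in_count => j; rewrite lt_take => ->; rewrite andbT.
  apply/esym/eqP; rewrite -leqn0 leqNgt -has_count; apply/hasPn => j /gt_drop kj.
  by rewrite negb_and -leqNgt (ltnW kj) orbT.
Qed.

Lemma wedge_list_basis I : wedge_list (fun k => delta_mx ord0 k) (enum I) = basis_form I.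
Proof.
have [m] := ubnP #|I|; elim: m I => // m IH I Im.
have [->|/set0Pn[k kI]] := eqVneq I finset.set0.
  by rewrite enum_set0 /wedge_list big_nil.
have [s1 [s2 [e1 e2 sz]]] := @enum_setU1_split k (I :\ k)%SET (negbT (setD11 _ _)).
rewrite finset.setD1K // in e1.
rewrite e1 wedge_list_mid covector_delta -e2 IH; last by rewrite (cardsD1 k) kI in Im.
rewrite (basis_formD1 kI) sz; congr (_ ^+ _ *: _).
by rewrite (@lesserD1 n k k I kI) ltnn.
Qed.

Section Linear.
Variable L : 'rV[R]_n -> 'rV[R]_n.

Definition comp_row k : 'rV[R]_n := \row_j L (delta_mx ord0 j) ord0 k.

Lemma pullbackE a : pullback L a =
  \sum_(I : {set 'I_n}) coef a I *: wedge_list comp_row (enum I).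
Proof. by []. Qed.

Fact pullback_is_linear : linear (pullback L).
Proof.
move=> t a b; rewrite !pullbackE scaler_sumr -big_split; apply: eq_bigr => I _ /=.
by rewrite coefD coefZ scalerDl scalerA.
Qed.
HB.instance Definition _ := GRing.isLinear.Build R (form R n) (form R n) *:%R
  (pullback L) pullback_is_linear.

Lemma pullbackP t a b : pullback L (t *: a + b) = t *: pullback L a + pullback L b.
Proof. exact: pullback_is_linear. Qed.
Lemma pullbackD a b : pullback L (a + b) = pullback L a + pullback L b.
Proof. exact: linearD. Qed.
Lemma pullbackZ t a : pullback L (t *: a) = t *: pullback L a.
Proof. exact: linearZ_LR. Qed.
Lemma pullback_sum (T : Type) (r : seq T) (P : pred T) (F : T -> form R n) :
  pullback L (\sum_(i <- r | P i) F i) = \sum_(i <- r | P i) pullback L (F i).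
Proof. exact: linear_sum. Qed.
Lemma pullbackN a : pullback L (- a) = - pullback L a.
Proof. exact: linearN. Qed.

Lemma pullback_basis J : pullback L (basis_form J) = wedge_list comp_row (enum J).
Proof.
rewrite pullbackE (bigD1 J) //= big1 ?addr0 => [|I IJ].
  by rewrite coef_basis eqxx scale1r.
by rewrite coef_basis (negPf IJ) scale0r.
Qed.

Lemma pullback1 : pullback L unit_form = unit_form.
Proof. by rewrite -basis_form0 pullback_basis enum_set0 /wedge_list big_nil. Qed.

(** On a basis form containing [dx k] both sides vanish. Otherwise inserting [k] at its position
    produces the same sign on both sides. *)
Lemma pullback_dx k a :
  pullback L (wedge (dx k) a) = wedge (covector (comp_row k)) (pullback L a).
Proof.
rewrite (form_basis a) wedge_sumr !pullback_sum wedge_sumr; apply: eq_bigr => J _.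
rewrite wedgeZr !pullbackZ wedgeZr; congr (_ *: _); rewrite pullback_basis.
have [kJ|kJ] := boolP (k \in J).
  by rewrite (basis_formD1 kJ) wedgeZr dxx scaler0 linear0 wedge_list_mem ?mem_enum.
have [s1 [s2 [e1 e2 sz]]] := enum_setU1_split kJ.
have -> : wedge (dx k) (basis_form J) = (-1) ^+ lesser k J *: basis_form (k |: J)%SET :> form R n.
  rewrite (basis_formD1 (finset.setU11 k J)) lesserU1 // ltnn add0n finset.setU1K //.
  by rewrite scalerA -exprD addnn -mul2n exprM sqrrN !expr1n scale1r.
rewrite pullbackZ pullback_basis e1 wedge_list_mid -e2 sz scalerA -exprD addnn -mul2n exprM.
by rewrite sqrrN !expr1n scale1r.
Qed.

Lemma pullback_wedge a b : pullback L (wedge a b) = wedge (pullback L a) (pullback L b).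
Proof.
elim/(@form_ind R n): a => [t a a' IH IH'||k a IH].
- by rewrite wedgeDl wedgeZl !pullbackP wedgeDl wedgeZl IH IH'.
- by rewrite pullback1 !wedge1l.
- by rewrite dx_wedgeA !pullback_dx IH wedgeA.
Qed.

Lemma dscale_covector g y a :
  dscale g (wedge (covector y) a) = wedge (covector y) (dscale (g \o succn) a).
Proof.
rewrite !wedge_covector_coord linear_sum; apply: eq_bigr => k _ /=.
by rewrite linearZ /= dscale_dx.
Qed.

Lemma pullback_dscale g a : pullback L (dscale g a) = dscale g (pullback L a).
Proof.
elim/(@form_ind R n): a g => [t a a' IH IH'||k a IH] g.
- by rewrite dscaleP !pullbackP dscaleP IH IH'.
- by rewrite dscale_unit pullbackZ pullback1 dscale_unit.
- by rewrite dscale_dx !pullback_dx IH dscale_covector.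
Qed.

Lemma pullback_homog p a : homog p a -> homog p (pullback L a).
Proof. by move=> /homogP ha; apply/homogP; rewrite -pullback_dscale ha. Qed.

End Linear.

(** Both sides obey the same Leibniz rule for a factor [dx k]; the scalar terms agree because
    pairing [X] with [comp_row L k] gives the k-th coordinate of [L X]. *)
Lemma iprod_pullback (L : {linear 'rV[R]_n -> 'rV[R]_n}) X a :
  iprod X (pullback L a) = pullback L (iprod (L X) a).
Proof.
elim/(@form_ind R n): a => [t a a' IH IH'||k a IH].
- by rewrite pullbackP !iprodDr !iprodZr pullbackP IH IH'.
- by rewrite pullback1 !iprod1 linear0.
rewrite pullback_dx iprod_covector IH iprod_dx pullbackD pullbackZ pullbackN pullback_dx.
congr (_ *: _ - _); rewrite {2}(row_sum_delta X) linear_sum summxE.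
by apply: eq_bigr => j _; rewrite linearZ !mxE.
Qed.

(** ** Pullback in top degree *)

Local Notation w := (wedge_list (fun k => delta_mx ord0 k : 'rV[R]_n)).

Lemma wedge_list_swap (x : 'I_n -> 'rV[R]_n) s1 k s2 l s3 :
  wedge_list x (s1 ++ k :: s2 ++ l :: s3) = - wedge_list x (s1 ++ l :: s2 ++ k :: s3).
Proof.
rewrite 2!wedge_list_mid !catA 2!wedge_list_mid !wedgeZr covectorC.
by rewrite !scalerN.
Qed.

Lemma wedge_list_tperm (f : 'I_n -> 'I_n) e i j : uniq e -> i \in e -> j \in e -> i != j ->
  w (map (f \o tperm i j) e) = - w (map f e).
Proof.
have split k (s : seq 'I_n) : k \in s -> exists s1 s2, s = s1 ++ k :: s2.
  by case/splitPr => s1 s2; exists s1, s2.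
move=> ue ie je ij.
(* The statement is symmetric in [i] and [j], so [i] may be taken to come first. *)
wlog [s1 [s2 [s3 ee]]] : i j ie je ij / exists s1 s2 s3, e = s1 ++ i :: s2 ++ j :: s3.
  move=> H; have [s1 [s2 e1]] := split _ _ ie.
  have := je; rewrite e1 mem_cat inE eq_sym (negPf ij) /= => /orP[/split[t1 [t2 e2]]|].
    rewrite tpermC -e1; apply: H => //; first by rewrite eq_sym.
    by exists t1, t2, s2; rewrite e1 e2 -catA.
  by move=> /split[t1 [t2 e2]]; rewrite -e1; apply: H => //; exists s1, t1, t2; rewrite e1 e2.
have fixed (s : seq _) : i \notin s -> j \notin s -> map (f \o tperm i j) s = map f s.
  move=> si sj; apply/eq_in_map => k ks /=; rewrite tpermD //.
    by apply: contraNneq si => ->.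
  by apply: contraNneq sj => ->.
have : perm_eq e (i :: j :: s1 ++ s2 ++ s3).
  by apply/seq.permP => p; rewrite ee /= !count_cat /= !count_cat /=; lia.
move/perm_uniq; rewrite ue /= inE !mem_cat !negb_or => /esym/and3P[/and4P[_ i1 i2 i3] /and3P[j1 j2 j3] _].
by rewrite ee !map_cat /= !map_cat /= !fixed //= tpermL tpermR wedge_list_swap.
Qed.

Lemma coef_wedge_list_perm (s : 'S_n) :
  coef (w (map s (enum 'I_n))) [set: 'I_n]%SET = (-1) ^+ s.
Proof.
have [ts -> ] := prod_tpermP s; elim: ts => [_|[i j] ts IH /= /andP[/= ij /IH{}IH]].
  rewrite big_nil odd_perm1 expr0 (eq_map (g := id)) ?map_id; last by move=> k; rewrite perm1.
  have -> : enum 'I_n = enum [set: 'I_n]%SET by apply: eq_enum => k; rewrite !inE.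
  by rewrite wedge_list_basis coef_top.
rewrite big_cons odd_permM odd_tperm ij signr_addb mulN1r -IH -coefN.
rewrite -(@wedge_list_tperm _ _ i j) ?enum_uniq ?mem_enum //.
by congr (coef (w _) _); apply: eq_map => k; rewrite permM.
Qed.

(** Expanding the product of covectors gives a sum over all maps of the index set. Maps that are not
    injective repeat a covector and vanish, and the permutations that remain give the Leibniz
    formula. *)
Lemma coef_pullback_top (L : 'rV[R]_n -> 'rV[R]_n) :
  coef (pullback L top_form) [set: 'I_n]%SET = \det (\matrix_(k, j) L (delta_mx ord0 j) ord0 k).
Proof.
set M := \matrix_(k, j) _.
rewrite pullback_basis.
have -> : enum [set: 'I_n]%SET = enum 'I_n by apply: eq_enum => k; rewrite !inE.
have enumI : enum 'I_n = index_enum 'I_n.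
  by rewrite /index_enum -(locked_withE index_enum_key (Finite.enum _)) -enumT.
rewrite /wedge_list enumI /covector.
transitivity (\sum_(f : {ffun 'I_n -> 'I_n}) (\prod_k M k (f k)) * coef (w (map f (enum 'I_n))) [set: 'I_n]%SET).
  rewrite wedge_distr coef_sum; apply: eq_bigr => f _.
  rewrite -coefZ; congr coef.
  rewrite wedge_list_map /wedge_list -enumI.
  elim: (enum 'I_n) => [|k s IH]; first by rewrite !big_nil scale1r.
  rewrite !big_cons IH wedgeZl wedgeZr scalerA /= covector_delta !mxE.
  by [].
rewrite (bigID (fun f : {ffun 'I_n -> 'I_n} => injectiveb f)) /= [X in _ + X]big1 ?addr0; last first.
  move=> f fi; rewrite wedge_list_map wedge_list_nuniq ?coef0 ?mulr0 //.
  apply: contra fi => u; apply/injectiveP/injectiveP; move: u.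
  by rewrite /injectiveb /dinjectiveb (map_comp (fun k => delta_mx ord0 k)) => /map_uniq.
rewrite (reindex (@pval _)) /=; last first.
  pose in_Sn := insubd (1%g : 'S_n).
  by exists in_Sn => /= f Uf; first apply: val_inj; apply: insubdK.
apply: eq_big => /= [s|s _]; rewrite ?(valP s) // mulrC; congr (_ * _).
  by rewrite -coef_wedge_list_perm; congr (coef (w _) _); apply: eq_map => k; rewrite pvalE.
by apply: eq_bigr => k _; rewrite pvalE.
Qed.

End Pullback.

(** * Differentiability and smooth functions on open sets *)

Section Differentiable.
Context {R : realType}.

(** The difference vanishes near [x], hence is differentiable there with zero differential. Locality
    is needed because fields are meaningful only on chart images. *)
Lemma near_eq_differentiable (V W : normedModType R) (f g : V -> W) x :
  (\near x, f x = g x) -> differentiable f x -> differentiable g x.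
Proof.
move=> fg df.
have -> : g = f + (g - f) by rewrite addrC subrK.
apply: differentiableD => //.
have h0 : (g - f) \o shift x = cst ((g - f) x) + (\0 : {linear V -> W}) +o_ 0 id.
  apply/eqaddoP => e e0 /=.
  have gx : g x = f x by rewrite (nbhs_singleton fg).
  have : \forall y \near 0, f (y + x) = g (y + x).
    rewrite (near_shift x) /= sub0r; apply: filterS fg => y fgy.
    by rewrite /= subrK.
  apply: filterS => y fgy.
  rewrite -[X in `|X|]/((g (y + x) - f (y + x)) - ((g x - f x) + 0)) fgy gx !subrr addr0 subrr.
  by rewrite normr0 mulr_ge0 // ltW.
apply/diff_locallyP; rewrite (diff_unique _ h0); last exact: cst_continuous.
by split => //; exact: cst_continuous.
Qed.

Section Open.
Context {V W : normedModType R} (U : set V) (Uo : open U).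

Lemma open_near_eq (f g : V -> W) x : (forall y, U y -> f y = g y) -> U x ->
  \near x, f x = g x.
Proof. by move=> fg Ux; near=> y; apply: fg; near: y; exact: open_nbhs_nbhs. Unshelve. all: by end_near. Qed.

End Open.

Lemma differentiable_rowP (V : normedModType R) m (F : V -> 'rV[R]_m) x :
  differentiable F x <-> forall j, differentiable (fun y => F y ord0 j) x.
Proof.
split=> [dF j|dF].
  exact: (differentiable_comp dF (differentiable_coord _ _ _)).
have -> : F = \sum_(j < m) (fun y => F y ord0 j *: delta_mx ord0 j : 'rV[R]_m).
  by apply/funext => y; rewrite fct_sumE {1}(row_sum_delta (F y)).
by apply: differentiable_sum => j; apply: differentiableZl.
Qed.

Lemma derive_row (V : normedModType R) m (F : V -> 'rV[R]_m) x v j :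
  differentiable F x -> 'D_v F x ord0 j = 'D_v (fun y => F y ord0 j) x.
Proof. by move=> dF; rewrite derive_mx ?mxE //; apply: diff_derivable. Qed.

Lemma derive_sqrt_comp (V : normedModType R) (f : V -> R) x v : differentiable f x -> 0 < f x ->
  'D_v (fun y => Num.sqrt (f y)) x = (2 * Num.sqrt (f x))^-1 * 'D_v f x.
Proof.
move=> df f0; have ds : differentiable (@Num.sqrt R) (f x).
  by apply/derivable1_diffP; apply: ex_derive; apply: is_derive1_sqrt.
rewrite [LHS]deriveE; last exact: differentiable_comp df ds.
rewrite (diff_comp df ds) /= deriveE //.
have := diff1E; move=> /(_ _ _ _ _ ds) ->.
by rewrite derive1E derive_sqrt // [RHS]mulrC.
Qed.

(** The difference quotients on both sides are the same function. Directional derivatives on the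
    space of pairs, which are all that [is_hat] asks for, thus become derivatives in one
    variable. *)
Lemma is_derive_line (V : normedModType R) (f : V -> R) (a v : V) (df : R) :
  is_derive (0 : R) (1 : R) (fun t : R => f (t *: v + a)) df -> is_derive a v f df.
Proof.
have e : (fun h : R => h^-1 *: ((fun t => f (t *: v + a)) (h *: 1 + 0)
      - (fun t => f (t *: v + a)) 0)) = (fun h => h^-1 *: (f (h *: v + a) - f a)).
  by apply/funext => h; rewrite scale0r add0r addr0 [h *: 1]mulr1.
case=> d1 d2; split; first by move: d1; rewrite /derivable e.
by rewrite -d2 /derive e.
Qed.

End Differentiable.

Section Smooth.
Context {R : realType} {n : nat}.
Local Notation V := 'rV[R]_n.
Context (U : set V) (Uo : open U).

Lemma eq_partial (W : normedModType R) k (f g : V -> W) :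
  (forall y, U y -> f y = g y) -> forall y, U y -> partial k f y = partial k g y.
Proof. by move=> fg y Uy; apply: near_eq_derive; apply: open_near_eq fg Uy. Qed.

(** A class of functions differentiable on [U] and stable under partial derivatives, up to equality
    on [U], consists of smooth functions. It replaces inductions over iterated derivatives. *)
Lemma smooth_coind (W : normedModType R) (P : (V -> W) -> Prop) :
  (forall F, P F -> forall x, U x -> differentiable F x) ->
  (forall F k, P F -> exists2 G, P G & forall x, U x -> partial k F x = G x) ->
  forall F, P F -> smooth_on U F.
Proof.
move=> Pd Pp F PF s x Ux.
suff [G PG FG] : exists2 G, P G & forall x, U x -> foldr partial F s x = G x.
  apply: (near_eq_differentiable (f := G)); last exact: Pd.
  by apply: open_near_eq Ux => // y Uy; rewrite FG.
elim: s => [|k s [G PG FG]] /=; first by exists F.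
have [H PH GH] := Pp G k PG; exists H => // y Uy.
by rewrite (eq_partial _ FG) // GH.
Qed.

Lemma smooth_diff (W : normedModType R) (F : V -> W) x :
  smooth_on U F -> U x -> differentiable F x.
Proof. by move=> sF; apply: (sF [::]). Qed.

Lemma smooth_partial (W : normedModType R) (F : V -> W) k :
  smooth_on U F -> smooth_on U (partial k F).
Proof. by move=> sF s x Ux; have := sF (rcons s k) x Ux; rewrite foldr_rcons. Qed.

Lemma smooth_row m (F : V -> 'rV[R]_m) :
  smooth_on U F <-> forall j, smooth_on U (fun x => F x ord0 j).
Proof.
split=> [sF j|].
  apply: (smooth_coind (W := R) (P := fun f : V -> R => exists2 G : V -> 'rV[R]_m,
    smooth_on U G & f = fun x => G x ord0 j)).
  - move=> _ [G sG ->] x Ux.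
    by move/differentiable_rowP: (smooth_diff sG Ux); apply.
  - move=> _ k [G sG ->]; exists (fun x => partial k G x ord0 j).
      by exists (partial k G) => //; apply: smooth_partial.
    by move=> x Ux; rewrite /partial derive_row //; apply: smooth_diff Ux.
  - by exists F.
apply: (smooth_coind (P := fun F : V -> 'rV[R]_m => forall j, smooth_on U (fun x => F x ord0 j))).
- move=> {}F sF x Ux; apply/differentiable_rowP => j; exact: smooth_diff Ux.
- move=> {}F k sF; exists (partial k F) => // j.
  have e x : U x -> partial k (fun x => F x ord0 j) x = partial k F x ord0 j.
    move=> Ux; rewrite /partial derive_row //; apply/differentiable_rowP => i.
    exact: smooth_diff Ux.
  apply: (smooth_coind (W := R) (P := fun f : V -> R => exists2 g : V -> R,
    smooth_on U g & forall x, U x -> f x = g x)).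
  + move=> f [g sg fg] x Ux; apply: (near_eq_differentiable (f := g)).
      by apply: open_near_eq Ux => // y Uy; rewrite fg.
    exact: smooth_diff Ux.
  + move=> f l [g sg fg]; exists (partial l g); last exact: eq_partial.
    by exists (partial l g) => //; apply: smooth_partial.
  + exists (partial k (fun x => F x ord0 j)); first exact: smooth_partial.
    by move=> x Ux; rewrite e.
Qed.

Lemma smooth_coord m (F : V -> 'rV[R]_m) j :
  smooth_on U F -> smooth_on U (fun x => F x ord0 j).
Proof. by move=> /smooth_row. Qed.

(** A class to feed to [smooth_coind]: derivatives of inverses and square roots stay inside it.
    These two constructors are there for the density of the volume and for dividing by it. *)
Inductive smooth_expr : (V -> R) -> Prop :=
| SmoothBase f : smooth_on U f -> smooth_expr f
| SmoothCst c : smooth_expr (cst c)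
| SmoothAdd f g : smooth_expr f -> smooth_expr g -> smooth_expr (f + g)
| SmoothMul f g : smooth_expr f -> smooth_expr g -> smooth_expr (f * g)
| SmoothInv f : smooth_expr f -> (forall x, U x -> f x != 0) ->
    smooth_expr (fun x => (f x)^-1)
| SmoothSqrt f : smooth_expr f -> (forall x, U x -> 0 < f x) ->
    smooth_expr (fun x => Num.sqrt (f x)).

Lemma smooth_expr_diff f : smooth_expr f -> forall x, U x -> differentiable f x.
Proof.
elim=> {f} [f sf|c|f g _ df _ dg|f g _ df _ dg|f _ df f0|f _ df f0] x Ux.
- exact: smooth_diff Ux.
- exact: differentiable_cst.
- by apply: differentiableD; [apply: df | apply: dg].
- by apply: differentiableM; [apply: df | apply: dg].
- by apply: differentiableV; [apply: df | apply: f0].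
- apply: (differentiable_comp (df x Ux)); apply/derivable1_diffP.
  by apply: ex_derive; apply: is_derive1_sqrt; apply: f0.
Qed.

Lemma smooth_expr_partial f k : smooth_expr f ->
  exists2 g, smooth_expr g & forall x, U x -> partial k f x = g x.
Proof.
move=> sf; have df := smooth_expr_diff sf; elim: sf df => {f}.
- by move=> f sf _; exists (partial k f) => //; apply/SmoothBase/smooth_partial.
- by move=> c _; exists (cst 0); [exact: SmoothCst|move=> x _; apply: derive_cst].
- move=> f g sf IHf sg IHg _.
  have [f' sf' ef] := IHf (smooth_expr_diff sf); have [g' sg' eg] := IHg (smooth_expr_diff sg).
  exists (f' + g'); first exact: SmoothAdd.
  move=> x Ux; rewrite /partial deriveD; first by rewrite -/(partial k f x) -/(partial k g x) ef ?eg.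
    by apply/diff_derivable/smooth_expr_diff.
  by apply/diff_derivable/smooth_expr_diff.
- move=> f g sf IHf sg IHg _.
  have [f' sf' ef] := IHf (smooth_expr_diff sf); have [g' sg' eg] := IHg (smooth_expr_diff sg).
  exists (f * g' + g * f'); first by apply: SmoothAdd; apply: SmoothMul.
  move=> x Ux; rewrite /partial deriveM; first by rewrite -/(partial k f x) -/(partial k g x) ef ?eg.
    by apply/diff_derivable/smooth_expr_diff.
  by apply/diff_derivable/smooth_expr_diff.
- move=> f sf IHf f0 _; have [f' sf' ef] := IHf (smooth_expr_diff sf).
  pose h := fun x => (f x)^-1.
  exists (cst (-1) * (h * h) * f').
    by do 3?[apply: SmoothMul] => //; [exact: SmoothCst| exact: SmoothInv..].
  move=> x Ux; rewrite /partial deriveV ?f0 //; last by apply/diff_derivable/smooth_expr_diff.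
  rewrite -/(partial k f x) ef // !fctE /= /cst /h expr2 invfM scaleNr.
  by rewrite -[_ *: _]/(_ * _) mulN1r mulNr.
- move=> f sf IHf f0 _; have [f' sf' ef] := IHf (smooth_expr_diff sf).
  pose h := fun x => ((cst 2 * fun y => Num.sqrt (f y)) x)^-1.
  exists (h * f').
    apply: SmoothMul => //; apply: SmoothInv.
      by apply: SmoothMul; [exact: SmoothCst | exact: SmoothSqrt].
    by move=> x Ux; rewrite fctE mulf_neq0 ?pnatr_eq0 // gt_eqF // sqrtr_gt0 f0.
  move=> x Ux; rewrite /partial derive_sqrt_comp ?f0 //; last exact: smooth_expr_diff.
  by rewrite -/(partial k f x) ef.
Qed.

Lemma smooth_exprP f : smooth_expr f -> smooth_on U f.
Proof.
apply: smooth_coind; first exact: smooth_expr_diff.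
by move=> F k; apply: smooth_expr_partial.
Qed.

End Smooth.

(** * Product rules for bilinear and linear maps *)

Section BilinearCalculus.
Context {R : realType} {n p q r : nat}.
Local Notation V := 'rV[R]_n.
Context (b : 'rV[R]_p -> 'rV[R]_q -> 'rV[R]_r).
Hypothesis bl : forall t x y z, b (t *: x + y) z = t *: b x z + b y z.
Hypothesis br : forall z, linear (b z).

(** In coordinates a bilinear map is a finite sum of products of scalars, so the product rule and
    smoothness for [wedge] and [iprod] both reduce to the scalar case. *)
Lemma bilinear_expand x y :
  b x y = \sum_i \sum_j (x ord0 i * y ord0 j) *: b (delta_mx ord0 i) (delta_mx ord0 j).
Proof.
pose f1 z := GRing.isLinear.Build R 'rV[R]_p 'rV[R]_r *:%R (b^~ z) (fun t u v => bl t u v z).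
pose f2 z := GRing.isLinear.Build R 'rV[R]_q 'rV[R]_r *:%R (b z) (@br z).
pose F1 z : {linear 'rV[R]_p -> 'rV[R]_r} := HB.pack (b^~ z) (f1 z).
pose F2 z : {linear 'rV[R]_q -> 'rV[R]_r} := HB.pack (b z) (f2 z).
rewrite -[b x y]/(F1 y x) {1}(row_sum_delta x) linear_sum; apply: eq_bigr => i _.
rewrite linearZ /= -[b _ y]/(F2 _ y) {1}(row_sum_delta y) linear_sum scaler_sumr.
by apply: eq_bigr => j _; rewrite linearZ /= scalerA.
Qed.

Lemma bilinear_expand_fun (F : V -> 'rV[R]_p) (G : V -> 'rV[R]_q) :
  (fun y => b (F y) (G y)) = \sum_i \sum_j (fun y =>
    ((fun y => F y ord0 i) * (fun y => G y ord0 j)) y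
      *: b (delta_mx ord0 i) (delta_mx ord0 j)).
Proof.
apply/funext => y; rewrite bilinear_expand fct_sumE; apply: eq_bigr => i _.
by rewrite fct_sumE.
Qed.

Section Point.
Context (F : V -> 'rV[R]_p) (G : V -> 'rV[R]_q) (x : V).
Hypothesis dF : differentiable F x.
Hypothesis dG : differentiable G x.

Let dFi i : differentiable (fun y => F y ord0 i) x.
Proof. by move/differentiable_rowP : dF; apply. Qed.
Let dGj j : differentiable (fun y => G y ord0 j) x.
Proof. by move/differentiable_rowP : dG; apply. Qed.
Let dFG i j : differentiable ((fun y => F y ord0 i) * (fun y => G y ord0 j)) x.
Proof. exact: differentiableM. Qed.

Lemma bilinear_diff : differentiable (fun y => b (F y) (G y)) x.
Proof.
rewrite bilinear_expand_fun; apply: differentiable_sum => i.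
by apply: differentiable_sum => j; apply: differentiableZl.
Qed.

Lemma bilinear_derive v : 'D_v (fun y => b (F y) (G y)) x =
  b ('D_v F x) (G x) + b (F x) ('D_v G x).
Proof.
rewrite bilinear_expand_fun derive_sum; last first.
  move=> i; apply/diff_derivable/differentiable_sum => j; exact: differentiableZl.
rewrite 2!bilinear_expand -big_split; apply: eq_bigr => i _ /=.
rewrite derive_sum; last by move=> j; apply/diff_derivable/differentiableZl.
rewrite -big_split; apply: eq_bigr => j _ /=.
rewrite deriveE ?diffZl //=; last exact: differentiableZl.
rewrite -scalerDl; congr (_ *: _).
rewrite -deriveE // deriveM; [|exact: diff_derivable..].
by rewrite !derive_row // addrC; congr (_ + _); rewrite mulrC.
Qed.

End Point.

Lemma bilinear_smooth (U : set V) (F : V -> 'rV[R]_p) (G : V -> 'rV[R]_q) : open U ->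
  smooth_on U F -> smooth_on U G -> smooth_on U (fun y => b (F y) (G y)).
Proof.
move=> Uo sF sG; apply/smooth_row => // k; apply: smooth_exprP => //.
have -> : (fun y => b (F y) (G y) ord0 k) = \sum_i \sum_j
    ((fun y => F y ord0 i) * (fun y => G y ord0 j)
      * cst (b (delta_mx ord0 i) (delta_mx ord0 j) ord0 k)).
  apply/funext => y; rewrite bilinear_expand summxE fct_sumE; apply: eq_bigr => i _.
  by rewrite summxE fct_sumE; apply: eq_bigr => j _; rewrite mxE.
elim/big_ind: _ => [||i _]; [exact: (SmoothCst _ 0)|exact: SmoothAdd|].
elim/big_ind: _ => [||j _]; [exact: (SmoothCst _ 0)|exact: SmoothAdd|].
apply: SmoothMul; last exact: SmoothCst.
by apply: SmoothMul; apply: SmoothBase; apply: smooth_coord.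
Qed.

End BilinearCalculus.

Section LinearCalculus.
Context {R : realType} {n : nat}.
Local Notation V := 'rV[R]_n.

Lemma derive_dir (W : normedModType R) (F : V -> W) x v : differentiable F x ->
  'D_v F x = \sum_k v ord0 k *: partial k F x.
Proof.
move=> dF; rewrite deriveE // {1}(row_sum_delta v) linear_sum.
by apply: eq_bigr => k _; rewrite linearZ /= /partial deriveE.
Qed.

Section Lin.
Context {p r : nat} (T : {linear 'rV[R]_p -> 'rV[R]_r}).

(** A linear map becomes bilinear with the help of a scalar slot, later held at the constant 1, so
    the bilinear results specialise. *)
Let b (u : 'rV[R]_1) y := u ord0 ord0 *: T y.
Let bl t x y z : b (t *: x + y) z = t *: b x z + b y z.
Proof. by rewrite /b !mxE scalerDl scalerA. Qed.
Let br z : linear (b z).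
Proof. by move=> t x y; rewrite /b linearP scalerDr !scalerA mulrC. Qed.
Let bE y : b (const_mx 1) y = T y. Proof. by rewrite /b mxE scale1r. Qed.
Let bfE (F : V -> 'rV[R]_p) : (fun y => b (cst (const_mx 1) y) (F y)) = T \o F.
Proof. by apply/funext => y; apply: bE. Qed.

Lemma linear_derive (F : V -> 'rV[R]_p) x v : differentiable F x ->
  'D_v (T \o F) x = T ('D_v F x).
Proof.
move=> dF; rewrite -bfE (bilinear_derive bl br) // derive_cst.
by rewrite bE /b mxE scale0r add0r.
Qed.

Lemma linear_smooth (U : set V) (F : V -> 'rV[R]_p) : open U -> smooth_on U F ->
  smooth_on U (T \o F).
Proof.
move=> Uo sF; rewrite -bfE; apply: (bilinear_smooth bl br) => //.
apply/smooth_row => // j; apply: smooth_exprP => //; exact: SmoothCst.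
Qed.

End Lin.

Lemma smoothD (U : set V) (p : nat) (F G : V -> 'rV[R]_p) : open U ->
  smooth_on U F -> smooth_on U G -> smooth_on U (fun x => F x + G x).
Proof.
move=> Uo sF sG; apply/smooth_row => // j; apply: smooth_exprP => //.
have -> : (fun x => (F x + G x) ord0 j) = (fun x => F x ord0 j) + (fun x => G x ord0 j).
  by apply/funext => x; rewrite mxE.
by apply: SmoothAdd; apply: SmoothBase; apply: smooth_coord.
Qed.

Lemma smoothZ (U : set V) (p : nat) (f : V -> R) (F : V -> 'rV[R]_p) : open U ->
  smooth_on U f -> smooth_on U F -> smooth_on U (fun x => f x *: F x).
Proof.
move=> Uo sf sF; apply/smooth_row => // j; apply: smooth_exprP => //.
have -> : (fun x => (f x *: F x) ord0 j) = f * (fun x => F x ord0 j).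
  by apply/funext => x; rewrite mxE.
by apply: SmoothMul; apply: SmoothBase => //; apply: smooth_coord.
Qed.

Lemma smooth_cst (U : set V) (p : nat) (c : 'rV[R]_p) : open U -> smooth_on U (fun=> c).
Proof.
move=> Uo; apply/smooth_row => // j; apply: smooth_exprP => //; exact: SmoothCst.
Qed.

End LinearCalculus.

(** * Exterior derivative, Lie derivative and Cartan calculus *)

Section ExteriorDerivative.
Context {R : realType} {n : nat}.
Local Notation V := 'rV[R]_n.
Implicit Types (X Y Z : V -> V) (al be : V -> form R n).

Let wl t (a b c : form R n) : wedge (t *: a + b) c = t *: wedge a c + wedge b c.
Proof. by rewrite wedgeDl wedgeZl. Qed.
Let wr (a : form R n) : linear (wedge a).
Proof. exact: wedge_is_linear. Qed.

Section Point.
Variable x : V.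

Lemma partial_iprod k Y al : differentiable Y x -> differentiable al x ->
  partial k (fun y => iprod (Y y) (al y)) x =
  iprod (partial k Y x) (al x) + iprod (Y x) (partial k al x).
Proof.
move=> dY da; apply: (bilinear_derive (b := @iprod R n)) => //.
  by move=> t u v z; rewrite iprodDl iprodZl.
exact: iprod_is_linear.
Qed.

Lemma diff_wedge al be : differentiable al x -> differentiable be x ->
  differentiable (fun y => wedge (al y) (be y)) x.
Proof. by move=> da db; apply: (bilinear_diff wl wr). Qed.

Lemma extdD al be : differentiable al x -> differentiable be x ->
  extd (fun y => al y + be y) x = extd al x + extd be x.
Proof.
move=> da db; rewrite /extd -big_split; apply: eq_bigr => k _.
by rewrite /partial deriveD ?wedgeDr //; apply: diff_derivable.
Qed.

Lemma extdZ t al : differentiable al x -> extd (fun y => t *: al y) x = t *: extd al x.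
Proof.
move=> da; rewrite /extd scaler_sumr; apply: eq_bigr => k _.
by rewrite /partial deriveZ ?wedgeZr //; apply: diff_derivable.
Qed.

Lemma extd_sum m (F : 'I_m -> V -> form R n) : (forall i, differentiable (F i) x) ->
  extd (fun y => \sum_i F i y) x = \sum_i extd (F i) x.
Proof.
move=> dF; rewrite /extd exchange_big; apply: eq_bigr => k _ /=.
rewrite -wedge_sumr; congr wedge.
have -> : (fun y => \sum_i F i y) = \sum_i F i by apply/funext => y; rewrite fct_sumE.
by rewrite /partial derive_sum // => i; apply: diff_derivable.
Qed.

Lemma extd_cst c : extd (fun=> c) x = 0.
Proof. by rewrite /extd big1 // => k _; rewrite /partial derive_cst wedge0r. Qed.

(** The derivative raises the degree by one. With [g] the indicator of a degree this shows that
    every homogeneous part of a closed form is closed. *)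
Lemma extd_dscale g al : differentiable al x ->
  extd (fun y => dscale (g \o succn) (al y)) x = dscale g (extd al x).
Proof.
move=> da; rewrite /extd linear_sum; apply: eq_bigr => k _ /=.
by rewrite dscale_dx /partial (linear_derive (dscale (g \o succn))).
Qed.

Lemma extd_wedge al be : differentiable al x -> differentiable be x ->
  extd (fun y => wedge (al y) (be y)) x =
  wedge (extd al x) (be x) + wedge (parity (al x)) (extd be x).
Proof.
move=> da db; rewrite /extd wedge_suml wedge_sumr -big_split; apply: eq_bigr => k _ /=.
rewrite /partial (bilinear_derive wl wr) // wedgeDr dx_wedgeA wedge_dx.
congr (_ + wedge _ (wedge _ _)).
by rewrite /parity dscaleM -[LHS]dscale1; apply: eq_dscale => p; rewrite -exprD addnn -mul2n exprM sqrrN !expr1n.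
Qed.

(** Termwise in [k]: passing [iprod (Y x)] through [dx k] yields the directional derivative and a
    term that cancels against the derivative of [al] inside the contraction. *)
Lemma cartan Y al : differentiable Y x -> differentiable al x ->
  lie Y al x = extd (fun y => iprod (Y y) (al y)) x + iprod (Y x) (extd al x).
Proof.
move=> dY da; rewrite /lie derive_dir // /extd iprod_sumr -!big_split; apply: eq_bigr => k _ /=.
by rewrite partial_iprod // wedgeDr iprod_dx [LHS]addrC -addrA; congr (_ + _); rewrite addrCA subrr addr0.
Qed.

(** The product rule supplies the derivative of [Z] along [Y]; the other half of the bracket appears
    when [iprod (Z x)] is moved past the [dx k] in the definition of [lie]. *)
Lemma lie_iprod Y Z al : differentiable Y x -> differentiable Z x -> differentiable al x ->
  lie Y (fun y => iprod (Z y) (al y)) x =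
  iprod (bracket Y Z x) (al x) + iprod (Z x) (lie Y al x).
Proof.
move=> dY dZ da; rewrite /lie /bracket iprodDl iprodNl iprodDr iprod_sumr.
rewrite (bilinear_derive (b := @iprod R n)) //; first last.
- exact: iprod_is_linear.
- by move=> t u v z; rewrite iprodDl iprodZl.
have -> : \sum_k iprod (Z x) (wedge (dx k) (iprod (partial k Y x) (al x))) =
    iprod ('D_(Z x) Y x) (al x)
    + \sum_k wedge (dx k) (iprod (partial k Y x) (iprod (Z x) (al x))).
  rewrite derive_dir // iprod_suml -big_split; apply: eq_bigr => k _ /=.
  by rewrite iprod_dx iprodZl (iprodC (Z x)) wedgeNr opprK.
by rewrite -!addrA; congr (_ + _); rewrite [RHS]addrCA addKr.
Qed.

End Point.

Lemma extd_homog (U : set V) p al x : open U -> (forall y, U y -> homog p (al y)) ->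
  U x -> differentiable al x -> homog p.+1 (extd al x).
Proof.
move=> Uo ha Ux da; apply/homogP.
rewrite -(@extd_dscale x (fun q => (q == p.+1)%:R) al da).
rewrite /extd; apply: eq_bigr => k _; congr wedge.
apply: (eq_partial Uo) Ux => y Uy.
by rewrite (homog_dscale _ (ha y Uy)) /= eqxx scale1r.
Qed.

Lemma eq_extd (U : set V) al be x : open U -> (forall y, U y -> al y = be y) -> U x ->
  extd al x = extd be x.
Proof.
by move=> Uo ab Ux; apply: eq_bigr => k _; rewrite (eq_partial Uo k ab).
Qed.

Lemma diff_iter_wedge al x m : differentiable al x ->
  differentiable (fun y => iter m (wedge (al y)) unit_form) x.
Proof.
move=> da; elim: m => [|m IH]; first exact: differentiable_cst.
exact: diff_wedge.
Qed.

Lemma extd_exp al x : differentiable al x -> extd al x = 0 -> extd (fun y => exp_form (al y)) x = 0.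
Proof.
move=> da ca.
have ci m : extd (fun y => iter m (wedge (al y)) unit_form) x = 0.
  elim: m => [|m IH]; first exact: extd_cst.
  by rewrite extd_wedge ?IH ?ca ?wedge0l ?wedge0r ?addr0 //; apply: diff_iter_wedge.
rewrite /exp_form extd_sum => [|m]; last exact/differentiableZ/diff_iter_wedge.
by apply: big1 => m _; rewrite extdZ ?ci ?scaler0 //; apply: diff_iter_wedge.
Qed.

End ExteriorDerivative.

(** * Functions with vanishing partial derivatives *)

Section LocallyConstant.
Context {R : realType} {n : nat}.
Local Notation V := 'rV[R]_n.

(** A small ball is convex, so the segment from [x] to [y] stays in [U] and the mean value theorem
    applies along it. *)
Lemma partial0_locally_constant (U : set V) (f : V -> R) x : open U -> U x ->
  (forall y, U y -> differentiable f y) ->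
  (forall y, U y -> forall k, partial k f y = 0) ->
  \forall y \near x, f y = f x.
Proof.
move=> Uo Ux df pf.
have /nbhs_normP[e /= e0 eU] : nbhs x U by exact: open_nbhs_nbhs.
apply/nbhs_normP; exists e => //= y; rewrite /ball_ /= => xy.
pose l (t : R) : V := x + t *: (y - x).
have lU t : `|t| <= 1 -> U (l t).
  move=> t1; apply: eU => /=; rewrite /l opprD addrA subrr sub0r normrN normrZ.
  by apply: le_lt_trans xy; rewrite distrC ler_piMl.
have dl t : is_diff t l ( *:%R^~ (y - x)).
  have := is_diffD (is_diff_cst x t) (is_diff_scalel t (y - x)).
  by rewrite add0r.
have dg (t : R) : `|t| <= 1 -> is_derive t (1 : R) (f \o l) 0.
  move=> t1; have dfl := df _ (lU t t1).
  have dlt : differentiable l t by [].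
  split; first by apply/diff_derivable/differentiable_comp.
  rewrite deriveE; last exact: differentiable_comp.
  rewrite diff_comp //= diff_val scale1r -deriveE // derive_dir // big1 // => k _.
  by rewrite pf ?scaler0 //; apply: lU.
have [||c _] := @MVT R (f \o l) (cst 0) 0 1 ltr01.
- move=> t; rewrite in_itv /= => /andP[t0 t1]; apply: dg.
  by rewrite ger0_norm ltW.
- apply: derivable_within_continuous => t; rewrite in_itv /= => /andP[t0 t1].
  by apply: ex_derive; apply: dg; rewrite ger0_norm.
- rewrite /cst mul0r /= /l scale1r scale0r addr0 (addrC x) subrK => /eqP.
  by rewrite subr_eq0 => /eqP.
Qed.

End LocallyConstant.

(** * Covectors, degree bookkeeping and coefficients of top degree *)

Section OneForms.
Context {R : realType} {n : nat}.
Implicit Types (a b th : form R n) (X Y Z : 'rV[R]_n).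

Lemma dotDr X Y Z : dot X (Y + Z) = dot X Y + dot X Z :> R. Proof. exact: linearD. Qed.
Lemma dotZr t X Y : dot X (t *: Y) = t * dot X Y :> R. Proof. exact: linearZ. Qed.
Lemma dotNr X Y : dot X (- Y) = - dot X Y :> R. Proof. exact: linearN. Qed.
Lemma dot0r X : dot X 0 = 0 :> R. Proof. exact: linear0. Qed.
Lemma dotDl X Y Z : dot (X + Y) Z = dot X Z + dot Y Z :> R.
Proof. by rewrite !(dotC _ Z) dotDr. Qed.
Lemma dotZl t X Y : dot (t *: X) Y = t * dot X Y :> R.
Proof. by rewrite !(dotC _ Y) dotZr. Qed.
Lemma dotNl X Y : dot (- X) Y = - dot X Y :> R.
Proof. by rewrite !(dotC _ Y) dotNr. Qed.
Lemma dot0l X : dot 0 X = 0 :> R. Proof. by rewrite dotC dot0r. Qed.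

Definition row_of_form th : 'rV[R]_n := \row_k coef th [set k]%SET.

Lemma covector_row_of_form th : homog 1%N th -> covector (row_of_form th) = th.
Proof.
move=> h; apply/formP => I; rewrite /covector coef_sum.
have [/cards1P[k ->]|I1] := boolP (#|I| == 1%N).
  rewrite (bigD1 k) //= big1 ?addr0 => [|j jk]; rewrite coefZ coef_dx.
    by rewrite eqxx mulr1 mxE.
  by rewrite eq_sym (inj_eq (@finset.set1_inj _)) (negPf jk) mulr0.
rewrite h // big1 // => k _; rewrite coefZ coef_dx; case: (I =P _) => [e|]; last by rewrite mulr0.
by rewrite e finset.cards1 in I1.
Qed.

Lemma coef_iprod_covector X y : coef (iprod X (covector y)) finset.set0 = dot X y.
Proof.
rewrite -[covector y]wedge1r iprod_covector iprod1 linear0 subr0 coefZ coef_unit.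
by rewrite eqxx mulr1.
Qed.

Lemma homog0E a : homog 0%N a -> a = coef a finset.set0 *: unit_form.
Proof.
move=> h; apply/formP => I; rewrite coefZ coef_unit.
have [->|I0] := eqVneq I finset.set0; first by rewrite mulr1.
by rewrite mulr0 h // cards_eq0.
Qed.

(** Only degrees with sum [m] meet in this coefficient, so sign identities for the Mukai pairing
    need checking only for complementary degrees. *)
Lemma coef_wedge_dscale m (g h g' h' : nat -> R) a b (I : {set 'I_n}) : #|I| = m ->
  (forall p q, (p + q = m)%N -> g p * h q = g' p * h' q) ->
  coef (wedge (dscale g a) (dscale h b)) I = coef (wedge (dscale g' a) (dscale h' b)) I.
Proof.
move=> Im e; rewrite !coef_wedge; apply: eq_bigr => J JI; rewrite !coef_dscale.
have /e eJ : (#|J| + #|I :\: J| = m)%N by rewrite -Im -(cardsID J I) (finset.setIidPr JI).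
transitivity (shuffle_sign J (I :\: J) * coef a J * coef b (I :\: J) * (g #|J| * h #|I :\: J|)).
  by ring.
by rewrite eJ; ring.
Qed.

Lemma coef_top_homog p a : p != n -> homog p a -> coef a [set: 'I_n]%SET = 0.
Proof. by move=> pn -> //; rewrite finset.cardsT card_ord eq_sym. Qed.

Lemma coef_iprod_setT X a : coef (iprod X a) [set: 'I_n]%SET = 0.
Proof. by rewrite coef_iprod big1 // => k; rewrite finset.in_setT. Qed.

(** A contraction has no top degree part, so the Leibniz rule becomes an integration by parts. *)
Lemma iprod_wedge_setT X a b : coef (wedge (iprod X a) b) [set: 'I_n]%SET =
  - coef (wedge (parity a) (iprod X b)) [set: 'I_n]%SET.
Proof. by apply/eqP; rewrite -addr_eq0 -coefD -iprod_wedge coef_iprod_setT. Qed.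

Lemma wedge_covectorl a y b :
  wedge a (wedge (covector y) b) = wedge (covector y) (wedge (parity a) b).
Proof.
rewrite !wedge_covector_coord wedge_sumr; apply: eq_bigr => k _.
by rewrite wedgeZr wedge_dx.
Qed.

End OneForms.

(** * Mukai pairing, the quadratic map [Q] and the quartic invariant *)

Section Clifford.
Context {R : realType}.
Local Notation E := 'rV[R]_5.
Local Notation L := (form R 5).
Local Notation T := [set: 'I_5]%SET.
Implicit Types (u v w : E * E) (a b c phi psi : L) (rho : L * L) (X Y : E).

Lemma mukaiDl a b c : mukai (a + b) c = mukai a c + mukai b c.
Proof. by rewrite /mukai wedgeDl coefD. Qed.
Lemma mukaiZl t a b : mukai (t *: a) b = t * mukai a b.
Proof. by rewrite /mukai wedgeZl coefZ. Qed.
Lemma mukaiNl a b : mukai (- a) b = - mukai a b.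
Proof. by rewrite /mukai wedgeNl coefN. Qed.

Lemma sigmaE a : sigma a = dscale (fun p => (-1) ^+ (p./2)) a.
Proof. by []. Qed.

Lemma mukaiDr a b c : mukai a (b + c) = mukai a b + mukai a c.
Proof. by rewrite /mukai !sigmaE linearD wedgeDr coefD. Qed.
Lemma mukaiZr t a b : mukai a (t *: b) = t * mukai a b.
Proof. by rewrite /mukai !sigmaE linearZ /= wedgeZr coefZ. Qed.
Lemma mukaiNr a b : mukai a (- b) = - mukai a b.
Proof. by rewrite /mukai !sigmaE linearN wedgeNr coefN. Qed.

Let sgn_half q : (-1) ^+ (q.+1./2) = (-1) ^+ (q./2) * (-1) ^+ q :> R.
Proof. by rewrite -[q.+1./2]/(uphalf q) uphalf_half addnC exprD signr_odd. Qed.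

Let sgn2 q : (-1) ^+ q * (-1) ^+ q = 1 :> R.
Proof. by rewrite -exprD addnn -mul2n exprM sqrrN !expr1n. Qed.

(** When the degree [q] of [b] goes up by one, [sigma] changes by the sign of parity [q], while
    moving the covector past [a] costs the sign of parity [p]. The remaining degrees satisfy p + q =
    4, so the two signs cancel. The contraction case below is the same with p + q = 5 and the minus
    sign of [iprod_wedge_setT]. *)
Lemma mukai_covector y a b :
  mukai (wedge (covector y) a) b = mukai a (wedge (covector y) b).
Proof.
rewrite /mukai !sigmaE dscale_covector wedge_covectorl wedgeA !wedge_covector_coord !coef_sum.
apply: eq_bigr => k _; rewrite !coefZ !coef_dx_wedge finset.in_setT; congr (_ * (_ * _)).
rewrite -[in LHS](dscale1 a); apply: (@coef_wedge_dscale _ _ 4).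
  by have := cardsD1 k T; rewrite finset.in_setT finset.cardsT card_ord => -[].
move=> p q pq /=; rewrite mul1r sgn_half mulrCA -[(-1) ^+ p]signr_odd -[(-1) ^+ q in RHS]signr_odd.
have -> : odd p = odd q by lia.
by rewrite sgn2 mulr1.
Qed.

Lemma mukai_iprod X a b : mukai (iprod X a) b = mukai a (iprod X b).
Proof.
rewrite /mukai !sigmaE iprod_wedge_setT dscale_iprod -coefN -wedgeNl /parity -scaleN1r -dscaleZ.
rewrite -[in RHS](dscale1 a); apply: (@coef_wedge_dscale _ _ 5).
  by rewrite finset.cardsT card_ord.
move=> p q pq /=; rewrite mul1r sgn_half mulN1r mulNr mulrCA -[(-1) ^+ p]signr_odd -[(-1) ^+ q in LHS]signr_odd.
have -> : odd p = ~~ odd q by lia.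
by rewrite signrN mulNr sgn2 mulrN1 opprK.
Qed.

Lemma mukai_clifford v a b : mukai (clifford v a) b = mukai a (clifford v b).
Proof. by rewrite /clifford mukaiDl mukaiDr mukai_iprod mukai_covector. Qed.

(** For [p] odd and p + q = 5 the halves [p./2] and [q./2] add up to 2, so [sigma] gives the same
    sign on either factor. *)
Lemma mukaiC a b : odd_form a -> even_form b -> mukai a b = mukai b a.
Proof.
move=> ha hb; rewrite /mukai !sigmaE [in RHS]wedgeC_even //.
have -> : a = dscale (fun p => (odd p)%:R) a.
  apply/formP => I; rewrite coef_dscale; case: (boolP (odd _)) => [_|/ha->]; first by rewrite mul1r.
  by rewrite mulr0.
rewrite dscaleM -[in RHS](dscale1 b); apply: (@coef_wedge_dscale _ _ 5).
  by rewrite finset.cardsT card_ord.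
move=> p q pq; rewrite mulr1; case: (boolP (odd p)) => op; last by rewrite mul0r mulr0.
rewrite mul1r mulr1 -[LHS]signr_odd -[RHS]signr_odd; congr (_ ^+ nat_of_bool _).
by lia.
Qed.

Lemma mukai_basis a (I : {set 'I_5}) :
  mukai a (basis_form (~: I)%SET) =
  shuffle_sign I (~: I)%SET * (-1) ^+ (#|~: I|%SET./2) * coef a I.
Proof.
rewrite /mukai coef_wedge (bigD1 I) ?finset.subsetT //= big1 ?addr0.
  by rewrite finset.setTD sigmaE coef_dscale coef_basis eqxx mulr1 mulrAC.
move=> J /andP[_ JI]; rewrite finset.setTD sigmaE coef_dscale coef_basis.
by rewrite (inj_eq (@finset.setC_inj _)) (negPf JI) !mulr0.
Qed.

(** Pairing with the basis form of the complement reads off one coefficient up to sign, and the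
    complement of an odd set in five elements is even. *)
Lemma mukai_nondegenerate a : odd_form a -> (forall b, even_form b -> mukai a b = 0) -> a = 0.
Proof.
move=> ha h; apply/formP => I; rewrite coef0.
have [oI|] := boolP (odd #|I|); last exact: ha.
have := h (basis_form (~: I)%SET); rewrite mukai_basis => /(_ _)/eqP.
rewrite !mulf_eq0 !signr_eq0 /= => e; apply/eqP/e => J oJ.
rewrite coef_basis; case: eqP => // JI; move: oJ; rewrite JI.
by have := cardsC I; rewrite card_ord => /(congr1 odd); rewrite oddD oI /=; case: odd.
Qed.

(** ** The inner product *)

Lemma innerE v w : inner v w = 2^-1 * (dot v.1 w.2 + dot w.1 v.2).
Proof. by []. Qed.

Lemma innerC v w : inner v w = inner w v.
Proof. by rewrite !innerE addrC. Qed.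

Lemma innerDl u v w : inner (u + v) w = inner u w + inner v w.
Proof. by rewrite !innerE /= linearD !(dotC _ w.2) linearD /=; ring. Qed.

Lemma innerZl t v w : inner (t *: v) w = t * inner v w.
Proof. by rewrite !innerE /= linearZ !(dotC _ w.2) linearZ /=; ring. Qed.

Lemma innerNl v w : inner (- v) w = - inner v w.
Proof. by rewrite -scaleN1r innerZl mulN1r. Qed.
Lemma innerDr u v w : inner u (v + w) = inner u v + inner u w.
Proof. by rewrite !(innerC u) innerDl. Qed.
Lemma innerZr t v w : inner v (t *: w) = t * inner v w.
Proof. by rewrite !(innerC v) innerZl. Qed.
Lemma innerNr v w : inner v (- w) = - inner v w.
Proof. by rewrite !(innerC v) innerNl. Qed.

Lemma inner_eq u v : (forall w, inner u w = inner v w) -> u = v.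
Proof.
have h2 : (2^-1 : R) != 0 by rewrite invr_eq0 pnatr_eq0.
move=> e; case: u v e => u1 u2 [v1 v2] e; congr pair; apply/rowP => k.
  have := e (0, delta_mx ord0 k); rewrite !innerE /= => /(mulfI h2).
  by rewrite ![dot 0 _]dotC !linear0 !addr0 !dot_delta.
have := e (delta_mx ord0 k, 0); rewrite !innerE /= => /(mulfI h2).
by rewrite !linear0 !add0r ![dot (delta_mx _ _) _]dotC !dot_delta.
Qed.

(** The hypotheses say that [r] carries [q1'] and [q2'] to [k] times [q1] and [q2]. Used with a
    reflection, for the spin group, and with the action of a linear change of coordinates. *)
Lemma inner_isometry (r r' : E * E -> E * E) (k : R) q1 q2 q1' q2' :
  cancel r' r -> (forall v w, inner (r v) (r w) = inner v w) ->
  (forall v, inner q1' v = k * inner q1 (r v)) ->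
  (forall v, inner q2' v = k * inner q2 (r v)) ->
  inner q1' q2' = k ^+ 2 * inner q1 q2.
Proof.
move=> rK iso e1 e2; rewrite e1.
suff -> : r q2' = k *: q2 by rewrite innerZr; ring.
by apply: inner_eq => w; rewrite -{1}(rK w) iso e2 rK innerZl.
Qed.

Lemma cliffordDr v a b : clifford v (a + b) = clifford v a + clifford v b.
Proof. by rewrite /clifford iprodDr wedgeDr addrACA. Qed.
Lemma cliffordZr v t a : clifford v (t *: a) = t *: clifford v a.
Proof. by rewrite /clifford iprodZr wedgeZr scalerDr. Qed.
Lemma cliffordDl v w a : clifford (v + w) a = clifford v a + clifford w a.
Proof. by rewrite /clifford /= iprodDl linearD wedgeDl addrACA. Qed.
Lemma cliffordZl t v a : clifford (t *: v) a = t *: clifford v a.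
Proof. by rewrite /clifford /= iprodZl linearZ /= wedgeZl scalerDr. Qed.
Lemma cliffordNl v a : clifford (- v) a = - clifford v a.
Proof. by rewrite -scaleN1r cliffordZl scaleN1r. Qed.
Lemma clifford_vec X a : clifford (X, 0) a = iprod X a.
Proof. by rewrite /clifford /= linear0 wedge0l addr0. Qed.
Lemma clifford_covec y a : clifford (0, y) a = wedge (covector y) a.
Proof. by rewrite /clifford /= iprod0l add0r. Qed.

Lemma cliffordC v w a : clifford v (clifford w a) =
  (2 * inner v w) *: a - clifford w (clifford v a).
Proof.
rewrite /clifford !iprodDr !wedgeDr !iprod_covector (iprodC v.1) (covectorC v.2).
have -> : 2 * inner v w = dot v.1 w.2 + dot w.1 v.2.
  by rewrite innerE mulrA divff ?pnatr_eq0 // mul1r.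
rewrite scalerDl; set p := dot _ _ *: a; set q := dot _ _ *: a.
set A := iprod _ _; set B := wedge _ (iprod _ _); set C := wedge _ (iprod _ _); set D := wedge _ _.
apply/eqP; rewrite -subr_eq0; apply/eqP/rowP => i; rewrite !mxE; ring.
Qed.

Lemma clifford_sqr v a : clifford v (clifford v a) = inner v v *: a.
Proof.
have /eqP := cliffordC v v a; rewrite -subr_eq0 opprB addrA -mulr2n -scaler_nat -scalerA.
rewrite -scalerBr scaler_eq0 pnatr_eq0 /=.
by rewrite subr_eq0 => /eqP.
Qed.

Lemma clifford_odd v phi : even_form phi -> odd_form (clifford v phi).
Proof.
move=> h I oI; rewrite coefD wedge_covector_coord coef_sum coef_iprod !big1 ?addr0 // => k kI.
  rewrite coefZ coef_dx_wedge; case: ifP => kI'; last by rewrite mulr0.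
  by rewrite h ?mulr0 //; move: oI; rewrite (cardsD1 k I) kI' add1n /= negbK.
by rewrite h ?mulr0 // finset.cardsU1 kI add1n.
Qed.

Lemma clifford_even v phi : odd_form phi -> even_form (clifford v phi).
Proof.
move=> h I oI; rewrite coefD wedge_covector_coord coef_sum coef_iprod !big1 ?addr0 // => k kI.
  rewrite coefZ coef_dx_wedge; case: ifP => kI'; last by rewrite mulr0.
  by rewrite h ?mulr0 //; move: oI; rewrite (cardsD1 k I) kI' add1n.
by rewrite h ?mulr0 // finset.cardsU1 kI add1n /= negbK.
Qed.

Lemma mukai_homog q a b : homog q b -> mukai a b = (-1) ^+ (q./2) * coef (wedge a b) T.
Proof. by move=> hb; rewrite /mukai sigmaE (homog_dscale _ hb) wedgeZr coefZ. Qed.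

Lemma mukai_homog0 p q a b : homog p a -> homog q b -> (p + q)%N != 5%N -> mukai a b = 0.
Proof.
move=> ha hb pq; rewrite (mukai_homog _ hb) (coef_top_homog pq) ?mulr0 //.
exact: homog_wedge.
Qed.

Lemma dot_row_iprod X Y be : homog 2%N be ->
  dot Y (row_of_form (iprod X be)) = coef (iprod Y (iprod X be)) finset.set0.
Proof.
move=> hb; rewrite -coef_iprod_covector covector_row_of_form //; exact: homog_iprod.
Qed.

Lemma coef_top_covector_iprod X y :
  coef (wedge (covector y) (iprod X top_form)) T = dot X y.
Proof. by rewrite covector_iprod_top coefZ coef_top mulr1. Qed.

(** Of the products in the Mukai pairing only those of complementary degree survive. Recording the
    square of [be] by the vector [Z] makes the answer a plain pair of vectors. *)
Lemma Q_explicit t be Y Z : homog 2%N be -> wedge be be = iprod Z top_form ->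
  Q (t *: unit_form + be + iprod Y top_form) =
  (4 * t *: Y - 2 *: Z, - (4 *: row_of_form (iprod Y be))).
Proof.
move=> hb bb; set ga := iprod Y top_form; apply: inner_eq => -[X y].
have h0 : homog 0%N (t *: unit_form : L) by apply/homogZ/homog_unit.
have h4 : homog 4%N ga by apply/homog_iprod/homog_top.
have hX : homog 1%N (iprod X be) by apply: homog_iprod.
have hXga : homog 3%N (iprod X ga) by apply: homog_iprod.
have hy : homog 1%N (covector y) by apply: homog_covector.
have ebe := homog_even (isT : ~~ odd 2) hb.
have ega := homog_even (isT : ~~ odd 4) h4.
rewrite Q_spec /clifford /= mukaiDl.
have -> : mukai (iprod X (t *: unit_form + be + ga)) (t *: unit_form + be + ga) =
    2 * dot Y (row_of_form (iprod X be)).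
  rewrite !iprodDr iprodZr iprod1 scaler0 add0r !mukaiDl !mukaiDr.
  rewrite (mukai_homog0 hX h0) // (mukai_homog0 hX hb) // (mukai_homog0 hXga h0) //.
  rewrite (mukai_homog0 hXga h4) // [mukai (iprod X ga) be]mukai_iprod.
  rewrite -(mukaiC (homog_odd (isT : odd 1) hX) ega).
  rewrite (mukai_homog _ h4) -(covector_row_of_form hX) coef_top_covector_iprod.
  by rewrite covector_row_of_form //=; ring.
have -> : mukai (wedge (covector y) (t *: unit_form + be + ga)) (t *: unit_form + be + ga) =
    2 * t * dot Y y - dot Z y.
  rewrite !wedgeDr wedgeZr wedge1r !mukaiDl !mukaiDr !mukaiZl !mukaiZr.
  have hyb : homog 3%N (wedge (covector y) be) := homog_wedge hy hb.
  have hyg : homog 5%N (wedge (covector y) ga) := homog_wedge hy h4.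
  have h1 : homog 0%N (unit_form : L) := homog_unit.
  rewrite (mukai_homog0 hy h1) // (mukai_homog0 hy hb) // (mukai_homog0 hyb h1) //.
  rewrite (mukai_homog0 hyb h4) // (mukai_homog0 hyg hb) // (mukai_homog0 hyg h4) //.
  rewrite (mukai_homog _ h4) (mukai_homog _ hb) (mukai_homog _ h1) wedge1r wedgeA bb.
  by rewrite !coef_top_covector_iprod /=; ring.
rewrite innerE /= dotNr dotZr dotDl dotNl !dotZl.
rewrite !dot_row_iprod // (iprodC Y X) coefN.
set d1 := coef _ _; set d2 := dot _ _; set d3 := dot _ _.
by lra.
Qed.

Definition vector_part phi : E :=
  \row_k coef (wedge (dx k) (dscale (fun q => (q == 4)%:R) phi)) T.

Lemma homog_part p a : homog p (dscale (fun q => (q == p)%:R) a).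
Proof. by apply/homogP; rewrite dscaleM; apply: eq_dscale => q; case: eqP; rewrite ?mulr0 ?mulr1. Qed.

Lemma even_form_split phi : even_form phi ->
  phi = coef phi finset.set0 *: unit_form + dscale (fun q => (q == 2)%:R) phi
        + iprod (vector_part phi) top_form.
Proof.
move=> h; rewrite -(iprod_topE (p := 4)) //; last exact: homog_part.
apply/formP => I; rewrite !coefD coefZ coef_unit !coef_dscale.
have I5 : (#|I| <= 5)%N by rewrite -[X in (_ <= X)%N](card_ord 5) max_card.
have [->|I0] := eqVneq I finset.set0; first by rewrite finset.cards0 /=; ring.
have {}I0 : (#|I| != 0)%N by rewrite cards_eq0.
have := h I; move: I5 I0; case: #|I| => [|[|[|[|[|[|//]]]]]] //= _ _ e.
- by rewrite e //; ring.
- by ring.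
- by rewrite e //; ring.
- by ring.
- by rewrite e //; ring.
Qed.

Lemma square_vector (be : L) : homog 2%N be -> exists Z, wedge be be = iprod Z top_form.
Proof. by move=> hb; eexists; apply: (iprod_topE (p := 4)) => //; apply: (homog_wedge hb hb). Qed.

(* the cube of a 2-form vanishes in dimension 5 *)
Lemma iprod_square (be : L) X : homog 2%N be -> wedge (iprod X be) (wedge be be) = 0.
Proof.
move=> hb; have eb := homog_even (isT : ~~ odd 2) hb.
have : iprod X (wedge be (wedge be be)) = 0.
  by rewrite (homog_gt (_ : (5 < 2 + (2 + 2))%N) (homog_wedge hb (homog_wedge hb hb))) // iprod0r.
rewrite !iprod_wedge !parity_even // !wedgeDr (wedgeC_even (iprod X be) eb) -!wedgeA.
rewrite (wedgeC_even (iprod X be) eb) !wedgeA.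
rewrite -mulr2n -mulrS -scaler_nat => /eqP; rewrite scaler_eq0 pnatr_eq0 /= => /eqP.
by [].
Qed.

(** The pairing of [Y] with the contraction of [be] by [Y] vanishes by skewness. The pairing with
    [Z] is the contraction of [be] wedged with its square, zero by [iprod_square]. *)
Lemma Q_null phi : even_form phi -> inner (Q phi) (Q phi) = 0.
Proof.
move=> /even_form_split ->; set t := coef _ _; set be := dscale _ _; set Y := vector_part _.
have hb : homog 2%N be by apply: homog_part.
have [Z bb] := square_vector hb.
rewrite (Q_explicit _ _ hb bb) innerE /= dotNr dotZr dotDl dotNl !dotZl.
rewrite [dot Y _]dot_row_iprod // iprod_sqr coef0.
have -> : dot Z (row_of_form (iprod Y be)) = 0.
  rewrite -coef_top_covector_iprod covector_row_of_form; last exact: homog_iprod.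
  by rewrite -bb iprod_square // coef0.
by ring.
Qed.

Lemma mukai_polarC v phi psi : even_form phi -> even_form psi ->
  mukai (clifford v psi) phi = mukai (clifford v phi) psi.
Proof.
by move=> h1 h2; rewrite mukai_clifford; apply/esym/mukaiC => //; apply: clifford_odd.
Qed.

Fact polar_key : unit. Proof. exact: tt. Qed.
(** The polarisation of [Q], locked so that it stays an atom under the bilinearity rewrites of
    [inner]. *)
Definition polar phi psi : E * E :=
  locked_with polar_key (Q (phi + psi) - Q phi - Q psi).

Lemma inner_polar phi psi v : even_form phi -> even_form psi ->
  inner (polar phi psi) v = 2 * mukai (clifford v phi) psi.
Proof.
move=> h1 h2; rewrite /polar [locked_with _ _]unlock !(innerDl, innerNl) !Q_spec cliffordDr (mukaiDl (clifford v phi)).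
rewrite !(mukaiDr (clifford v _)) mukai_polarC //.
by ring.
Qed.

Lemma even_formD phi psi : even_form phi -> even_form psi -> even_form (phi + psi).
Proof. by move=> h1 h2 I oI; rewrite coefD h1 ?h2 ?addr0. Qed.

Lemma even_formZ t phi : even_form phi -> even_form (t *: phi).
Proof. by move=> h I oI; rewrite coefZ h ?mulr0. Qed.

Lemma QD x y phi psi : even_form phi -> even_form psi ->
  Q (x *: phi + y *: psi) =
  x ^+ 2 *: Q phi + (x * y) *: polar phi psi + y ^+ 2 *: Q psi.
Proof.
move=> h1 h2; apply: inner_eq => v.
rewrite !(innerDl, innerZl) inner_polar // !Q_spec cliffordDr !cliffordZr.
rewrite (mukaiDl (x *: clifford v phi)) !(mukaiDr (_ *: clifford v _)) !(mukaiZl, mukaiZr).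
by rewrite mukai_polarC //; ring.
Qed.

Lemma Q_null_polar phi psi : even_form phi -> even_form psi ->
  [/\ inner (Q phi) (polar phi psi) = 0, inner (Q psi) (polar phi psi) = 0
    & inner (polar phi psi) (polar phi psi) = - 2 * inner (Q phi) (Q psi)].
Proof.
move=> h1 h2.
have N x y : x ^+ 3 * y * 2 * inner (Q phi) (polar phi psi)
    + x ^+ 2 * y ^+ 2 * (2 * inner (Q phi) (Q psi) + inner (polar phi psi) (polar phi psi))
    + x * y ^+ 3 * 2 * inner (Q psi) (polar phi psi) = 0.
  have := Q_null (even_formD (even_formZ x h1) (even_formZ y h2)); rewrite QD //.
  rewrite !(innerDl, innerDr, innerZl, innerZr) !Q_null // (innerC (Q psi) (Q phi)).
  rewrite (innerC (polar _ _) (Q _)) (innerC (polar _ _) (Q psi)) => <-.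
  by ring.
(* Nullity of [Q] along a pencil is a polynomial identity with three unknown coefficients; these
   three evaluations are independent. *)
move: (N 1 1) (N 1 (-1)) (N 2 1) => e1 e2 e3.
by split; lra.
Qed.

Lemma det2 (A : 'M[R]_2) : \det A = A 0 0 * A 1 1 - A 0 1 * A 1 0.
Proof.
rewrite (expand_det_row _ 0) !big_ord_recl big_ord0 addr0 /cofactor !det_mx11 !mxE /=.
rewrite expr0 expr1 mul1r mulN1r mulrN.
by congr (A _ _ * A _ _ - A _ _ * A _ _); apply: val_inj.
Qed.

(** With rows (a, b) and (c, d), the [Q] terms contribute the squares of ad and bc, and the inner
    square of [polar] contributes -2abcd: together, the squared determinant. *)
Lemma quartic_mix (A : 'M[R]_2) rho : even_pairs rho ->
  quartic (mix A rho) = (\det A) ^+ 2 * quartic rho.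
Proof.
case: rho => r1 r2 [/= h1 h2]; rewrite /quartic /mix /= !QD // det2.
have [e1 e2 e3] := Q_null_polar h1 h2.
rewrite !(innerDl, innerDr, innerZl, innerZr) !Q_null // (innerC (Q r2) (Q r1)).
rewrite (innerC (polar _ _) (Q _)) (innerC (polar _ _) (Q r2)) e1 e2 e3.
by ring.
Qed.

(** ** The derivative of the volume *)

Definition hat1 rho : L := - (vol_density rho)^-1 *: clifford (Q rho.1) rho.2.
Definition hat2 rho : L := (vol_density rho)^-1 *: clifford (Q rho.2) rho.1.

Lemma is_hat_hat rho : even_pairs rho -> 0 < quartic rho -> is_hat rho (hat1 rho, hat2 rho).
Proof.
case: rho => r1 r2 [/= e1 e2] q0 [s1 s2] [/= f1 f2].
set q := quartic (r1, r2) in q0.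
have iP (a b : L) : even_form a -> even_form b -> forall v, inner v (polar a b) = 2 * mukai (clifford v a) b.
  by move=> ha hb v; rewrite innerC inner_polar.
(* Along a line the quartic is a polynomial in [t]; [c1] is its linear coefficient and so its
   derivative at 0. *)
pose c1 := 2 * mukai (clifford (Q r2) r1) s1 + 2 * mukai (clifford (Q r1) r2) s2.
pose c2 := inner (Q s1) (Q r2) + inner (polar r1 s1) (polar r2 s2) + inner (Q r1) (Q s2).
pose c3 := inner (Q s1) (polar r2 s2) + inner (polar r1 s1) (Q s2).
pose c4 := inner (Q s1) (Q s2).
have quarticE t : quartic (t *: (s1, s2) + (r1, r2)) =
    q + t * (c1 + t * (c2 + t * (c3 + t * c4))).
  rewrite /q /quartic /= ![t *: _ + _]addrC -[X in Q (X + _)]scale1r -[X in inner _ (Q (X + _))]scale1r.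
  rewrite !QD // !(innerDl, innerDr, innerZl, innerZr) inner_polar // iP // /c1 /c2 /c3 /c4.
  by ring.
apply: is_derive_line.
have -> : (fun t : R => vol_density (t *: (s1, s2) + (r1, r2))) =
    Num.sqrt \o (fun t => q + t * (c1 + t * (c2 + t * (c3 + t * c4)))).
  by apply/funext => t; rewrite /vol_density quarticE.
set g := fun t : R => _.
have dg : is_derive (0 : R) (1 : R) g c1.
  pose u : {poly R} := c1%:P + 'X * (c2%:P + 'X * (c3%:P + 'X * c4%:P)).
  have -> : g = horner (q%:P + 'X * u) by apply/funext => t; rewrite /u /g !(hornerD, hornerM, hornerX, hornerC).
  apply: is_derive_eq; rewrite derivD derivC derivM derivX mul1r add0r.
  by rewrite /u !(hornerD, hornerM, hornerX, hornerC); ring.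
have dgf : differentiable g 0 by apply/derivable1_diffP; apply: ex_derive.
have g0 : g 0 = q by rewrite /g mul0r addr0.
split.
  apply/diff_derivable; apply: (differentiable_comp dgf); apply/derivable1_diffP.
  by apply: ex_derive; apply: is_derive1_sqrt; rewrite g0.
rewrite derive_sqrt_comp ?g0 // derive_val /c1 /hat1 /hat2 /vol_density -/q /= !mukaiZl.
by rewrite invfM; field; rewrite gt_eqF // sqrtr_gt0.
Qed.

End Clifford.

(** * The action of 2-forms by exponentials *)

Section Exponential.
Context {R : realType}.
Local Notation L := (form R 5).
Implicit Types (a b B C : L).

Lemma exp_formE B : homog 2%N B -> exp_form B = unit_form + B + 2^-1 *: wedge B B.
Proof.
move=> hB; rewrite /exp_form !big_ord_recl big_ord0 /=.
have hBBB c p : homog p c -> wedge B (wedge B (wedge B c)) = 0.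
  by move=> hc; apply: homog_gt (homog_wedge hB (homog_wedge hB (homog_wedge hB hc))).
rewrite !(hBBB _ 0%N) ?wedge0r ?scaler0 ?addr0; last exact: homog_unit.
by rewrite !wedge1r fact0 [(bump _ _)`!]/= [(bump 0 _)`!]/= !invr1 !scale1r addrA.
Qed.

Lemma wedgeC2 B a : homog 2%N B -> wedge B a = wedge a B.
Proof. by move=> hB; apply: wedgeC_even; apply: (homog_even (p := 2)). Qed.

Lemma exp_formD B C : homog 2%N B -> homog 2%N C ->
  wedge (exp_form B) (exp_form C) = exp_form (B + C).
Proof.
move=> hB hC.
rewrite !exp_formE //; last exact: homogD.
rewrite (wedgeDr (B + C)) !(wedgeDl B C) (wedgeC2 C hB).
set BC := wedge C B; have hBC : homog 4%N BC := homog_wedge hC hB.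
set BB := wedge B B; have hBB : homog 4%N BB := homog_wedge hB hB.
set CC := wedge C C; have hCC : homog 4%N CC := homog_wedge hC hC.
rewrite !(wedgeDl, wedgeDr, wedgeZl, wedgeZr, wedge1l, wedge1r) -/CC.
have z p q (a b : L) : (5 < p + q)%N -> homog p a -> homog q b -> wedge a b = 0.
  by move=> pq ha hb; apply: homog_gt pq (homog_wedge ha hb).
rewrite (z 2%N 4%N B CC) // (z 4%N 2%N BB C) // (z 4%N 4%N BB CC) // (wedgeC2 C hB) -/BC.
by apply/rowP => i; rewrite !mxE; lra.
Qed.

Lemma exp_form0 : exp_form 0 = unit_form :> L.
Proof. by rewrite exp_formE ?wedge0l ?scaler0 ?addr0 //; apply: homog0. Qed.

Lemma exp_formK B a : homog 2%N B -> wedge (exp_form B) (wedge (exp_form (- B)) a) = a.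
Proof.
move=> hB; rewrite -wedgeA exp_formD //; last exact: homogN.
by rewrite subrr exp_form0 wedge1l.
Qed.

(** Raising the degree by two flips [sigma]. Hence the adjoint of [exp_form B] is [exp_form (- B)],
    which is its inverse. *)
Lemma mukai_wedge2 B a b : homog 2%N B -> mukai (wedge B a) b = - mukai a (wedge B b).
Proof.
move=> hB; rewrite /mukai !sigmaE (dscale_homogl _ _ hB) (wedgeC2 a hB) wedgeA -coefN -wedgeNr -wedgeNr.
congr (coef (wedge _ (wedge _ _)) _); apply/formP => I; rewrite coefN !coef_dscale.
by rewrite [(2 + _)./2]/= exprS mulN1r mulNr opprK.
Qed.

Lemma mukai_exp B a b : homog 2%N B ->
  mukai (wedge (exp_form B) a) b = mukai a (wedge (exp_form (- B)) b).
Proof.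
move=> hB; rewrite !exp_formE //; last exact: homogN.
have -> : wedge (- B) (- B) = wedge B B by rewrite wedgeNl wedgeNr opprK.
rewrite !wedgeDl !wedge1l !wedgeZl wedgeNl.
rewrite !wedgeA.
rewrite (mukaiDl (a + _)).
rewrite (mukaiDl a).
rewrite (mukaiDr a (b + _)).
rewrite (mukaiDr a b).
rewrite mukaiZl mukaiZr mukaiNr.
rewrite (mukai_wedge2 a b hB).
rewrite !(mukai_wedge2 _ _ hB).
by rewrite opprK.
Qed.

End Exponential.

(** * Words of unit vectors acting on forms *)

Section SpinGroup.
Context {R : realType}.
Local Notation E := 'rV[R]_5.
Local Notation L := (form R 5).
Implicit Types (u v w : E * E) (a b c phi psi : L) (rho : L * L) (X Y : E) (vs : seq (E * E)).

Let unit_vector v := inner v v = 1 \/ inner v v = -1.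

Let unit_sqr v : unit_vector v -> inner v v * inner v v = 1.
Proof. by case=> ->; rewrite ?mulr1 ?mulrNN ?mulr1. Qed.

Lemma cliffordNr v a : clifford v (- a) = - clifford v a.
Proof. by rewrite -scaleN1r cliffordZr scaleN1r. Qed.

(** Up to the sign [inner u u], acting by [u] changes [Q] by the isometry [r], which is minus the
    reflection in the hyperplane orthogonal to [u]. The sign enters squared. *)
Lemma quartic_clifford u rho : unit_vector u ->
  quartic (clifford u rho.1, clifford u rho.2) = quartic rho.
Proof.
move=> hu; have u2 := unit_sqr hu.
pose r v := (2 * inner v u * inner u u) *: u - v.
have riso v w : inner (r v) (r w) = inner v w.
  rewrite /r !(innerDl, innerDr, innerNl, innerNr, innerZl, innerZr) (innerC u w).
  transitivity (inner v w + 4 * inner v u * inner w u * (inner u u * inner u u - 1) * inner u u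
    + 0); last by rewrite u2; ring.
  by ring.
have rK : cancel r r.
  move=> v; rewrite {1}/r /r !(innerDl, innerNl, innerZl).
  apply: inner_eq => w; rewrite !(innerDl, innerNl, innerZl).
  transitivity (inner v w + 4 * inner v u * inner u w * (inner u u * inner u u - 1) * inner u u).
    by ring.
  by rewrite u2; ring.
have QE phi v : inner (Q (clifford u phi)) v = inner u u * inner (Q phi) (r v).
  rewrite !Q_spec cliffordC.
  have -> : (2 * inner v u) *: phi - clifford u (clifford v phi) = clifford u (clifford (r v) phi).
    rewrite /r cliffordDl cliffordNl cliffordZl cliffordDr cliffordZr clifford_sqr scalerA.
    by rewrite -mulrA u2 mulr1 cliffordNr.
  by rewrite mukai_clifford clifford_sqr mukaiZr.
rewrite /quartic (inner_isometry rK riso (QE rho.1) (QE rho.2)) expr2 u2 mul1r.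
by [].
Qed.

Lemma quartic_spin_act vs rho : spin_word vs ->
  quartic (spin_act vs rho.1, spin_act vs rho.2) = quartic rho.
Proof.
case=> _; elim: vs => [|v vs IH] h; first by case: rho.
rewrite /= (quartic_clifford (spin_act vs rho.1, spin_act vs rho.2)) /=; last first.
  by apply: h; rewrite inE eqxx.
by apply: IH => w wv; apply: h; rewrite inE wv orbT.
Qed.

Lemma spin_actDZ vs t phi psi :
  spin_act vs (t *: phi + psi) = t *: spin_act vs phi + spin_act vs psi.
Proof. by elim: vs => //= v vs ->; rewrite cliffordDr cliffordZr. Qed.

Lemma spin_actZ vs t phi : spin_act vs (t *: phi) = t *: spin_act vs phi.
Proof. by elim: vs => //= v vs ->; rewrite cliffordZr. Qed.

Lemma spin_act_cat vs ws phi : spin_act (vs ++ ws) phi = spin_act vs (spin_act ws phi).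
Proof. by rewrite /spin_act foldr_cat. Qed.

Lemma spin_act_even vs phi : spin_word vs -> even_form phi -> even_form (spin_act vs phi).
Proof.
case=> sz _ h; suff : if odd (size vs) then odd_form (spin_act vs phi) else even_form (spin_act vs phi).
  by rewrite (negPf sz).
elim: vs {sz} => //= v vs; case: (odd _) => /=; first exact: clifford_even.
exact: clifford_odd.
Qed.

Lemma spin_word_cat vs ws : spin_word vs -> spin_word ws -> spin_word (vs ++ ws).
Proof.
move=> [s1 h1] [s2 h2]; split; first by rewrite size_cat oddD (negPf s1) (negPf s2).
by move=> v; rewrite mem_cat => /orP[/h1|/h2].
Qed.

(** A vector of norm 1 or -1 is inverted by itself times its norm, so the inverse word is the
    reversed list of these. *)
Lemma spin_word_inv vs : spin_word vs -> exists2 ws, spin_word ws &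
  forall phi, spin_act ws (spin_act vs phi) = phi.
Proof.
case=> sz h; exists (rev (map (fun v => inner v v *: v) vs)).
  split=> [|w]; first by rewrite size_rev size_map.
  rewrite mem_rev => /mapP[v /h hv ->]; rewrite innerZl innerZr unit_sqr // mulr1.
  exact: hv.
move=> phi; elim: vs {sz} h => // v vs IH h.
rewrite /= rev_cons -cats1 spin_act_cat /= cliffordZl clifford_sqr scalerA.
rewrite unit_sqr ?scale1r; last by apply: h; rewrite inE eqxx.
by apply: IH => w wv; apply: h; rewrite inE wv orbT.
Qed.

(** Lets group elements be given by formulas on forms and composed without carrying words along. *)
Definition spin_map (g : L -> L) := exists2 vs, spin_word vs & spin_act vs =1 g.

Lemma spin_map_id : spin_map id.
Proof. by exists [::]. Qed.

Lemma spin_map_comp (f g : L -> L) : spin_map f -> spin_map g -> spin_map (f \o g).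
Proof.
move=> [vs hv ev] [ws hw ew]; exists (vs ++ ws); first exact: spin_word_cat.
by move=> phi; rewrite spin_act_cat ew ev.
Qed.

Lemma eq_spin_map (f g : L -> L) : f =1 g -> spin_map f -> spin_map g.
Proof. by move=> fg [vs hv ev]; exists vs => // phi; rewrite ev. Qed.

(* 1 + 2 s u v = (1 + s (u + u') v) (1 + s (u - u') v), and each factor is a
   product of two vectors of norm 1 or -1. *)
Lemma spin_map_elementary u v u' (t : R) : inner u u = 0 -> inner v v = 0 -> inner u v = 0 ->
  inner u' u' = 0 -> 2 * inner u u' = 1 -> inner u' v = 0 ->
  spin_map (fun phi => phi + t *: clifford u (clifford v phi)).
Proof.
move=> uu vv uv u'u' uu' u'v; pose s := 2^-1 * t.
have [w1 [w2 [n1 n2 w1v w2v w21]]] : exists w1 w2, [/\ inner w1 w1 = 1, inner w2 w2 = -1,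
    inner w1 v = 0, inner w2 v = 0 & w2 + w1 = 2 *: u].
  exists (u + u'), (u - u'); split.
  - by rewrite !(innerDl, innerDr) (innerC u' u) uu u'u'; lra.
  - by rewrite !(innerDl, innerDr, innerNl, innerNr) (innerC u' u) uu u'u'; lra.
  - by rewrite innerDl uv u'v addr0.
  - by rewrite innerDl innerNl uv u'v subr0.
  - by rewrite addrACA addNr addr0 scaler_nat.
have nv w (c : R) : inner w v = 0 -> inner (w + c *: v) (w + c *: v) = inner w w.
  by move=> wv; rewrite !(innerDl, innerDr, innerZl, innerZr) (innerC v w) wv vv; ring.
exists [:: w1; w1 + s *: v; - w2; w2 + (- s) *: v].
  split=> // x; rewrite !inE => /or4P[] /eqP->; first by left.
  - by left; rewrite nv.
  - by right; rewrite innerNl innerNr opprK.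
  - by right; rewrite nv.
move=> phi /=; rewrite cliffordNl [clifford (w2 + _) _]cliffordDl cliffordZl.
rewrite cliffordDr clifford_sqr n2 cliffordZr.
set psi := - _.
have -> : psi = phi + s *: clifford w2 (clifford v phi).
  by rewrite /psi scaleN1r scaleNr opprD !opprK.
rewrite cliffordDl (cliffordDr w1) clifford_sqr n1 scale1r cliffordZl cliffordZr.
(* The cross term of the two factors dies: [v] anticommutes with [w2] and has square zero. *)
have vw : clifford v (clifford w2 (clifford v phi)) = 0.
  rewrite cliffordC innerC w2v mulr0 scale0r sub0r clifford_sqr vv scale0r.
  by rewrite -[0](scale0r (0 : L)) cliffordZr !scale0r oppr0.
rewrite [clifford v (_ + _)]cliffordDr [clifford v (_ *: _)]cliffordZr vw scaler0 addr0.
rewrite -addrA -scalerDr -cliffordDl w21 cliffordZl scalerA.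
by rewrite /s mulrAC mulVf ?pnatr_eq0 ?mul1r.
Qed.

End SpinGroup.

(** * Explicit spin transformations and the orbit relation *)

Section SpinMaps.
Context {R : realType}.
Local Notation E := 'rV[R]_5.
Local Notation L := (form R 5).
Local Notation e k := (delta_mx ord0 k : E).
Implicit Types (a b c phi psi : L) (rho : L * L) (X Y y : E).

Lemma dot_deltaE (i j : 'I_5) : dot (e i) (e j) = (i == j)%:R.
Proof. by rewrite dot_delta mxE eqxx eq_sym. Qed.

Let inner_vec X Y : inner (X, 0 : E) (Y, 0 : E) = 0.
Proof. by rewrite innerE /= !dot0r addr0 mulr0. Qed.
Let inner_covec X Y : inner (0 : E, X) (0 : E, Y) = 0.
Proof. by rewrite innerE /= !dot0l addr0 mulr0. Qed.
Let inner_mixed X Y : inner (X, 0 : E) (0 : E, Y) = 2^-1 * dot X Y.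
Proof. by rewrite innerE /= dot0l addr0. Qed.
Let half2 : 2 * 2^-1 = 1 :> R. Proof. by rewrite divff ?pnatr_eq0. Qed.

(** The endomorphism of forms has square zero when [y] kills [X], so this is its exponential: a
    shear of the tangent space. For nonzero [y], a rescaled basis vector serves as the null vector
    dual to [y]. *)
Lemma spin_map_transvection X y t : dot X y = 0 ->
  spin_map (fun phi => phi + t *: wedge (covector y) (iprod X phi)).
Proof.
move=> Xy; have [->|/rV0Pn[k yk]] := eqVneq y 0.
  apply: eq_spin_map spin_map_id => phi.
  by rewrite linear0 wedge0l scaler0 addr0.
apply: (eq_spin_map (f := fun phi => phi + t *: clifford (0, y) (clifford (X, 0) phi))).
  by move=> phi; rewrite clifford_covec clifford_vec.
apply: (@spin_map_elementary _ _ _ ((y ord0 k)^-1 *: e k, 0)) => //.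
- by rewrite innerC inner_mixed Xy mulr0.
- by rewrite innerC inner_mixed dotZl dotC dot_delta mulVf // mulr1.
Qed.

Lemma spin_map_bivector X Y y t : dot X y = 1 -> dot Y y = 0 ->
  spin_map (fun phi => phi + t *: iprod X (iprod Y phi)).
Proof.
move=> Xy Yy.
apply: (eq_spin_map (f := fun phi => phi + t *: clifford (X, 0) (clifford (Y, 0) phi))).
  by move=> phi; rewrite !clifford_vec.
apply: (@spin_map_elementary _ _ _ (0, y)) => //.
- by rewrite inner_mixed Xy mulr1.
- by rewrite innerC inner_mixed Yy mulr0.
Qed.

Lemma spin_map_dx (i j : 'I_5) t : i != j ->
  spin_map (fun phi : L => phi + t *: wedge (dx i) (wedge (dx j) phi)).
Proof.
move=> ij.
apply: (eq_spin_map (f := fun phi => phi + t *: clifford (0, e i) (clifford (0, e j) phi))).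
  by move=> phi; rewrite !clifford_covec !covector_delta.
apply: (@spin_map_elementary _ _ _ (e i, 0)) => //.
- by rewrite innerC inner_mixed dot_deltaE eqxx mulr1.
- by rewrite inner_mixed dot_deltaE (negPf ij) mulr0.
Qed.

(** Scales by [p] the terms without [dx k] and by [q] those containing it. *)
Definition torus k (p q : R) phi : L :=
  p *: iprod (e k) (wedge (dx k) phi) + q *: wedge (dx k) (iprod (e k) phi).

Lemma spin_map_torus k (p q : R) : p * q = 1 \/ p * q = -1 -> spin_map (torus k p q).
Proof.
move=> pq; exists [:: (p *: e k, q *: e k); (e k, e k)].
  split=> // v; rewrite !inE => /orP[] /eqP->.
    have -> : inner (p *: e k, q *: e k) (p *: e k, q *: e k) = p * q; last by [].
    by rewrite innerE /= dotZl dotZr dot_deltaE eqxx mulr1; lra.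
  by left; rewrite innerE /= dot_deltaE eqxx mulr1n; lra.
move=> phi /=; rewrite /clifford /= !linearZ /= !covector_delta wedgeZl iprodZl !iprodDr wedgeDr.
by rewrite iprod_sqr dxx add0r addr0.
Qed.

(** By [exp_formD] the exponential is a product over basis 2-forms. Each of these has square zero,
    so its exponential is one of the maps of [spin_map_dx]. *)
Lemma spin_map_exp B : homog 2%N B -> spin_map (wedge (exp_form B : L)).
Proof.
move=> hB; suff [] : homog 2%N B /\ spin_map (wedge (exp_form B : L)) by [].
rewrite (form_basis B); elim/big_rec: _ => [|I C _ [hC sC]].
  split; first exact: homog0.
  by apply: eq_spin_map spin_map_id => phi; rewrite exp_form0 wedge1l.
have [/cards2P[i [j [ij ->]]]|I2] := boolP (#|I| == 2%N); last first.
  by rewrite hB // scale0r add0r.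
set t := coef B _.
have [s be] : exists s, basis_form [set i; j]%SET = s *: wedge (dx i) (dx j) :> L.
  exists ((-1) ^+ lesser i [set i; j]%SET * (-1) ^+ lesser j [set j]%SET).
  rewrite (@basis_formD1 _ _ i) ?finset.set21 // finset.setU1K ?inE //.
  rewrite (@basis_formD1 _ _ j [set j]%SET) ?finset.set11 // finset.setDv basis_form0 wedge1r.
  by rewrite wedgeZr scalerA.
have hD : homog 2%N (wedge (dx i) (dx j) : L) by apply: (homog_wedge (homog_dx i) (homog_dx j)).
rewrite be scalerA; set r := t * s.
split; first by apply: homogD => //; apply: homogZ.
have : spin_map ((fun phi : L => phi + r *: wedge (dx i) (wedge (dx j) phi)) \o wedge (exp_form C)).
  by apply: spin_map_comp => //; apply: spin_map_dx.
apply: eq_spin_map => phi /=; rewrite -exp_formD //; last exact: homogZ.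
rewrite wedgeA; set psi := wedge (exp_form C) phi.
rewrite exp_formE; last exact: homogZ.
have -> : wedge (r *: wedge (dx i) (dx j)) (r *: wedge (dx i) (dx j)) = 0 :> L.
  by rewrite wedgeZl wedgeZr dx_wedgeA (dxC j i) wedgeNr dxx oppr0 !scaler0.
by rewrite scaler0 addr0 wedgeDl wedge1l wedgeZl dx_wedgeA.
Qed.

(** ** The orbit relation *)

Lemma mixM (A B : 'M[R]_2) rho : mix A (mix B rho) = mix (A *m B) rho.
Proof.
rewrite /mix /= !mxE !big_ord_recl !big_ord0.
have -> : lift ord0 ord0 = 1 :> 'I_2 by apply: val_inj.
by congr pair; apply/rowP => i; rewrite !mxE; ring.
Qed.

Lemma mix1 rho : mix 1%:M rho = rho.
Proof.
case: rho => r1 r2; rewrite /mix !mxE /=.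
by congr pair; rewrite ?scale0r ?scale1r ?addr0 ?add0r.
Qed.

Definition map_pair (g : L -> L) rho := (g rho.1, g rho.2).

Lemma mix_spin A vs rho : mix A (map_pair (spin_act vs) rho) = map_pair (spin_act vs) (mix A rho).
Proof. by rewrite /mix /map_pair /= !spin_actDZ !spin_actZ. Qed.

Lemma orbit_trans rho2 rho1 rho3 : spin_gl2_orbit rho1 rho2 -> spin_gl2_orbit rho2 rho3 ->
  spin_gl2_orbit rho1 rho3.
Proof.
move=> [vs [A [hv hA e1]]] [ws [B [hw hB e2]]].
exists (ws ++ vs), (B *m A); split; first exact: spin_word_cat.
  by rewrite unitmx_mul hB.
rewrite e2 e1 !spin_act_cat -mixM; apply: (congr1 (mix B)).
exact: (esym (mix_spin A ws (_, _))).
Qed.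

Lemma orbit_sym rho1 rho2 : spin_gl2_orbit rho1 rho2 -> spin_gl2_orbit rho2 rho1.
Proof.
move=> [vs [A [hv hA ->]]]; have [ws hw wv] := spin_word_inv hv.
exists ws, (invmx A); split; rewrite ?unitmx_inv //.
etransitivity; last exact: (congr1 (mix (invmx A)) (mix_spin A ws (_, _))).
by rewrite mixM mulVmx // mix1 /map_pair /= !wv; case: rho1.
Qed.

Lemma orbit_spin (g : L -> L) rho : spin_map g -> spin_gl2_orbit rho (map_pair g rho).
Proof.
move=> [vs hv ev]; exists vs, 1%:M; split; rewrite ?unitmx1 //.
by rewrite mix1 !ev.
Qed.

Lemma orbit_mix A rho : A \in unitmx -> spin_gl2_orbit rho (mix A rho).
Proof. by move=> hA; exists [::], A; split=> //; case: rho. Qed.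

Lemma orbit_even rho rho' : spin_gl2_orbit rho rho' -> even_pairs rho -> even_pairs rho'.
Proof.
move=> [vs [A [hv hA ->]]] [h1 h2].
by split=> /=; apply: even_formD; apply: even_formZ; apply: spin_act_even.
Qed.

Lemma orbit_quartic rho rho' : spin_gl2_orbit rho rho' -> even_pairs rho ->
  (0 < quartic rho') = (0 < quartic rho).
Proof.
move=> [vs [A [hv hA ->]]] [h1 h2].
rewrite quartic_mix; last by split=> /=; apply: spin_act_even.
rewrite quartic_spin_act // pmulr_rgt0 // exprn_even_gt0 //=.
by move: hA; rewrite unitmxE unitfE.
Qed.

End SpinMaps.

(** * Reducing a standard pair by shears and a bivector *)

Section OrbitReduction.
Context {R : realType}.
Local Notation E := 'rV[R]_5.
Local Notation L := (form R 5).
Local Notation e k := (delta_mx ord0 k : E).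
Implicit Types (om : L) (rho : L * L) (X Y y : E).

(** The normal form with the density of the volume absorbed in the vectors. *)
Definition std_pair om Y1 Y2 : L * L :=
  (om + iprod Y1 top_form, unit_form + iprod Y2 top_form).

Lemma Q_std1 om Y Z : homog 2%N om -> wedge om om = iprod Z top_form ->
  Q (om + iprod Y top_form) = (- (2 *: Z), - (4 *: row_of_form (iprod Y om))).
Proof.
move=> h hZ; have := Q_explicit 0 Y h hZ.
by rewrite scale0r add0r mulr0 scale0r sub0r.
Qed.

Lemma Q_std2 Y : Q (unit_form + iprod Y top_form : L) = (4 *: Y, 0).
Proof.
have := @Q_explicit R 1 0 Y 0 (@homog0 _ _ _) _; rewrite wedge0l iprod0l scale1r addr0 => ->//.
congr pair; first by rewrite mulr1 scaler0 subr0.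
by apply/rowP => i; rewrite iprod0r !mxE coef0 mulr0 oppr0.
Qed.

Lemma quartic_std om Y1 Y2 : homog 2%N om ->
  quartic (std_pair om Y1 Y2) = - 8 * coef (iprod Y2 (iprod Y1 om)) finset.set0.
Proof.
move=> h; have [Z hZ] := square_vector h.
rewrite /quartic /= (Q_std1 _ h hZ) Q_std2 innerE /= dot0r add0r dotNr dotZr dotZl.
by rewrite dot_row_iprod //; set d := coef _ _; lra.
Qed.

Lemma even_std om Y1 Y2 : homog 2%N om -> even_pairs (std_pair om Y1 Y2).
Proof.
move=> h; have h4 Y : even_form (iprod Y top_form : L).
  by apply: (homog_even (p := 4)) => //; apply/homog_iprod/homog_top.
split; apply: even_formD => //; first exact: (homog_even (p := 2)).
exact: (homog_even (p := 0)) (@homog_unit _ _).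
Qed.

Lemma orbit_transvection om Y1 Y2 X y : dot X y = 0 ->
  spin_gl2_orbit (std_pair om Y1 Y2)
    (std_pair (om + wedge (covector y) (iprod X om))
       (Y1 - dot Y1 y *: X) (Y2 - dot Y2 y *: X)).
Proof.
move=> Xy; have := orbit_spin (std_pair om Y1 Y2) (spin_map_transvection 1 Xy).
congr (spin_gl2_orbit _ _).
have top Y : wedge (covector y) (iprod X (iprod Y top_form)) = - (dot Y y *: iprod X top_form).
  rewrite iprodC wedgeNr; congr (- _); apply/eqP; rewrite eq_sym -subr_eq0.
  by rewrite -iprod_covector covector_iprod_top Xy scale0r iprod0r.
rewrite /map_pair /std_pair /= !iprodDr iprod1 add0r !wedgeDr !top !iprodDl !iprodNl !iprodZl.
rewrite !scale1r; congr pair; last by rewrite addrA.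
by rewrite addrACA.
Qed.

Lemma homog_transvection om X y : homog 2%N om ->
  homog 2%N (om + wedge (covector y) (iprod X om)).
Proof.
move=> h; apply: homogD => //; apply: (homog_wedge (homog_covector y)).
exact: (homog_iprod (p := 1)).
Qed.

(** If [Y2] has a component off [e 0], some covector takes the value 1 on both [Y2] and [e 0], and
    shearing along their difference maps one to the other. Otherwise [Y2] is already a multiple of
    [e 0]; hence the scalar [t]. *)
Lemma orbit_std_Y2 om Y1 Y2 : homog 2%N om -> exists om' Y1' t,
  homog 2%N om' /\ spin_gl2_orbit (std_pair om Y1 Y2) (std_pair om' Y1' (t *: e 0)).
Proof.
move=> h; have [/existsP[k /andP[k0 yk]]|nex] := boolP [exists k, (k != 0) && (Y2 ord0 k != 0)]; last first.
  exists om, Y1, (Y2 ord0 0); split => //.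
  have -> : Y2 ord0 0 *: e 0 = Y2.
    apply/rowP => i; rewrite !mxE eqxx /=; case: eqP => [->|/eqP i0]; first by rewrite mulr1.
    move: nex; rewrite negb_exists => /forallP/(_ i); rewrite i0 /= negbK => /eqP->.
    by rewrite mulr0.
  by rewrite -[X in spin_gl2_orbit _ X]mix1; apply: orbit_mix; rewrite unitmx1.
pose y := e 0 + ((1 - Y2 ord0 0) / Y2 ord0 k) *: e k; pose X := Y2 - e 0.
have Yy : dot Y2 y = 1 by rewrite /y dotDr dotZr !dot_delta divfK //; ring.
have ey : dot (e 0) y = 1.
  by rewrite /y dotDr dotZr !dot_deltaE eqxx eq_sym (negPf k0) mulr0 addr0.
have Xy : dot X y = 0 by rewrite /X dotDl dotNl Yy ey subrr.
exists (om + wedge (covector y) (iprod X om)), (Y1 - dot Y1 y *: X), 1.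
split; first exact: homog_transvection.
have := orbit_transvection om Y1 Y2 Xy; congr (spin_gl2_orbit _ (std_pair _ _ _)).
by rewrite Yy !scale1r /X opprB addrCA subrr addr0.
Qed.

(** The same shear with a covector that also kills [e 0], so that the second vector stays put. If
    [Y1] lies in the span of [e 0] and [e 1], the nonvanishing pairing forces a component along
    [e 1], and shearing along [e 0] removes the rest. *)
Lemma orbit_std_Y1 om Y1 t : homog 2%N om ->
  coef (iprod (t *: e 0) (iprod Y1 om)) finset.set0 != 0 -> exists om' s,
  homog 2%N om' /\ spin_gl2_orbit (std_pair om Y1 (t *: e 0)) (std_pair om' (s *: e 1) (t *: e 0)).
Proof.
move=> h nz.
have [/existsP[k /and3P[k0 k1 yk]]|nex] :=
    boolP [exists k : 'I_5, [&& k != 0, k != 1 & Y1 ord0 k != 0]].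
  pose y := e 1 + ((1 - Y1 ord0 1) / Y1 ord0 k) *: e k; pose X := Y1 - e 1.
  have Yy : dot Y1 y = 1 by rewrite /y dotDr dotZr !dot_delta divfK //; ring.
  have ey : dot (e 1) y = 1.
    by rewrite /y dotDr dotZr !dot_deltaE eqxx eq_sym (negPf k1) mulr0 addr0.
  have e0y : dot (t *: e 0) y = 0.
    by rewrite dotZl /y dotDr dotZr !dot_deltaE (eq_sym _ k) (negPf k0) !mulr0 addr0 mulr0.
  have Xy : dot X y = 0 by rewrite /X dotDl dotNl Yy ey subrr.
  exists (om + wedge (covector y) (iprod X om)), 1; split; first exact: homog_transvection.
  have := orbit_transvection om Y1 (t *: e 0) Xy.
  by rewrite Yy e0y scale0r subr0 !scale1r /X opprB addrCA subrr addr0.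
have Y1E : Y1 = Y1 ord0 0 *: e 0 + Y1 ord0 1 *: e 1.
  apply/rowP => i; rewrite !mxE eqxx /=.
  have [->|i0] := eqVneq i 0; first by rewrite mulr1 mulr0 addr0.
  have [->|i1] := eqVneq i 1; first by rewrite mulr0 mulr1 add0r.
  move: nex; rewrite negb_exists => /forallP/(_ i); rewrite i0 i1 /= negbK => /eqP->.
  by rewrite !mulr0 addr0.
have y1 : Y1 ord0 1 != 0.
  apply: contraNneq nz => y1; rewrite Y1E y1 scale0r addr0 !iprodZl.
  by rewrite !iprodZr iprod_sqr !scaler0 coef0.
pose y := (Y1 ord0 1)^-1 *: e 1; pose X := Y1 ord0 0 *: e 0.
have Xy : dot X y = 0 by rewrite dotZr dotZl dot_deltaE !mulr0.
have Yy : dot Y1 y = 1 by rewrite dotZr dot_delta mulVf.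
have ey : dot (t *: e 0) y = 0 by rewrite dotZr dotZl dot_deltaE !mulr0.
exists (om + wedge (covector y) (iprod X om)), (Y1 ord0 1); split; first exact: homog_transvection.
have := orbit_transvection om Y1 (t *: e 0) Xy.
have -> : Y1 - dot Y1 y *: X = Y1 ord0 1 *: e 1 by rewrite Yy scale1r {1}Y1E /X addrAC subrr add0r.
by rewrite ey scale0r subr0.
Qed.

(** Shears fixing [e 0] and [e 1] clear the mixed terms of the 2-form. What is left besides [dx 0]
    and [dx 1] lives on three coordinates and is absorbed by a bivector acting on the 4-form of the
    first component. *)
Lemma orbit_std_om om s t : homog 2%N om -> s != 0 ->
  coef (iprod (e 1) (iprod (e 0) om)) finset.set0 != 0 -> exists w,
  spin_gl2_orbit (std_pair om (s *: e 1) (t *: e 0))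
    (std_pair (w *: wedge (dx 0) (dx 1)) (s *: e 1) (t *: e 0)).
Proof.
move=> h s0; set w := coef _ _ => w0.
have i10 : iprod (e 1) (iprod (e 0) om) = w *: unit_form.
  by apply: homog0E; apply: homog_iprod; apply: homog_iprod.
have i01 : iprod (e 0) (iprod (e 1) om) = - (w *: unit_form) by rewrite iprodC i10.
have h1 X : homog 1%N (iprod X om) by apply: homog_iprod.
(* This covector kills [e 0] and [e 1], so the shear fixes both vectors. Its first term cancels the
   contraction by [e 1] and its second leaves a multiple of [dx 0]; [z] below plays the same part
   for [e 0]. *)
pose y := w^-1 *: row_of_form (iprod (e 1) om) + e 0.
have cy : covector y = w^-1 *: iprod (e 1) om + dx 0.
  by rewrite /y linearD linearZ /= covector_row_of_form // covector_delta.
have dy0 : dot (e 0) y = 0.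
  rewrite /y dotDr dotZr dot_row_iprod // i01 coefN coefZ coef_unit eqxx mulr1 dot_deltaE.
  by rewrite mulrN mulVf // eqxx addNr.
have dy1 : dot (e 1) y = 0.
  by rewrite /y dotDr dotZr dot_row_iprod // iprod_sqr coef0 mulr0 dot_deltaE add0r.
pose om1 := om + wedge (covector y) (iprod (e 0) om).
have o1 : spin_gl2_orbit (std_pair om (s *: e 1) (t *: e 0)) (std_pair om1 (s *: e 1) (t *: e 0)).
  have := orbit_transvection om (s *: e 1) (t *: e 0) dy0.
  by rewrite !dotZl dy0 dy1 !mulr0 !scale0r !subr0.
have i1om1 : iprod (e 1) om1 = - (w *: dx 0).
  rewrite /om1 iprodDr iprod_covector dy1 scale0r sub0r i10 wedgeZr wedge1r cy.
  by rewrite scalerDr scalerA divff // scale1r opprD addrA subrr add0r.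
have i0om1 : iprod (e 0) om1 = iprod (e 0) om.
  by rewrite /om1 iprodDr iprod_covector dy0 scale0r sub0r iprod_sqr wedge0r oppr0 addr0.
pose z := - (w^-1 *: row_of_form (iprod (e 0) om)) + e 1.
have cz : covector z = - (w^-1 *: iprod (e 0) om) + dx 1.
  by rewrite /z linearD linearN linearZ /= covector_row_of_form // covector_delta.
have dz0 : dot (e 0) z = 0.
  by rewrite /z dotDr dotNr dotZr dot_row_iprod // iprod_sqr coef0 mulr0 dot_deltaE oppr0 add0r.
have dz1 : dot (e 1) z = 0.
  rewrite /z dotDr dotNr dotZr dot_row_iprod // i10 coefZ coef_unit eqxx mulr1 dot_deltaE.
  by rewrite mulVf // eqxx addNr.
pose om2 := om1 + wedge (covector z) (iprod (e 1) om1).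
have o2 : spin_gl2_orbit (std_pair om1 (s *: e 1) (t *: e 0)) (std_pair om2 (s *: e 1) (t *: e 0)).
  have := orbit_transvection om1 (s *: e 1) (t *: e 0) dz1.
  by rewrite !dotZl dz0 dz1 !mulr0 !scale0r !subr0.
have i1om2 : iprod (e 1) om2 = - (w *: dx 0).
  by rewrite /om2 iprodDr iprod_covector dz1 scale0r sub0r iprod_sqr wedge0r oppr0 addr0.
have i0dx0 : iprod (e 0) (dx 0) = unit_form :> L.
  by rewrite -[dx 0]wedge1r iprod_dx mxE !eqxx scale1r iprod1 wedge0r subr0.
have i0dx1 : iprod (e 0) (dx 1) = 0 :> L.
  by rewrite -[dx 1]wedge1r iprod_dx mxE /= scale0r iprod1 wedge0r subr0.
have i1dx1 : iprod (e 1) (dx 1) = unit_form :> L.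
  by rewrite -[dx 1]wedge1r iprod_dx mxE !eqxx scale1r iprod1 wedge0r subr0.
have i0om2 : iprod (e 0) om2 = w *: dx 1.
  rewrite /om2 iprodDr iprod_covector dz0 scale0r sub0r i1om1 iprodNr iprodZr i0dx0 wedgeNr opprK.
  rewrite wedgeZr wedge1r cz i0om1 scalerDr scalerN scalerA divff // scale1r addrA subrr.
  by rewrite add0r.
have h2 : homog 2%N om2 by apply/homog_transvection/homog_transvection.
clearbody om2.
pose eta := om2 - w *: wedge (dx 0) (dx 1).
have d2 : homog 2%N (wedge (dx 0) (dx 1) : L) := homog_wedge (homog_dx _) (homog_dx _).
have heta : homog 2%N eta by apply: homogD => //; apply/homogN/homogZ.
have i0eta : iprod (e 0) eta = 0.
  rewrite /eta iprodDr iprodNr iprodZr iprod_dx i0dx1 wedge0r subr0 mxE !eqxx scale1r i0om2.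
  by rewrite subrr.
have i1eta : iprod (e 1) eta = 0.
  rewrite /eta iprodDr iprodNr iprodZr iprod_dx i1dx1 wedge1r mxE /= scale0r sub0r i1om2.
  by rewrite scalerN opprK addNr.
have h4 : homog 4%N (wedge (dx 0) (wedge (dx 1) eta)).
  by apply: (homog_wedge (homog_dx _)); apply: (homog_wedge (homog_dx _) heta).
set th := wedge (dx 0) _ in h4.
(* As [e 0] and [e 1] contract [eta] to zero, [eta] is recovered from [th], a 4-form, which is a
   vector contracted into the volume. *)
pose W := \row_k coef (wedge (dx k) th) [set: 'I_5]%SET.
have thE : th = iprod W top_form by apply: (iprod_topE (p := 4)).
have W0 : dot W (e 0) = 0 by rewrite dot_delta mxE /th dxx coef0.
have W1 : dot W (e 1) = 0 by rewrite dot_delta mxE /th (dxC 0 1) wedgeNr dxx oppr0 coef0.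
have etaE : eta = iprod (e 1) (iprod (e 0) th).
  rewrite /th iprod_dx mxE !eqxx scale1r (iprod_dx (e 0) 1) mxE /= scale0r i0eta.
  by rewrite wedge0r subrr wedge0r subr0 iprod_dx mxE !eqxx scale1r i1eta wedge0r subr0.
exists w; apply: (orbit_trans o1); apply: (orbit_trans o2).
have b0 : dot (e 0) (e 0) = 1 by rewrite dot_deltaE eqxx.
have bW : dot W (e 0) = 0 by [].
(* This bivector sends the 4-form of the first component to [s] times [eta], so the coefficient
   removes [eta]. The second component is fixed since [e 0] is contracted twice. *)
have := orbit_spin (std_pair om2 (s *: e 1) (t *: e 0)) (spin_map_bivector (- s^-1) b0 bW).
congr (spin_gl2_orbit _ _); rewrite /map_pair /std_pair /=.
have om2E : om2 = w *: wedge (dx 0) (dx 1) + eta by rewrite /eta addrC subrK.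
congr pair.
  rewrite !iprodDr !iprodZl !iprodZr.
  have -> : iprod W om2 = iprod W eta.
    rewrite om2E iprodDr iprodZr iprod_dx -[dx 1]wedge1r iprod_dx iprod1 wedge0r subr0.
    rewrite -!(dot_delta W) W0 W1 !scale0r wedge0r subr0 scaler0 add0r.
    by [].
  rewrite iprodC i0eta iprod0r oppr0 add0r.
  have -> : iprod (e 0) (iprod W (iprod (e 1) top_form)) = eta.
    by rewrite etaE thE (iprodC W) iprodNr (iprodC (e 0) (e 1)) opprK.
  by rewrite scalerA mulNr mulVf // scaleN1r om2E addrAC addrK.
have -> : iprod (e 0) (iprod W (unit_form + iprod (t *: e 0) top_form)) = 0.
  by rewrite iprodDr iprod1 add0r iprodZl !iprodZr (iprodC W) iprodNr iprod_sqr oppr0 scaler0.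
by rewrite scaler0 addr0.
Qed.

End OrbitReduction.

(** * The canonical pair and scaling of monomial pairs *)

Section OpenOrbit.
Context {R : realType}.
Local Notation E := 'rV[R]_5.
Local Notation L := (form R 5).
Local Notation e k := (delta_mx ord0 k : E).
Implicit Types (om phi psi B : L) (rho : L * L) (X Y y : E).

Definition mx2 (a b c d : R) : 'M[R]_2 :=
  \matrix_(i, j) (if i == 0 then if j == 0 then a else b else if j == 0 then c else d).

Lemma det_mx2 a b c d : \det (mx2 a b c d) = a * d - b * c.
Proof. by rewrite det2 !mxE. Qed.

Lemma mix_mx2 a b c d rho :
  mix (mx2 a b c d) rho = (a *: rho.1 + b *: rho.2, c *: rho.1 + d *: rho.2).
Proof. by rewrite /mix !mxE. Qed.

Lemma torus_p k p q phi : iprod (e k) phi = 0 -> torus k p q phi = p *: phi.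
Proof.
move=> h; rewrite /torus h wedge0r scaler0 addr0 iprod_dx h wedge0r subr0 mxE !eqxx.
by rewrite scale1r.
Qed.

Lemma torus_q k p q phi : wedge (dx k) phi = 0 -> torus k p q phi = q *: phi.
Proof.
move=> h; have := iprod_dx (e k) k phi; rewrite h iprod0r mxE !eqxx scale1r => /esym/eqP.
by rewrite subr_eq0 => /eqP hh; rewrite /torus h iprod0r scaler0 add0r -hh.
Qed.

Lemma torusD k p q phi psi : torus k p q (phi + psi) = torus k p q phi + torus k p q psi.
Proof. by rewrite /torus !(wedgeDr, iprodDr) !scalerDr addrACA. Qed.

Lemma torusZ k p q t phi : torus k p q (t *: phi) = t *: torus k p q phi.
Proof.
by rewrite /torus !(wedgeZr, iprodZr) scalerDr !scalerA !(mulrC t).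
Qed.

Definition canonical_pair : L * L := std_pair (wedge (dx 0) (dx 1)) (e 1) (e 0).

Lemma quartic_monomial (w s t : R) :
  quartic (std_pair (w *: wedge (dx 0) (dx 1)) (s *: e 1) (t *: e 0)) = 8 * (w * s * t).
Proof.
rewrite quartic_std; last first.
  exact/homogZ/(homog_wedge (homog_dx _) (homog_dx _)).
rewrite !iprodZl !iprodZr iprod_dx -[dx 1]wedge1r !iprod_dx iprod1 wedge0r subr0 !mxE /=.
rewrite !scale0r !scale1r sub0r wedge1r !iprodNr -[dx 0]wedge1r iprod_dx iprod1 wedge0r subr0.
rewrite !mxE /= !scale1r !coefZ coefN coef_unit eqxx mulr1n.
by ring.
Qed.

(** Torus elements and diagonal matrices act on such pairs by rescaling the four coefficients. *)
Definition mono (x1 x2 y1 y2 : R) : L * L :=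
  (x1 *: wedge (dx 0) (dx 1) + x2 *: iprod (e 1) top_form,
   y1 *: unit_form + y2 *: iprod (e 0) top_form).

Lemma std_mono w s t :
  std_pair (w *: wedge (dx 0) (dx 1)) (s *: e 1) (t *: e 0) = mono w s 1 t.
Proof. by rewrite /std_pair /mono !iprodZl scale1r. Qed.

Lemma torus_comb k p q t u phi psi p' q' :
  torus k p q phi = p' *: phi -> torus k p q psi = q' *: psi ->
  torus k p q (t *: phi + u *: psi) = (p' * t) *: phi + (q' * u) *: psi.
Proof.
by move=> h1 h2; rewrite torusD !(torusZ k p q) h1 h2 !scalerA (mulrC t) (mulrC u).
Qed.

Let dtop (i j : 'I_5) : i != j -> wedge (dx i) (iprod (e j) top_form) = 0 :> L.
Proof.
by move=> ij; rewrite -covector_delta covector_iprod_top dot_deltaE eq_sym (negPf ij) scale0r.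
Qed.

Lemma torus1_mono (p q x1 x2 y1 y2 : R) :
  map_pair (torus 1 p q) (mono x1 x2 y1 y2) = mono (q * x1) (p * x2) (p * y1) (q * y2).
Proof.
rewrite /map_pair /mono /=; congr pair; apply: torus_comb.
- apply: torus_q; have := dxx 1 (unit_form : L); rewrite wedge1r dxC => ->.
  by rewrite wedge0r oppr0.
- exact/torus_p/iprod_sqr.
- exact/torus_p/iprod1.
- exact/torus_q/dtop.
Qed.

Lemma torus2_mono (p q x1 x2 y1 y2 : R) :
  map_pair (torus 2 p q) (mono x1 x2 y1 y2) = mono (p * x1) (q * x2) (p * y1) (q * y2).
Proof.
rewrite /map_pair /mono /=; congr pair; apply: torus_comb.
- apply: torus_p; rewrite iprod_dx -[dx 1]wedge1r iprod_dx iprod1 wedge0r subr0 !mxE /=.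
  by rewrite !scale0r wedge0r subr0.
- exact/torus_q/dtop.
- exact/torus_p/iprod1.
- exact/torus_q/dtop.
Qed.

Lemma mix_mono (p q x1 x2 y1 y2 : R) :
  mix (mx2 p 0 0 q) (mono x1 x2 y1 y2) = mono (p * x1) (p * x2) (q * y1) (q * y2).
Proof. by rewrite mix_mx2 /mono /= !scale0r addr0 add0r !scalerDr !scalerA. Qed.

Lemma orbit_monomial (w s t : R) : 0 < w * s * t ->
  spin_gl2_orbit (std_pair (w *: wedge (dx 0) (dx 1)) (s *: e 1) (t *: e 0)) canonical_pair.
Proof.
move=> wst; have [wsn0 t0] : w * s != 0 /\ t != 0.
  by apply/andP; rewrite -negb_or -mulf_eq0 gt_eqF.
have [w0 s0] : w != 0 /\ s != 0 by apply/andP; rewrite -negb_or -mulf_eq0.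
(* The four coefficients must become 1. Those of the second form require the square of [a] to be the
   absolute value of [t], with the sign of [t] put into the torus. Those of the first fix [m1] and
   require the fourth power of [c] to be s t / w, which is positive because w s t is. *)
pose a := Num.sqrt `|t|; have a0 : a != 0 by rewrite gt_eqF // sqrtr_gt0 normr_gt0.
have a2 : a * a = `|t| by rewrite -expr2 sqr_sqrtr.
pose sg := Num.sg t; have sgt : sg * a * a = t by rewrite -mulrA a2 [RHS]numEsg.
have sg2 : sg * sg = 1 by rewrite -expr2 sqr_sg t0.
have sg1 : sg = 1 \/ sg = -1.
  have : (sg == 1) || (sg == -1) by rewrite -eqf_sqr expr1n expr2 sg2.
  by case/orP => /eqP; [left|right].
have stw : 0 < s * t / w.
  have -> : s * t / w = (w * s * t) * (w^-1 * w^-1) by field.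
  by rewrite pmulr_rgt0 // -expr2 exprn_even_gt0 // invr_eq0.
pose d := Num.sqrt (s * t / w); have d0 : 0 < d by rewrite sqrtr_gt0.
pose c := Num.sqrt d; have c0 : c != 0 by rewrite gt_eqF // sqrtr_gt0.
have c2 : c * c = d by rewrite -expr2 sqr_sqrtr // ltW.
have c4 : c * c * (c * c) = s * t / w by rewrite c2 -expr2 sqr_sqrtr // ltW.
have ht1 : (a / c) * (sg * c / a) = 1 \/ (a / c) * (sg * c / a) = -1.
  by have -> : (a / c) * (sg * c / a) = sg by field; rewrite a0 c0.
have ht2 : c * c^-1 = 1 \/ c * c^-1 = -1 by left; rewrite divff.
rewrite std_mono; apply: (orbit_trans (orbit_spin _ (spin_map_torus 1 ht1))).
apply: (orbit_trans (orbit_spin _ (spin_map_torus 2 ht2))).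
pose m1 := c * c / (a * s).
have m10 : m1 != 0 by rewrite /m1 !(mulf_neq0, invr_neq0).
have hm : mx2 m1 0 0 a^-1 \in unitmx.
  by rewrite unitmxE unitfE det_mx2 mulr0 subr0 mulf_neq0 // invr_neq0.
have := orbit_mix (map_pair (torus 2 c c^-1) (map_pair (torus 1 (a / c) (sg * c / a))
  (mono w s 1 t))) hm.
congr (spin_gl2_orbit _ _).
rewrite torus1_mono torus2_mono mix_mono -[canonical_pair]/(std_pair _ _ _).
rewrite -[in RHS](scale1r (e 1)) -[in RHS](scale1r (e 0)) -[wedge (dx 0) (dx 1) in RHS]scale1r std_mono.
have k1 : m1 * (c * (sg * c / a * w)) = 1.
  transitivity (c * c * (c * c) * w * (sg * a * a) / (a * a * a * a * s)).
    by rewrite /m1; field; rewrite a0 s0.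
  rewrite c4 sgt; transitivity (t * t / (`|t| * `|t|)).
    by rewrite -a2; field; rewrite a0 s0 w0.
  by rewrite -normrM ger0_norm ?divff ?mulf_neq0 // -expr2 sqr_ge0.
have k2 : m1 * (c^-1 * (a / c * s)) = 1 by rewrite /m1; field; rewrite a0 s0 c0.
have k3 : a^-1 * (c * (a / c * 1)) = 1 by field; rewrite a0 c0.
have k4 : a^-1 * (c^-1 * (sg * c / a * t)) = 1.
  by rewrite -sgt; transitivity (sg * sg); [field; rewrite a0 c0|].
by rewrite k1 k2 k3 k4.
Qed.

End OpenOrbit.

(** * Normalisation by a matrix and a 2-form; openness of the orbit *)

Section NormalForm.
Context {R : realType}.
Local Notation E := 'rV[R]_5.
Local Notation L := (form R 5).
Implicit Types (om phi psi B : L) (rho : L * L) (X Y y : E).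

Definition part p phi : L := dscale (fun q => (q == p)%:R) phi.

Lemma part0 phi : part 0 phi = coef phi finset.set0 *: unit_form.
Proof.
rewrite [LHS]homog0E; last exact: homog_part.
by rewrite coef_dscale finset.cards0 mul1r.
Qed.

Lemma part_homog p q phi : homog p phi -> part q phi = (p == q)%:R *: phi.
Proof. by move=> h; rewrite /part (homog_dscale _ h). Qed.

Lemma part_wedge p q B phi : homog p B -> part (p + q) (wedge B phi) = wedge B (part q phi).
Proof.
move=> h; rewrite /part (dscale_homogl _ _ h); congr wedge.
by apply: eq_dscale => r; rewrite eqn_add2l.
Qed.

Lemma part_wedge_lt p q B phi : homog p B -> (q < p)%N -> part q (wedge B phi) = 0.
Proof.
move=> h qp; rewrite /part (dscale_homogl _ _ h).
have -> : dscale (fun r => (p + r == q)%N%:R) phi = 0.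
  apply/formP => I; rewrite coef_dscale coef0.
  by rewrite gtn_eqF ?ltn_addr // mul0r.
by rewrite wedge0r.
Qed.

Lemma partD p phi psi : part p (phi + psi) = part p phi + part p psi.
Proof. exact: linearD. Qed.

Lemma partZ p t phi : part p (t *: phi) = t *: part p phi.
Proof. exact: linearZ. Qed.

Lemma exp_part B phi : homog 2%N B ->
  coef (wedge (exp_form B) phi) finset.set0 = coef phi finset.set0 /\
  part 2 (wedge (exp_form B) phi) = part 2 phi + coef phi finset.set0 *: B.
Proof.
move=> hB; have hBB : homog 4%N (wedge B B) := homog_wedge hB hB.
rewrite exp_formE // !wedgeDl wedge1l wedgeZl; split.
  suff h (C : L) p : homog p.+1 C -> coef (wedge C phi) finset.set0 = 0.
    by rewrite !coefD coefZ (h B 1%N) // (h (wedge B B) 3%N) // mulr0 !addr0.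
  move=> hC; have := part_wedge_lt phi hC (ltn0Sn p); rewrite part0.
  by move/(congr1 (fun c => coef c finset.set0)); rewrite coefZ coef_unit eqxx mulr1 coef0.
rewrite !partD partZ (part_wedge_lt phi hBB) // scaler0 addr0.
rewrite (part_wedge 0 phi hB : part 2 _ = _) part0 wedgeZr wedge1r.
by [].
Qed.

Lemma exp_even B phi : homog 2%N B -> even_form phi -> even_form (wedge (exp_form B) phi).
Proof.
move=> hB h; have [vs hvs e] := spin_map_exp hB.
by rewrite -e; apply: spin_act_even.
Qed.

Lemma exp_odd B phi : homog 2%N B -> odd_form phi -> odd_form (wedge (exp_form B) phi).
Proof.
move=> hB h; rewrite exp_formE // !wedgeDl wedge1l wedgeZl.
have h2 (C : L) : homog 2%N C -> forall psi, odd_form psi -> odd_form (wedge C psi).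
  move=> hC psi hpsi I oI; rewrite coef_wedge big1 // => J JI.
  have [J2|J2] := eqVneq #|J| 2%N; last by rewrite hC // mulr0 mul0r.
  rewrite hpsi ?mulr0 //; have := cardsID J I; rewrite (finset.setIidPr JI) J2 => I2.
  by move: oI; rewrite -I2 oddD.
by move=> I oI; rewrite !coefD coefZ wedgeA h // !h2 // ?mulr0 ?addr0 //; apply: h2.
Qed.

(** By [exp_part] the exponential adds to each degree 2 part its degree zero coefficient times the
    2-form: coefficient 1 in the second component, which is cleared, and 0 in the first, which is
    untouched. *)
Lemma normal_form rho : even_pairs rho -> coef rho.1 finset.set0 = 0 ->
  coef rho.2 finset.set0 = 1 ->
  let g := wedge (exp_form (- part 2 rho.2)) in
  map_pair g rho = std_pair (part 2 rho.1) (vector_part (g rho.1)) (vector_part (g rho.2)).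
Proof.
case: rho => r1 r2 [/= e1 e2] c1 c2; set B := - part 2 r2.
have hB : homog 2%N B by apply/homogN/homog_part.
have [p1 q1] := exp_part r1 hB; have [p2 q2] := exp_part r2 hB.
rewrite /map_pair /std_pair /=; congr pair.
  rewrite {1}(even_form_split (exp_even hB e1)) p1 c1 scale0r add0r.
  by rewrite -/(part 2 _) q1 c1 scale0r addr0.
rewrite {1}(even_form_split (exp_even hB e2)) p2 c2 scale1r -/(part 2 _) q2 c2 scale1r.
by rewrite /B subrr addr0.
Qed.

Lemma normalizing_matrix (c1 c2 : R) : (c1 != 0) || (c2 != 0) -> exists A : 'M[R]_2,
  [/\ \det A = 1, A 0 0 * c1 + A 0 1 * c2 = 0 & A 1 0 * c1 + A 1 1 * c2 = 1].
Proof.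
have [-> /=|c20 _] := eqVneq c2 0.
  rewrite orbF => c10; exists (mx2 0 (- c1) c1^-1 0); split; rewrite ?det_mx2 ?mxE /=.
  - by rewrite mulr0 mulNr sub0r opprK divff.
  - by rewrite mul0r mulr0 addr0.
  - by rewrite mulVf // mulr0 addr0.
exists (mx2 c2 (- c1) 0 c2^-1); split; rewrite ?det_mx2 ?mxE /=.
- by rewrite mulr0 subr0 divff.
- by rewrite mulNr mulrC subrr.
- by rewrite mulVf // mul0r add0r.
Qed.

Lemma coef_mix A rho I :
  (coef (mix A rho).1 I = A 0 0 * coef rho.1 I + A 0 1 * coef rho.2 I) *
  (coef (mix A rho).2 I = A 1 0 * coef rho.1 I + A 1 1 * coef rho.2 I).
Proof. by rewrite /mix /= !coefD !coefZ. Qed.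

Lemma mix_even A rho : even_pairs rho -> even_pairs (mix A rho).
Proof. by case=> h1 h2; split; apply: even_formD; apply: even_formZ. Qed.

(** Positivity of the quartic is carried through each reduction. On standard pairs it says that the
    2-form pairs the two vectors nontrivially, which is what the next reduction requires. *)
Lemma orbit_canonical rho : even_pairs rho -> 0 < quartic rho ->
  coef rho.2 finset.set0 != 0 -> spin_gl2_orbit rho canonical_pair.
Proof.
move=> er qr c2.
have [|A [dA a1 a2]] := @normalizing_matrix (coef rho.1 finset.set0) (coef rho.2 finset.set0).
  by rewrite c2 orbT.
have uA : A \in unitmx by rewrite unitmxE dA unitr1.
have o1 := orbit_mix rho uA; have e1 := mix_even A er.
have q1 : 0 < quartic (mix A rho) by rewrite (orbit_quartic o1 er).
apply: (orbit_trans o1); move: (mix A rho) e1 q1 (coef_mix A rho finset.set0) {o1}.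
rewrite a1 a2 => {er qr c2 a1 a2 uA dA A} {}rho er qr [c1 c2].
have hB : homog 2%N (- part 2 rho.2) by apply/homogN/homog_part.
have o2 := orbit_spin rho (spin_map_exp hB).
have q2 := qr; rewrite -(orbit_quartic o2 er) in q2.
apply: (orbit_trans o2); move: q2 {o2}; rewrite (normal_form er c1 c2).
have : homog 2%N (part 2 rho.1) by apply: homog_part.
move: (part 2 rho.1) (vector_part _) (vector_part _) => om Y2 Y1 h q {er qr c1 c2 hB rho}.
have ev := @even_std R.
have [om1 [Y1' [t [h1 o1]]]] := orbit_std_Y2 Y1 Y2 h.
rewrite -(orbit_quartic o1 (ev _ _ _ h)) in q.
apply: (orbit_trans o1) => {o1 h om Y1 Y2}.
have nz : coef (iprod (t *: delta_mx ord0 0) (iprod Y1' om1)) finset.set0 != 0.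
  by apply: contraTneq q => c0; rewrite quartic_std // c0 mulr0 ltxx.
have [om2 [s [h2 o2]]] := orbit_std_Y1 h1 nz.
rewrite -(orbit_quartic o2 (ev _ _ _ h1)) in q.
apply: (orbit_trans o2) => {o2 h1 nz om1 Y1'}.
have [s0 w0] : s != 0 /\ coef (iprod (delta_mx ord0 1) (iprod (delta_mx ord0 0) om2)) finset.set0 != 0.
  move: q; rewrite quartic_std // !iprodZl !iprodZr !coefZ iprodC coefN => q.
  by split; apply: contraTneq q => ->; rewrite ?oppr0 !(mul0r, mulr0) ltxx.
have [w o3] := orbit_std_om t h2 s0 w0.
rewrite -(orbit_quartic o3 (ev _ _ _ h2)) quartic_monomial in q.
apply: (orbit_trans o3); apply: orbit_monomial.
by move: q; rewrite pmulr_rgt0.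
Qed.

(** ** Openness *)

Section Continuity.
Context {V : topologicalType}.

(** Coordinatewise continuity reduces linear and bilinear maps to finite sums of products. *)
Definition coord_continuous_fun {m} (h : V -> 'rV[R]_m) :=
  forall j, continuous (fun x => h x ord0 j).

Lemma continuous_bilinear p q r (b : 'rV[R]_p -> 'rV[R]_q -> 'rV[R]_r)
    (F : V -> 'rV[R]_p) (G : V -> 'rV[R]_q) :
  (forall t u v z, b (t *: u + v) z = t *: b u z + b v z) -> (forall z, linear (b z)) ->
  coord_continuous_fun F -> coord_continuous_fun G ->
  coord_continuous_fun (fun x => b (F x) (G x)).
Proof.
move=> bl br cF cG j.
rewrite (_ : (fun _ => _) = (fun x => \sum_i \sum_k F x ord0 i * G x ord0 k
    * b (delta_mx ord0 i) (delta_mx ord0 k) ord0 j)); last first.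
  apply/funext => y; rewrite (bilinear_expand bl br) summxE; apply: eq_bigr => i _.
  by rewrite summxE; apply: eq_bigr => k _; rewrite mxE.
apply: continuous_big => [|i _]; first exact: add_continuous.
apply: continuous_big => [|k _]; first exact: add_continuous.
by move=> x; apply: cvgM; [apply: cvgM; [apply: cF|apply: cG]|apply: cvg_cst].
Qed.

Lemma continuous_coord_cst m (c : 'rV[R]_m) : coord_continuous_fun (fun=> c).
Proof. by move=> j x; apply: cvg_cst. Qed.

Lemma continuous_coordD m (F G : V -> 'rV[R]_m) : coord_continuous_fun F ->
  coord_continuous_fun G -> coord_continuous_fun (fun x => F x + G x).
Proof.
move=> cF cG j x; rewrite (_ : (fun _ => _) = (fun x => F x ord0 j + G x ord0 j)).
  by apply: cvgD; [apply: cF|apply: cG].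
by apply/funext => y; rewrite mxE.
Qed.

Lemma continuous_linear p q (g : 'rV[R]_p -> 'rV[R]_q) (F : V -> 'rV[R]_p) :
  (forall t u v, g (t *: u + v) = t *: g u + g v) ->
  coord_continuous_fun F -> coord_continuous_fun (fun x => g (F x)).
Proof.
move=> lg cF; have := @continuous_bilinear 1 p q (fun u v => u ord0 ord0 *: g v)
  (fun=> const_mx 1) F _ _ (@continuous_coord_cst 1 (const_mx 1)) cF.
rewrite (_ : (fun x => _ *: g (F x)) = (fun x => g (F x))); last first.
  by apply/funext => x; rewrite mxE scale1r.
apply=> [t u v z|z t u v]; first by rewrite !mxE scalerDl scalerA.
by rewrite lg scalerDr !scalerA mulrC.
Qed.

Lemma continuous_mukai (F G : V -> L) : coord_continuous_fun F -> coord_continuous_fun G ->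
  continuous (fun x => mukai (F x) (G x)).
Proof.
move=> cF cG; apply: (@continuous_bilinear _ _ _ (@wedge R 5) F (fun x => sigma (G x))) => //.
- by move=> t u v z; rewrite wedgeDl wedgeZl.
- exact: wedge_is_linear.
- by apply: continuous_linear cG => t u v; rewrite !sigmaE dscaleP.
Qed.

Lemma continuous_quartic (F G : V -> L) : coord_continuous_fun F -> coord_continuous_fun G ->
  continuous (fun x => quartic (F x, G x)).
Proof.
have cQ (H : V -> L) v : coord_continuous_fun H ->
    continuous (fun x => 2 * mukai (clifford v (H x)) (H x)).
  move=> cH x; apply: cvgM; first exact: cvg_cst.
  apply: continuous_mukai => //; apply: continuous_linear cH => t a b.
  by rewrite cliffordDr cliffordZr.
have cQ1 (H : V -> L) k : coord_continuous_fun H -> continuous (fun x => (Q (H x)).1 ord0 k).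
  move=> cH; rewrite (_ : (fun _ => _) = (fun x => 2 * mukai (clifford (0, delta_mx ord0 k) (H x)) (H x))).
    exact: cQ.
  by apply/funext => x; rewrite mxE.
have cQ2 (H : V -> L) k : coord_continuous_fun H -> continuous (fun x => (Q (H x)).2 ord0 k).
  move=> cH; rewrite (_ : (fun _ => _) = (fun x => 2 * mukai (clifford (delta_mx ord0 k, 0) (H x)) (H x))).
    exact: cQ.
  by apply/funext => x; rewrite mxE.
have cS (H K : V -> L) : coord_continuous_fun H -> coord_continuous_fun K ->
    continuous (fun x => \sum_k (Q (H x)).1 ord0 k * (Q (K x)).2 ord0 k).
  move=> cH cK; apply: continuous_big => [|k _]; first exact: add_continuous.
  by move=> x; apply: cvgM; [apply: cQ1|apply: cQ2].
move=> cF cG x; apply: cvgM; first exact: cvg_cst.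
by apply: cvgD; apply: cS.
Qed.

End Continuity.

Lemma in_open_orbit_positive rho : even_pairs rho -> 0 < quartic rho ->
  coef rho.2 finset.set0 != 0 -> in_open_orbit rho.
Proof.
move=> er qr cr; split => //.
pose G vs A (r : L * L) := mix A (map_pair (spin_act vs) r).
have cc : coord_continuous_fun (fun r : L * L => r.1) /\ coord_continuous_fun (fun r : L * L => r.2).
  have c (g : L * L -> L) : continuous g -> coord_continuous_fun g.
    move=> cg j x; apply: (@continuous_comp _ _ _ g (fun M : L => M ord0 j)); first exact: cg.
    exact: coord_continuous.
  by split; apply: c => x; [exact: cvg_fst|exact: cvg_snd].
have cG vs A : coord_continuous_fun (fun r => (G vs A r).1) /\ coord_continuous_fun (fun r => (G vs A r).2).
  by case: cc => c1 c2; split; apply: continuous_coordD;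
    apply: (@continuous_linear _ _ _ (fun a => _ *: spin_act vs a)) => // t u v;
    rewrite spin_actDZ scalerDr !scalerA mulrC.
exists [set r | exists vs A, [/\ spin_word vs, A \in unitmx, 0 < quartic (G vs A r)
    & coef (G vs A r).2 finset.set0 != 0]].
  (* The set is a union over group elements of preimages of open conditions under the continuous
     maps [G vs A]. *)
  rewrite (_ : [set r | _] = \bigcup_(p in [set p : seq (E * E) * 'M[R]_2 | spin_word p.1 /\ p.2 \in unitmx])
      ((fun r => quartic (G p.1 p.2 r)) @^-1` [set t | 0 < t]
       `&` (fun r => coef (G p.1 p.2 r).2 finset.set0) @^-1` [set t | t != 0])); last first.
    apply/seteqP; split=> r /= [].
      by move=> vs [A [h1 h2 h3 h4]]; exists (vs, A).
    by move=> [vs A] [/= h1 h2] [/= h3 h4]; exists vs, A.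
  apply: bigcup_open => -[vs A] _ /=; have [c1 c2] := cG vs A; apply: openI.
    apply: open_comp; last exact: open_gt.
    move=> r _; have := continuous_quartic c1 c2; move=> /(_ r).
    by under eq_fun do rewrite -surjective_pairing.
  by apply: open_comp; [move=> r _; apply: c2|exact: open_neq].
apply/seteqP; split=> r.
  move=> o; split; last exact: orbit_even o er.
  have [vs [A [hv hA e]]] := orbit_sym o.
  exists vs, A; split => //; first by rewrite /G /map_pair -e.
  by move: cr; rewrite {1}e.
move=> [[vs [A [hv hA q c]]] ev].
have o : spin_gl2_orbit r (G vs A r) by exists vs, A.
have o2 := orbit_canonical (orbit_even o ev) q c.
exact: orbit_trans (orbit_canonical er qr cr) (orbit_sym (orbit_trans o o2)).
Qed.

End NormalForm.

(** * Uniqueness, equivariance and explicit form of the hats *)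

Section Hats.
Context {R : realType}.
Local Notation E := 'rV[R]_5.
Local Notation L := (form R 5).
Implicit Types (om phi psi B : L) (rho h k : L * L) (X Y y : E).

Definition odd_pair h := odd_form h.1 /\ odd_form h.2.

Lemma even_form0 : even_form (0 : L). Proof. by move=> I _; rewrite coef0. Qed.

Lemma odd_formB (a b : L) : odd_form a -> odd_form b -> odd_form (a - b).
Proof. by move=> ha hb I oI; rewrite coefB ha ?hb ?subrr. Qed.

(** Testing in the directions (b, 0) and (0, b) separates the two components, and nondegeneracy
    against even forms determines each odd one. *)
Lemma is_hat_unique rho h k : odd_pair h -> odd_pair k -> is_hat rho h -> is_hat rho k -> h = k.
Proof.
case: h k => h1 h2 [k1 k2] [/= oh1 oh2] [/= ok1 ok2] hh hk.
have e s1 s2 : even_form s1 -> even_form s2 ->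
    mukai h2 s1 - mukai h1 s2 = mukai k2 s1 - mukai k1 s2.
  move=> e1 e2; have ev : even_pairs (s1, s2) by [].
  by have := hh _ ev; have := hk _ ev => /= d1 d2; rewrite -(@derive_val _ _ _ _ _ _ _ d1) -(@derive_val _ _ _ _ _ _ _ d2).
have mukai0 (a : L) : mukai a 0 = 0 by rewrite -(scale0r (0 : L)) mukaiZr mul0r.
congr pair; apply/eqP; rewrite -subr_eq0; apply/eqP/mukai_nondegenerate.
- exact: odd_formB.
- move=> b hb; have := e 0 b even_form0 hb; rewrite !mukai0 !sub0r => /eqP.
  by rewrite eqr_opp mukaiDl mukaiNl => /eqP->; rewrite subrr.
- exact: odd_formB.
- move=> b hb; have := e b 0 hb even_form0; rewrite !mukai0 !subr0.
  by rewrite mukaiDl mukaiNl => ->; rewrite subrr.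
Qed.

Lemma is_hat_equiv (g g' : L * L -> L * L) rho h k :
  (forall t r s, g (t *: r + s) = t *: g r + g s) -> cancel g' g ->
  (forall r, even_pairs r -> even_pairs (g' r)) -> even_pairs rho ->
  (forall r, even_pairs r -> vol_density (g r) = vol_density r) ->
  (forall r, even_pairs r -> mukai k.2 (g r).1 - mukai k.1 (g r).2 =
     mukai h.2 r.1 - mukai h.1 r.2) ->
  is_hat rho h -> is_hat (g rho) k.
Proof.
move=> gl gK ge er gv gh hh r hr; rewrite -[r]gK gh; last exact: ge.
have er' := ge _ hr; have hd := hh _ er'.
have line t : vol_density (t *: g (g' r) + g rho) = vol_density (t *: g' r + rho).
  rewrite -gl gv //; case: er er' => [a1 a2] [b1 b2].
  by split; apply: even_formD => //; apply: even_formZ.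
have e : (fun t : R => t^-1 *: ((vol_density \o shift (g rho)) (t *: g (g' r)) - vol_density (g rho)))
       = (fun t : R => t^-1 *: ((vol_density \o shift rho) (t *: g' r) - vol_density rho)).
  apply/funext => t /=; rewrite line; have := line 0; rewrite !scale0r !add0r => ->.
  by [].
case: hd => d1 d2; split; first by rewrite /derivable e.
by rewrite -d2 /derive e.
Qed.

Lemma vol_density_mix A rho : even_pairs rho -> \det A = 1 ->
  vol_density (mix A rho) = vol_density rho.
Proof. by move=> er dA; rewrite /vol_density quartic_mix // dA expr1n mul1r. Qed.

Lemma vol_density_exp B rho : homog 2%N B ->
  vol_density (map_pair (wedge (exp_form B)) rho) = vol_density rho.
Proof.
move=> hB; have [vs hv e] := spin_map_exp hB.
by rewrite /vol_density -(quartic_spin_act rho hv) /map_pair !e.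
Qed.

(** The pairing of hats with variations is skew in the two indices, hence multiplied by the
    determinant. *)
Lemma is_hat_mix A rho h : even_pairs rho -> \det A = 1 -> is_hat rho h ->
  is_hat (mix A rho) (mix A h).
Proof.
move=> er dA; have uA : A \in unitmx by rewrite unitmxE dA unitr1.
apply: (is_hat_equiv (g' := mix (invmx A))) => //.
- move=> t [r1 r2] [s1 s2]; rewrite /mix /=; congr pair; apply/rowP => i; rewrite !mxE; ring.
- by move=> r; rewrite mixM mulmxV // mix1.
- by move=> r; apply: mix_even.
- by move=> r er'; apply: vol_density_mix.
- move=> [r1 r2] _; rewrite /mix /= !(mukaiDl, mukaiDr) !(mukaiZl, mukaiZr).
  rewrite det2 in dA; transitivity ((A 0 0 * A 1 1 - A 0 1 * A 1 0) * (mukai h.2 r1 - mukai h.1 r2)).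
    by ring.
  by rewrite dA mul1r.
Qed.

Lemma is_hat_exp B rho h : homog 2%N B -> even_pairs rho -> is_hat rho h ->
  is_hat (map_pair (wedge (exp_form B)) rho) (map_pair (wedge (exp_form B)) h).
Proof.
move=> hB er; have hN := homogN hB.
apply: (is_hat_equiv (g' := map_pair (wedge (exp_form (- B))))) => //.
- by move=> t r s; rewrite /map_pair /= !wedgeDr !wedgeZr.
- by move=> [r1 r2]; rewrite /map_pair /= !exp_formK.
- by move=> r [h1 h2]; split; apply: exp_even.
- by move=> r _; apply: vol_density_exp.
- move=> [r1 r2] _; rewrite /map_pair /= !mukai_exp //.
  by have K := exp_formK _ hN; rewrite opprK in K; rewrite !K.
Qed.

Lemma hat_std om Y1 Y2 (f : R) : homog 2%N om -> 0 < f ->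
  coef (iprod Y2 (iprod Y1 om)) finset.set0 = - (1 / 8) ->
  let phi := f *: top_form in
  let rho := (om + iprod Y1 phi, unit_form + iprod Y2 phi) in
  [/\ vol_density rho = f,
      hat1 rho = 4 *: iprod Y1 om - 2 *: iprod Y2 (wedge om om) - 2^-1 *: phi
    & hat2 rho = 4 *: (iprod Y2 om + iprod Y2 (iprod Y1 phi))].
Proof.
move=> h f0 c phi rho.
have rhoE : rho = std_pair om (f *: Y1) (f *: Y2).
  by rewrite /rho /std_pair /phi !iprodZr !iprodZl.
have qf : vol_density rho = f.
  rewrite /vol_density rhoE quartic_std // !iprodZl !iprodZr !coefZ c.
  have -> : - 8 * (f * (f * - (1 / 8))) = f ^+ 2 by field.
  by rewrite sqrtr_sqr gtr0_norm.
have [Z hZ] := square_vector h.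
split => //.
  rewrite /hat1 qf rhoE /= (Q_std1 _ h hZ) iprodZl.
  have -> : row_of_form (f *: iprod Y1 om) = f *: row_of_form (iprod Y1 om).
    by apply/rowP => i; rewrite !mxE coefZ.
  rewrite /clifford /= iprodNl iprodZl linearN linearZ /= linearZ /= wedgeNl !wedgeZl iprodDr iprod1 add0r.
  rewrite [covector (f *: _)]linearZ /= wedgeZl covector_row_of_form; last exact: homog_iprod.
  rewrite wedgeDr wedge1r iprodZl iprodZr wedgeZr (iprodC Z) -hZ.
  (* A 1-form times a contracted volume is their pairing times the volume. The factor 4 in front
     turns -1/8 into the -1/2 of the last term. *)
  have -> : wedge (iprod Y1 om) (iprod Y2 top_form) = (- (1 / 8)) *: top_form.
    rewrite -[iprod Y1 om]covector_row_of_form; last exact: homog_iprod.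
    by rewrite covector_iprod_top dot_row_iprod // c.
  have fn0 : f != 0 by rewrite gt_eqF.
  apply/rowP => i; rewrite !mxE; field; exact: fn0.
rewrite /hat2 qf rhoE /= Q_std2 clifford_vec iprodZl iprodDr !iprodZl !iprodZr.
have fn0 : f != 0 by rewrite gt_eqF.
apply/rowP => i; rewrite !mxE; field; exact: fn0.
Qed.

End Hats.

(** * Behaviour of the quartic under linear changes of coordinates *)

Section PullbackQuartic.
Context {R : realType}.
Local Notation E := 'rV[R]_5.
Local Notation L := (form R 5).
Implicit Types (a b phi : L) (X Y y : E).
Variable (P : {linear E -> E}).
Local Notation d := (coef (pullback P top_form) [set: 'I_5]%SET).

Lemma coef_pullback_setT a :
  coef (pullback P a) [set: 'I_5]%SET = d * coef a [set: 'I_5]%SET.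
Proof.
have partT (c : L) : coef c [set: 'I_5]%SET = coef (part 5 c) [set: 'I_5]%SET.
  by rewrite coef_dscale finset.cardsT card_ord eqxx mul1r.
rewrite partT /part -pullback_dscale (@topE _ _ (dscale _ a)); last exact: homog_part.
by rewrite pullbackZ coefZ mulrC -/(part 5 a) -partT.
Qed.

Lemma mukai_pullback a b : mukai (pullback P a) (pullback P b) = d * mukai a b.
Proof. by rewrite /mukai !sigmaE -pullback_dscale -pullback_wedge coef_pullback_setT. Qed.

Lemma pullback_covector y : pullback P (covector y) = covector (y *m (lin1_mx P)^T).
Proof.
rewrite /covector pullback_sum.
transitivity (\sum_k y ord0 k *: covector (comp_row P k)).
  by apply: eq_bigr => k _; rewrite pullbackZ -[dx k]wedge1r pullback_dx pullback1 wedge1r.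
rewrite -/(covector (y *m _)).
under eq_bigr => k _ do rewrite -linearZ.
rewrite -linear_sum; congr covector; apply/rowP => j; rewrite summxE mxE.
by apply: eq_bigr => k _; rewrite !mxE.
Qed.

Lemma dotE X y : dot X y = (X *m y^T) ord0 ord0.
Proof. by rewrite mxE; apply: eq_bigr => k _; rewrite mxE. Qed.

(** [P] on vectors with its inverse transpose on covectors is an isometry, and the Mukai pairing
    scales by the determinant; [inner_isometry] squares the factor. *)
Lemma quartic_pullback (rho : L * L) : lin1_mx P \in unitmx ->
  quartic (map_pair (pullback P) rho) = d ^+ 2 * quartic rho.
Proof.
set M := lin1_mx P => uM; have uMT : M^T \in unitmx by rewrite unitmx_tr.
pose r (v : E * E) := (v.1 *m M, v.2 *m invmx M^T).
pose r' (v : E * E) := (v.1 *m invmx M, v.2 *m M^T).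
have rK : cancel r' r by case=> v1 v2; rewrite /r /r' /= mulmxKV // mulmxK.
have iso v w : inner (r v) (r w) = inner v w.
  rewrite !innerE /= !dotE !trmx_mul !trmx_inv !trmxK.
  by rewrite !mulmxA !mulmxK.
have QE phi v : inner (Q (pullback P phi)) v = d * inner (Q phi) (r v).
  rewrite !Q_spec -mukai_pullback /clifford /=; congr mukai.
  rewrite iprod_pullback pullbackD pullback_wedge pullback_covector mulmxKV //.
  by rewrite mul_rV_lin1.
exact: (inner_isometry rK iso (QE rho.1) (QE rho.2)).
Qed.

(** The transformation law of a vector field is read off from those of the volume and of its
    contraction. *)
Lemma pullback_iprod_top (f g : R) X Y : lin1_mx P \in unitmx -> f != 0 ->
  pullback P (g *: top_form) = f *: top_form ->
  iprod X (f *: top_form) = pullback P (iprod Y (g *: top_form)) -> Y = P X.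
Proof.
move=> uM f0 e; have [Z ->] : exists Z, Y = P Z.
  by exists (Y *m invmx (lin1_mx P)); rewrite -mul_rV_lin1 mulmxKV.
by rewrite -iprod_pullback e !iprodZr => /(scalerI f0)/iprod_top_inj ->.
Qed.

End PullbackQuartic.

(** * Smoothness of algebraic operations on forms *)

Section SmoothQuartic.
Context {R : realType} {n : nat}.
Local Notation V := 'rV[R]_n.
Local Notation L := (form R 5).
Context (U : set V) (Uo : open U).

Lemma eq_smooth (W : normedModType R) (f g : V -> W) : (forall x, U x -> f x = g x) ->
  smooth_on U f -> smooth_on U g.
Proof.
move=> fg sf s x Ux; apply: (near_eq_differentiable (f := foldr partial f s)); last exact: sf.
apply: open_near_eq Ux => //; elim: s => //= k s IH y Uy.
exact: (eq_partial Uo k IH).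
Qed.

Lemma smooth_iprod (m : nat) (F : V -> 'rV[R]_m) (G : V -> form R m) :
  smooth_on U F -> smooth_on U G -> smooth_on U (fun x => iprod (F x) (G x)).
Proof.
apply: (bilinear_smooth (b := @iprod R m)) => //; last exact: iprod_is_linear.
by move=> t u v z; rewrite iprodDl iprodZl.
Qed.

Lemma smooth_wedge (m : nat) (F G : V -> form R m) :
  smooth_on U F -> smooth_on U G -> smooth_on U (fun x => wedge (F x) (G x)).
Proof.
apply: (bilinear_smooth (b := @wedge R m)) => //; last exact: wedge_is_linear.
by move=> t u v z; rewrite wedgeDl wedgeZl.
Qed.

Lemma smooth_dscale (m : nat) g (F : V -> form R m) :
  smooth_on U F -> smooth_on U (fun x => dscale g (F x)).
Proof. exact: (linear_smooth (dscale g)). Qed.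

Lemma smooth_mukai (F G : V -> L) : smooth_on U F -> smooth_on U G ->
  smooth_on U (fun x => mukai (F x) (G x)).
Proof.
move=> sF sG.
have sW : smooth_on U (fun x => wedge (F x) (sigma (G x))).
  apply: smooth_wedge => //.
  exact: (@smooth_dscale 5 (fun p => (-1) ^+ (p./2)) G sG).
exact: (@smooth_coord _ _ _ Uo _ _ (enum_rank [set: 'I_5]%SET) sW).
Qed.

Lemma smooth_clifford v (F : V -> L) : smooth_on U F ->
  smooth_on U (fun x => clifford v (F x)).
Proof.
move=> sF; apply: smoothD => //; first by apply: smooth_iprod => //; apply: smooth_cst.
by apply: smooth_wedge => //; apply: smooth_cst.
Qed.

(** Stated for [smooth_expr] so that [SmoothSqrt] can be applied to it directly. *)
Lemma smooth_quartic (F G : V -> L) : smooth_on U F -> smooth_on U G ->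
  smooth_expr U (fun x => quartic (F x, G x)).
Proof.
have sQ (H : V -> L) v : smooth_on U H ->
    smooth_expr U (cst 2 * fun x => mukai (clifford v (H x)) (H x)).
  move=> sH; apply: SmoothMul; first exact: SmoothCst.
  by apply/SmoothBase/smooth_mukai => //; apply: smooth_clifford.
have sQ1 (H : V -> L) k : smooth_on U H -> smooth_expr U (fun x => (Q (H x)).1 ord0 k).
  move=> sH; rewrite (_ : (fun _ => _) = (cst 2 * fun x => mukai (clifford (0, delta_mx ord0 k) (H x)) (H x))).
    exact: sQ.
  by apply/funext => x; rewrite mxE.
have sQ2 (H : V -> L) k : smooth_on U H -> smooth_expr U (fun x => (Q (H x)).2 ord0 k).
  move=> sH; rewrite (_ : (fun _ => _) = (cst 2 * fun x => mukai (clifford (delta_mx ord0 k, 0) (H x)) (H x))).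
    exact: sQ.
  by apply/funext => x; rewrite mxE.
have sS (H K : V -> L) : smooth_on U H -> smooth_on U K ->
    smooth_expr U (\sum_k ((fun x => (Q (H x)).1 ord0 k) * (fun x => (Q (K x)).2 ord0 k))).
  move=> sH sK; elim/big_ind: _ => [||k _]; [exact: (SmoothCst _ 0)|exact: SmoothAdd|].
  by apply: SmoothMul; [apply: sQ1|apply: sQ2].
move=> sF sG.
rewrite (_ : (fun _ => _) = cst 2^-1 * (\sum_k ((fun x => (Q (F x)).1 ord0 k) * (fun x => (Q (G x)).2 ord0 k))
  + \sum_k ((fun x => (Q (G x)).1 ord0 k) * (fun x => (Q (F x)).2 ord0 k)))).
  apply: SmoothMul; first exact: SmoothCst.
  by apply: SmoothAdd; apply: sS.
by apply/funext => x; rewrite !fctE /= !fct_sumE.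
Qed.

End SmoothQuartic.

Lemma coef_pullback_set0 (R : realType) (P : 'rV[R]_5 -> 'rV[R]_5) (a : form R 5) :
  coef (pullback P a) finset.set0 = coef a finset.set0.
Proof.
have c0 (b : form R 5) : coef b finset.set0 = coef (part 0 b) finset.set0.
  by rewrite coef_dscale finset.cards0 mul1r.
rewrite c0 /part -pullback_dscale -/(part 0 a) part0 pullbackZ pullback1 coefZ coef_unit.
by rewrite eqxx mulr1.
Qed.

(** * Forms and vector fields on the manifold *)

Section Fields.
Context {R : realType} (M : omanifold R 5).
Local Notation E := 'rV[R]_5.
Local Notation L := (form R 5).
Implicit Types (al be : form_field M) (Y Z : vector_field M) (i j : chart M) (x : E).

Lemma lin1_transition_unit i j x : im i x -> dom j (param i x) ->
  lin1_mx ('d (transition i j) x) \in unitmx.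
Proof.
move=> ix jx; rewrite unitmxE unitfE gt_eqF //.
exact: (transition_oriented ix jx).
Qed.

Lemma coef_transition_top i j x : im i x -> dom j (param i x) ->
  0 < coef (pullback ('d (transition i j) x) top_form) [set: 'I_5]%SET.
Proof.
move=> ix jx; rewrite coef_pullback_top.
have -> : \matrix_(k, l) 'd (transition i j) x (delta_mx ord0 l) ord0 k =
    (lin1_mx ('d (transition i j) x))^T.
  by apply/matrixP => k l; rewrite !mxE.
rewrite det_tr; exact: (transition_oriented ix jx).
Qed.

Lemma smooth_form_diff al i x : smooth_form al -> im i x -> differentiable (al i) x.
Proof. by move=> [s _] ix; apply: smooth_diff ix; apply: s. Qed.

Lemma smooth_vector_diff Y i x : smooth_vector_field Y -> im i x -> differentiable (Y i) x.
Proof. by move=> [s _] ix; apply: smooth_diff ix; apply: s. Qed.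

Lemma smooth_formD al be : smooth_form al -> smooth_form be ->
  smooth_form (fun i x => al i x + be i x : L).
Proof.
move=> [sa ta] [sb tb]; split=> [i|i j x ix jx].
  by apply: smoothD; [exact: im_open|exact: sa|exact: sb].
by rewrite pullbackD -ta // -tb.
Qed.

Lemma smooth_formZ (t : R) al : smooth_form al -> smooth_form (fun i x => t *: al i x : L).
Proof.
move=> [sa ta]; split=> [i|i j x ix jx]; last by rewrite pullbackZ -ta.
apply: smoothZ; [exact: im_open| |exact: sa].
by apply: smooth_exprP; [exact: im_open|exact: SmoothCst].
Qed.

Lemma smooth_form_dscale g al : smooth_form al -> smooth_form (fun i x => dscale g (al i x)).
Proof.
move=> [sa ta]; split=> [i|i j x ix jx]; last by rewrite pullback_dscale -ta.
by apply: smooth_dscale; [exact: im_open|exact: sa].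
Qed.

Lemma smooth_form_wedge al be : smooth_form al -> smooth_form be ->
  smooth_form (fun i x => wedge (al i x) (be i x)).
Proof.
move=> [sa ta] [sb tb]; split=> [i|i j x ix jx]; last by rewrite pullback_wedge -ta // -tb.
by apply: smooth_wedge; [exact: im_open|exact: sa|exact: sb].
Qed.

Lemma smooth_form_unit : smooth_form (fun (_ : chart M) (_ : E) => unit_form : L).
Proof. by split=> [i|i j x ix jx]; [apply: smooth_cst; exact: im_open|rewrite pullback1]. Qed.

Lemma smooth_form_iprod Y al : smooth_vector_field Y -> smooth_form al ->
  smooth_form (fun i x => iprod (Y i x) (al i x)).
Proof.
move=> [sY tY] [sa ta]; split=> [i|i j x ix jx]; last by rewrite tY // -iprod_pullback -ta.
by apply: smooth_iprod; [exact: im_open|exact: sY|exact: sa].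
Qed.

Lemma eq_smooth_form al be : pointwise (fun i x => al i x = be i x) ->
  smooth_form al -> smooth_form be.
Proof.
move=> e [sa ta]; split=> [i|i j x ix jx].
  by refine (@eq_smooth _ _ _ (@im_open _ _ M i) _ (al i) (be i) _ (sa i)) => x; apply: e.
rewrite -e // -e; first exact: ta.
by rewrite /transition /=; apply: coords_im.
Qed.

Lemma smooth_form_exp al : smooth_homog_form 2%N al ->
  smooth_form (fun i x => exp_form (al i x)).
Proof.
move=> [sa ha]; apply: (@eq_smooth_form (fun i x => unit_form + al i x + 2^-1 *: wedge (al i x) (al i x))).
  by move=> i x ix; rewrite exp_formE //; apply: ha.
apply: smooth_formD; first by apply: smooth_formD => //; apply: smooth_form_unit.
by apply: smooth_formZ; apply: smooth_form_wedge.
Qed.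

(** ** Closed forms *)

Lemma closed_dscale g al : smooth_form al -> closed_form al ->
  closed_form (fun i x => dscale (g \o succn) (al i x)).
Proof.
move=> sa ca i x ix; rewrite extd_dscale; last exact: smooth_form_diff.
by rewrite ca // linear0.
Qed.

Lemma closed_part p al : smooth_form al -> closed_form al ->
  closed_form (fun i x => part p (al i x)).
Proof. exact: (@closed_dscale (fun q => (q == p.+1)%:R)). Qed.

Lemma eq_closed al be : pointwise (fun i x => al i x = be i x) ->
  closed_form al -> closed_form be.
Proof.
move=> e ca i x ix; rewrite -(ca i x ix); apply: (eq_extd (@im_open _ _ M i)) ix => y iy.
by rewrite e.
Qed.

Lemma closedD al be : smooth_form al -> smooth_form be -> closed_form al -> closed_form be ->
  closed_form (fun i x => al i x + be i x : L).
Proof.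
move=> sa sb ca cb i x ix; rewrite extdD; [|exact: smooth_form_diff..].
by rewrite ca // cb // addr0.
Qed.

Lemma closedZ (t : R) al : smooth_form al -> closed_form al ->
  closed_form (fun i x => t *: al i x : L).
Proof.
move=> sa ca i x ix; rewrite extdZ; last exact: smooth_form_diff.
by rewrite ca // scaler0.
Qed.

Lemma closed_wedge al be : smooth_form al -> smooth_form be -> closed_form al -> closed_form be ->
  closed_form (fun i x => wedge (al i x) (be i x)).
Proof.
move=> sa sb ca cb i x ix; rewrite extd_wedge; [|exact: smooth_form_diff..].
by rewrite ca // cb // wedge0l wedge0r addr0.
Qed.

Lemma closed_exp al : smooth_form al -> closed_form al ->
  closed_form (fun i x => exp_form (al i x)).
Proof. by move=> sa ca i x ix; apply: extd_exp; [apply: smooth_form_diff|apply: ca]. Qed.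

Lemma closed_unit : closed_form (fun (_ : chart M) (_ : E) => unit_form : L).
Proof. by move=> i x _; apply: extd_cst. Qed.

Lemma closed_top al : smooth_homog_form 5%N al -> closed_form al.
Proof.
move=> [sa ha] i x ix; apply: (@homog_gt _ _ 6) => //.
by apply: (extd_homog (@im_open _ _ M i) (ha i) ix); apply: smooth_form_diff.
Qed.

(** The degree zero coefficient does not depend on the chart, since pullback preserves it, and is
    locally constant, since the degree 1 part of the exterior derivative holds its partial
    derivatives. Its level sets are open and closed. *)
Lemma degree0_constant (M_connected : connected [set: M]) (M_nonempty : [set: M] !=set0) al :
  smooth_form al -> closed_form al ->
  exists c, forall i x, im i x -> coef (al i x) finset.set0 = c.
Proof.
move=> sa ca; have [p0 _] := M_nonempty; have [i0 di0] := dom_cover p0.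
pose v i (p : M) := coef (al i (coords i p)) finset.set0.
have vE i j p : dom i p -> dom j p -> v i p = v j p.
  move=> di dj; have ix := coords_im di; have jx : dom j (param i (coords i p)) by rewrite coordsK.
  rewrite /v (sa.2 i j _ ix jx) coef_pullback_set0.
  by rewrite /transition /= coordsK.
have vloc i p : dom i p -> \forall q \near p, dom i q /\ v i q = v i p.
  move=> di; have ix := coords_im di.
  have near_x : \forall y \near coords i p, coef (al i y) finset.set0 = coef (al i (coords i p)) finset.set0.
    apply: (partial0_locally_constant (@im_open _ _ M i) ix) => y iy.
      have da := smooth_form_diff sa iy.
      by move/differentiable_rowP : da; apply.
    move=> k; have := congr1 (fun c => coef c [set k]%SET) (ca i y iy).
    rewrite coef0 /extd coef_sum (bigD1 k) //= big1 ?addr0 => [|l lk].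
      rewrite coef_dx_wedge finset.set11 finset.setDv.
      have -> : lesser k [set k]%SET = 0%N.
        by apply: fintype.eq_card0 => z; rewrite !inE; case: eqP => [->|//]; rewrite ltnn.
      rewrite expr0 mul1r /partial /coef derive_row //; exact: smooth_form_diff.
    by rewrite coef_dx_wedge inE (negPf lk).
  have n1 : \forall q \near p, dom i q by apply: open_nbhs_nbhs; split=> //; exact: dom_open.
  have n2 : \forall q \near p, coef (al i (coords i q)) finset.set0 = coef (al i (coords i p)) finset.set0.
    exact: (coords_continuous di near_x).
  by apply: filterS2 n1 n2 => q.
pose c := v i0 p0; exists c => i x ix.
(* Quantifying over all charts gives a subset of the manifold; by [BE] one chart is enough for
   membership. *)
pose B := [set p : M | forall j, dom j p -> v j p = c].
have BE j p : dom j p -> v j p = c -> B p by move=> dj vc k dk; rewrite (vE k j).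
suff BT : B = [set: M].
  have : B (param i x) by rewrite BT.
  by move=> /(_ i (param_dom ix)); rewrite /v paramK.
apply: M_connected.
- by exists p0; apply: (BE i0).
- exists B; last by rewrite setTI.
  rewrite openE => p Bp; have [j dj] := dom_cover p.
  by apply: filterS (vloc j p dj) => q [dq vq]; apply: (BE j) => //; rewrite vq; apply: Bp.
- exists B; last by rewrite setTI.
  rewrite -openC openE => p /= nBp; have [j dj] := dom_cover p.
  apply: filterS (vloc j p dj) => q [dq vq] Bq; apply: nBp; apply: (BE j) => //.
  by rewrite -vq; apply: Bq.
Qed.

End Fields.

(** * From the reduced data to a critical structure *)

Section Structure.
Context {R : realType} (M : omanifold R 5).
Local Notation E := 'rV[R]_5.
Local Notation L := (form R 5).
Implicit Types (al be omega phi : form_field M) (Y Z : vector_field M) (i j : chart M) (x : E).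

Lemma closed_iprod Y al : smooth_vector_field Y -> smooth_form al -> closed_form al ->
  preserves Y al -> closed_form (fun i x => iprod (Y i x) (al i x)).
Proof.
move=> sY sa ca pa i x ix; have := pa i x ix.
rewrite cartan; [|exact: smooth_vector_diff|exact: smooth_form_diff].
by rewrite ca // iprod0r addr0.
Qed.

Lemma preserves_closed Y al : smooth_vector_field Y -> smooth_form al -> closed_form al ->
  closed_form (fun i x => iprod (Y i x) (al i x)) -> preserves Y al.
Proof.
move=> sY sa ca pa i x ix; rewrite cartan; [|exact: smooth_vector_diff|exact: smooth_form_diff].
by rewrite ca // iprod0r addr0; apply: pa.
Qed.

Lemma bracketC (X Y : E -> E) x : bracket X Y x = - bracket Y X x.
Proof. by rewrite /bracket opprB. Qed.

Section Data.
Variables (omega phi : form_field M) (Y1 Y2 : vector_field M).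
Hypothesis data : reduced_data omega phi Y1 Y2.

Let so : smooth_form omega. Proof. by case: data => -[[]]. Qed.
Let ho : pointwise (fun i x => homog 2%N (omega i x)). Proof. by case: data => -[[]]. Qed.
Let co : closed_form omega. Proof. by case: data => -[]. Qed.
Let shp : smooth_homog_form 5%N phi. Proof. by case: data => -[_ _ []]. Qed.
Let sp : smooth_form phi. Proof. by case: shp. Qed.
Let pp : pointwise (fun i x => 0 < coef (phi i x) [set: 'I_5]%SET).
Proof. by case: data => -[_ _ []]. Qed.
Let cp : closed_form phi. Proof. exact: closed_top shp. Qed.
Let s1 : smooth_vector_field Y1. Proof. by case: data => _ []. Qed.
Let s2 : smooth_vector_field Y2. Proof. by case: data => _ []. Qed.
Let comm : commuting Y1 Y2. Proof. by case: data => _ []. Qed.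
Let o1 : preserves Y1 omega. Proof. by case: data => _ _ []. Qed.
Let o2 : preserves Y2 omega. Proof. by case: data => _ _ []. Qed.
Let p1 : preserves Y1 phi. Proof. by case: data => _ _ []. Qed.
Let p2 : preserves Y2 phi. Proof. by case: data => _ _ []. Qed.
Let norm : pointwise (fun i x =>
  coef (iprod (Y2 i x) (iprod (Y1 i x) (omega i x))) finset.set0 = - (1 / 8)).
Proof. by case: data. Qed.

Let rho i x := (std1 omega phi Y1 i x, std2 phi Y2 i x).

(** The contraction of the square of [omega] is expanded into twice a wedge product, so that
    closedness follows from that of its two factors. *)
Let h1 : form_field M := fun i x => 4 *: iprod (Y1 i x) (omega i x)
  + (- 4) *: wedge (iprod (Y2 i x) (omega i x)) (omega i x) + (- 2^-1) *: phi i x.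
Let h2 : form_field M := fun i x =>
  4 *: (iprod (Y2 i x) (omega i x) + iprod (Y2 i x) (iprod (Y1 i x) (phi i x))).

Lemma std_point i x : im i x ->
  [/\ even_pairs (rho i x), 0 < quartic (rho i x), vol (rho i x) = phi i x
    & is_hat (rho i x) (h1 i x, h2 i x)].
Proof.
move=> ix; have f0 := pp ix; set f := coef _ _ in f0.
have pE : phi i x = f *: top_form by apply: topE; apply: shp.2.
have h := ho ix; have n := norm ix.
have [vf e1 e2] := hat_std h f0 n.
have rE : rho i x = (omega i x + iprod (Y1 i x) (f *: top_form),
                     unit_form + iprod (Y2 i x) (f *: top_form)).
  by rewrite /rho /std1 /std2 pE.
have ev : even_pairs (rho i x).
  by rewrite rE !iprodZr -!iprodZl; apply: even_std.
have q0 : 0 < quartic (rho i x).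
  by move: f0; rewrite -vf -rE sqrtr_gt0.
split => //.
  by rewrite /vol [in vol_density _]rE vf pE.
have := is_hat_hat ev q0; congr is_hat.
rewrite /h1 /h2 pE; congr pair; rewrite [in LHS]rE; last exact: e2.
rewrite e1 iprod_wedge parity_even; last exact: (homog_even (p := 2)).
rewrite -(wedgeC2 _ h); apply/rowP => k; rewrite !mxE; ring.
Qed.

Lemma smooth_hats : smooth_odd_form h1 /\ smooth_odd_form h2.
Proof.
have si1 := smooth_form_iprod s1 so; have si2 := smooth_form_iprod s2 so.
have sip1 := smooth_form_iprod s1 sp.
split; split.
- apply: smooth_formD; last exact: smooth_formZ.
  apply: smooth_formD; first exact: smooth_formZ.
  by apply: smooth_formZ; apply: smooth_form_wedge.
- move=> i x ix; have h := ho ix.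
  have i1 (X : E) : homog 1%N (iprod X (omega i x)) by apply: homog_iprod.
  move=> I oI; rewrite !coefD !coefZ (homog_odd (isT : odd 1) (i1 _)) //.
  have h3 := homog_wedge (i1 (Y2 i x)) h.
  rewrite (homog_odd (isT : odd 3) h3) // (homog_odd (isT : odd 5) (shp.2 i x ix)) //.
  by rewrite !mulr0 !addr0.
- apply: smooth_formZ; apply: smooth_formD => //; exact: smooth_form_iprod.
- move=> i x ix I oI; rewrite coefZ coefD.
  have i1 : homog 1%N (iprod (Y2 i x) (omega i x)) by apply: homog_iprod; apply: ho.
  have i3 : homog 3%N (iprod (Y2 i x) (iprod (Y1 i x) (phi i x))).
    by do 2!apply: homog_iprod; apply: shp.2.
  by rewrite (homog_odd (isT : odd 1) i1) // (homog_odd (isT : odd 3) i3) // addr0 mulr0.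
Qed.

Lemma closed_hats : closed_form h1 /\ closed_form h2.
Proof.
have si1 := smooth_form_iprod s1 so; have si2 := smooth_form_iprod s2 so.
have sip1 := smooth_form_iprod s1 sp.
have sw := smooth_form_wedge si2 so.
split.
  apply: closedD; last exact: closedZ.
  - by apply: smooth_formD; apply: smooth_formZ.
  - exact: smooth_formZ.
  apply: closedD; [exact: smooth_formZ|exact: smooth_formZ| |].
    by apply: closedZ => //; apply: closed_iprod.
  apply: closedZ => //; apply: closed_wedge => //; exact: closed_iprod.
have si21 := smooth_form_iprod s2 sip1.
apply: closedZ; first exact: smooth_formD.
apply: closedD => //; first exact: closed_iprod.
apply: closed_iprod => //; first exact: closed_iprod.
(* [Y2] preserves the contraction of [phi] by [Y1], because it preserves [phi] and the bracket
   vanishes. *)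
move=> i x ix; rewrite lie_iprod; [|exact: smooth_vector_diff..|exact: smooth_form_diff].
by rewrite p2 // iprod0r addr0 bracketC comm // oppr0 iprod0l.
Qed.

Lemma data_critical (M_nonempty : [set: M] !=set0) :
  critical_structure (std1 omega phi Y1) (std2 phi Y2) /\
  pointwise (fun i x => vol (std1 omega phi Y1 i x, std2 phi Y2 i x) = phi i x).
Proof.
have sip1 := smooth_form_iprod s1 sp; have sip2 := smooth_form_iprod s2 sp.
have coef2 i x : im i x -> coef (std2 phi Y2 i x) finset.set0 = 1.
  move=> ix; have h4 : homog 4%N (iprod (Y2 i x) (phi i x)) by apply: homog_iprod; apply: shp.2.
  by rewrite /std2 coefD coef_unit eqxx h4 ?finset.cards0 // addr0.
split; last by move=> i x ix; have [] := std_point ix.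
split.
- split; first exact: smooth_formD.
  by move=> i x ix; have [[]] := std_point ix.
- split; first by apply: smooth_formD => //; exact: smooth_form_unit.
  by move=> i x ix; have [[]] := std_point ix.
- move=> i x ix; have [ev q0 _ _] := std_point ix; split => //.
  by apply: in_open_orbit_positive => //=; rewrite coef2 // oner_eq0.
- split.
  + by apply: closedD => //; apply: closed_iprod.
  + apply: closedD => //; [exact: smooth_form_unit|exact: closed_unit|exact: closed_iprod].
  + have [sh1 sh2] := smooth_hats; have [ch1 ch2] := closed_hats.
    by exists h1, h2; split => // i x ix; have [] := std_point ix.
(* A point of the manifold witnesses the nonzero degree zero part. *)
- have [p _] := M_nonempty; have [i di] := dom_cover p.
  exists i, (coords i p); have ix := coords_im di; split => //.
  by right; rewrite coef2 // oner_eq0.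
Qed.

End Data.
End Structure.

(** * Volume and vector fields extracted from a pair of forms *)

Section Critical.
Context {R : realType} (M : omanifold R 5).
Local Notation E := 'rV[R]_5.
Local Notation L := (form R 5).
Implicit Types (al be omega phi : form_field M) (Y Z : vector_field M) (i j : chart M) (x : E).

Lemma partB p (a b : L) : part p (a - b) = part p a - part p b.
Proof. exact: linearB. Qed.

Lemma part1_sub p q (s t : R) (a b c : L) : homog 1%N a -> homog p.+2 b -> homog q.+2 c ->
  part 1 (a - s *: b - t *: c) = a.
Proof.
move=> ha hb hc.
by rewrite !partB !partZ (part_homog 1 ha) (part_homog 1 hb) (part_homog 1 hc) !scale0r !scaler0 !subr0 scale1r.
Qed.

Lemma part_add p q (a b : L) : homog p a -> homog q b -> p != q ->
  part p (a + b) = a /\ part q (a + b) = b.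
Proof.
move=> ha hb pq; rewrite !partD !(part_homog _ ha) !(part_homog _ hb) !eqxx (negPf pq).
by rewrite eq_sym (negPf pq) !scale0r !scale1r addr0 add0r.
Qed.

Lemma smooth_form_lin (s t : R) al be : smooth_form al -> smooth_form be ->
  smooth_form (fun i x => s *: al i x + t *: be i x : L).
Proof. by move=> sa sb; apply: smooth_formD; apply: smooth_formZ. Qed.

Lemma closed_lin (s t : R) al be : smooth_form al -> smooth_form be ->
  closed_form al -> closed_form be -> closed_form (fun i x => s *: al i x + t *: be i x : L).
Proof.
by move=> sa sb ca cb; apply: closedD; try exact: smooth_formZ; apply: closedZ.
Qed.

Lemma closed_scaled (t : R) al : t != 0 -> smooth_form al ->
  closed_form (fun i x => t *: al i x : L) -> closed_form al.
Proof.
move=> t0 sa ca i x ix; have := ca i x ix; rewrite extdZ; last exact: smooth_form_diff.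
by move/eqP; rewrite scaler_eq0 (negPf t0) => /eqP.
Qed.

Lemma vector_part_top (a : L) : part 4 a = iprod (vector_part a) top_form.
Proof. by apply: (iprod_topE (p := 4)) => //; apply: homog_part. Qed.

Lemma smooth_vector_part (U : set E) (F : E -> L) : open U -> smooth_on U F ->
  smooth_on U (fun x => vector_part (F x)).
Proof.
move=> Uo sF; apply/smooth_row => // k.
have sW : smooth_on U (fun x => wedge (dx k) (dscale (fun q => (q == 4)%:R) (F x))).
  apply: smooth_wedge => //; first exact: smooth_cst.
  exact: (@smooth_dscale _ _ _ Uo 5 (fun q => (q == 4)%:R) F sF).
rewrite (_ : (fun _ => _) = (fun x => wedge (dx k) (dscale (fun q => (q == 4)%:R) (F x)) ord0
    (enum_rank [set: 'I_5]%SET))).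
  exact: (@smooth_coord _ _ _ Uo _ _ (enum_rank [set: 'I_5]%SET) sW).
by apply/funext => x; rewrite mxE.
Qed.

Variables rho1 rho2 : form_field M.
Hypothesis s1 : smooth_form rho1.
Hypothesis s2 : smooth_form rho2.
Hypothesis pos : pointwise (fun i x => 0 < quartic (rho1 i x, rho2 i x)).

Definition density i x := vol_density (rho1 i x, rho2 i x).
Definition vol_field : form_field M := fun i x => vol (rho1 i x, rho2 i x).

Lemma density_gt0 i x : im i x -> 0 < density i x.
Proof. by move=> ix; rewrite sqrtr_gt0; apply: pos. Qed.

Lemma vol_fieldE i x : vol_field i x = density i x *: top_form.
Proof. by []. Qed.

Lemma smooth_density i : smooth_on (im i) (density i).
Proof.
apply: smooth_exprP; first exact: im_open.
apply: SmoothSqrt; last by move=> x ix; apply: pos.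
by apply: smooth_quartic; [exact: im_open|exact: s1.1|exact: s2.1].
Qed.

(** The quartic scales by the square of the Jacobian determinant. The charts are oriented, so the
    root of that square is the determinant itself and the density defines a global form. *)
Lemma pullback_vol i j x : im i x -> dom j (param i x) ->
  pullback ('d (transition i j) x) (density j (transition i j x) *: top_form)
  = density i x *: top_form.
Proof.
move=> ix jx; have d0 := coef_transition_top ix jx; have uM := lin1_transition_unit ix jx.
rewrite pullbackZ (topE (pullback_homog _ (@homog_top _ _))) scalerA; congr (_ *: _).
rewrite /density /vol_density (s1.2 i j x ix jx) (s2.2 i j x ix jx).
rewrite (quartic_pullback (rho1 j (transition i j x), rho2 j (transition i j x)) uM).
by rewrite [RHS]sqrtrM ?sqr_ge0 // sqrtr_sqr gtr0_norm // mulrC.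
Qed.

Lemma positive_vol_field : positive_volume_form vol_field.
Proof.
split; last by move=> i x ix; rewrite vol_fieldE coefZ coef_top mulr1 density_gt0.
split; last by move=> i x ix; rewrite vol_fieldE; apply/homogZ/homog_top.
split=> [i|i j x ix jx]; last by rewrite !vol_fieldE pullback_vol.
apply: smoothZ; [exact: im_open|exact: smooth_density|apply: smooth_cst; exact: im_open].
Qed.

(** The inverse of contraction with the volume, applied to the degree 4 part. *)
Definition contraction_field al : vector_field M :=
  fun i x => (density i x)^-1 *: vector_part (al i x).

Lemma contraction_fieldE al i x : im i x ->
  iprod (contraction_field al i x) (vol_field i x) = part 4 (al i x).
Proof.
move=> ix; rewrite vector_part_top iprodZl vol_fieldE iprodZr scalerA mulVf ?scale1r //.
by rewrite gt_eqF // density_gt0.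
Qed.

Lemma smooth_contraction_field al : smooth_form al -> smooth_vector_field (contraction_field al).
Proof.
move=> sa; split=> [i|i j x ix jx].
  apply: smoothZ; [exact: im_open| |].
    apply: smooth_exprP; first exact: im_open.
    apply: SmoothInv; first by apply/SmoothBase/smooth_density.
    by move=> x ix; rewrite gt_eqF // density_gt0.
  by apply: smooth_vector_part; [exact: im_open|exact: sa.1].
apply: (pullback_iprod_top (lin1_transition_unit ix jx) _ (pullback_vol ix jx)).
  by rewrite gt_eqF // density_gt0.
have jy : im j (transition i j x) by apply: coords_im.
rewrite -!vol_fieldE !contraction_fieldE // [in LHS](sa.2 i j x ix jx).
by rewrite /part pullback_dscale.
Qed.

End Critical.

(** * From a critical structure to the reduced data *)

Section CriticalData.
Context {R : realType} (M : omanifold R 5).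
Hypothesis M_connected : connected [set: M].
Hypothesis M_nonempty : [set: M] !=set0.
Local Notation E := 'rV[R]_5.
Local Notation L := (form R 5).

Lemma critical_data (rho1 rho2 : form_field M) : critical_structure rho1 rho2 ->
  exists (A : 'M[R]_2) (B : form_field M) (omega phi : form_field M) (Y1 Y2 : vector_field M),
    [/\ \det A = 1, smooth_homog_form 2%N B /\ closed_form B, reduced_data omega phi Y1 Y2,
        pointwise (fun i x => vol (rho1 i x, rho2 i x) = phi i x)
      & pointwise (fun i x => transform A B rho1 rho2 i x
          = (std1 omega phi Y1 i x, std2 phi Y2 i x))].
Proof.
move=> [[s1 e1] [s2 e2] st [c1 c2 [h1 [h2 [[sh1 oh1] [sh2 oh2] hat ch1 ch2]]]] nz].
have pos : pointwise (fun i x => 0 < quartic (rho1 i x, rho2 i x)).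
  by move=> i x ix; have [] := st i x ix.
have [a1 k1] := degree0_constant M_connected M_nonempty s1 c1.
have [a2 k2] := degree0_constant M_connected M_nonempty s2 c2.
have ne : (a1 != 0) || (a2 != 0).
  by case: nz => i [x [ix]]; rewrite k1 // k2 // => /orP.
have [A [dA A1 A2]] := normalizing_matrix ne.
pose r1 : form_field M := fun i x => A 0 0 *: rho1 i x + A 0 1 *: rho2 i x.
pose r2 : form_field M := fun i x => A 1 0 *: rho1 i x + A 1 1 *: rho2 i x.
pose k1' : form_field M := fun i x => A 0 0 *: h1 i x + A 0 1 *: h2 i x.
pose k2' : form_field M := fun i x => A 1 0 *: h1 i x + A 1 1 *: h2 i x.
have sr1 : smooth_form r1 by apply: smooth_form_lin.
have sr2 : smooth_form r2 by apply: smooth_form_lin.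
have sk1 : smooth_form k1' by apply: smooth_form_lin.
have sk2 : smooth_form k2' by apply: smooth_form_lin.
have cr1 : closed_form r1 by apply: closed_lin.
have cr2 : closed_form r2 by apply: closed_lin.
have ck1 : closed_form k1' by apply: closed_lin.
have ck2 : closed_form k2' by apply: closed_lin.
have er i x : im i x -> even_pairs (rho1 i x, rho2 i x) by move=> ix; split; [apply: e1|apply: e2].
have er' i x : im i x -> even_pairs (r1 i x, r2 i x) by move=> ix; apply: (mix_even A (er i x ix)).
have d1 i x : im i x -> coef (r1 i x) finset.set0 = 0.
  by move=> ix; rewrite coefD !coefZ k1 // k2.
have d2 i x : im i x -> coef (r2 i x) finset.set0 = 1.
  by move=> ix; rewrite coefD !coefZ k1 // k2.
pose B : form_field M := fun i x => - part 2 (r2 i x).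
have hB i x : homog 2%N (B i x) by apply/homogN/homog_part.
have sB : smooth_form B.
  apply: (@eq_smooth_form _ _ (fun i x => (-1) *: part 2 (r2 i x))); last first.
    by apply/smooth_formZ/smooth_form_dscale.
  by move=> i x _; rewrite scaleN1r.
have cB : closed_form B.
  apply: (@eq_closed _ _ (fun i x => (-1) *: part 2 (r2 i x))); last first.
    by apply: closedZ; [apply: smooth_form_dscale|apply: closed_part].
  by move=> i x _; rewrite scaleN1r.
have sX : smooth_form (fun i x => exp_form (B i x)) by apply: smooth_form_exp; split.
have cX : closed_form (fun i x => exp_form (B i x)) by apply: closed_exp.
pose G (al : form_field M) : form_field M := fun i x => wedge (exp_form (B i x)) (al i x).
have sG al : smooth_form al -> smooth_form (G al) by move=> sa; apply: smooth_form_wedge.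
have cG al : smooth_form al -> closed_form al -> closed_form (G al) by move=> sa ca; apply: closed_wedge.
pose omega : form_field M := fun i x => part 2 (r1 i x).
have so : smooth_form omega by apply: smooth_form_dscale.
have co : closed_form omega by apply: closed_part.
have ho i x : homog 2%N (omega i x) by apply: homog_part.
pose phi := vol_field rho1 rho2.
pose Y1 := contraction_field rho1 rho2 (G r1); pose Y2 := contraction_field rho1 rho2 (G r2).
have pp : positive_volume_form phi by apply: positive_vol_field.
have sp : smooth_form phi by case: pp => -[].
have hp : pointwise (fun i x => homog 5%N (phi i x)) by case: pp => -[].
have cp : closed_form phi by case: pp => hh _; apply: closed_top.
have sY1 : smooth_vector_field Y1 by apply: smooth_contraction_field => //; apply: sG.
have sY2 : smooth_vector_field Y2 by apply: smooth_contraction_field => //; apply: sG.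
have YE1 i x : im i x -> iprod (Y1 i x) (phi i x) = part 4 (G r1 i x).
  by move=> ix; apply: contraction_fieldE.
have YE2 i x : im i x -> iprod (Y2 i x) (phi i x) = part 4 (G r2 i x).
  by move=> ix; apply: contraction_fieldE.
(* From here the vector fields are known only by their smoothness and their contractions with
   [phi]. *)
clearbody Y1 Y2.
have GE i x : im i x -> (G r1 i x, G r2 i x) = (std1 omega phi Y1 i x, std2 phi Y2 i x).
  move=> ix; have := normal_form (er' i x ix) (d1 i x ix) (d2 i x ix).
  by rewrite /std1 /std2 YE1 // YE2 // !vector_part_top.
have volG i x : im i x -> vol_density (G r1 i x, G r2 i x) = density rho1 rho2 i x.
  move=> ix; rewrite (vol_density_exp (r1 i x, r2 i x) (hB i x)).
  exact: (vol_density_mix (er i x ix) dA).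
have quarticG i x : im i x -> quartic (G r1 i x, G r2 i x) = density rho1 rho2 i x ^+ 2.
  move=> ix; have := density_gt0 pos ix; rewrite -(volG i x ix) sqrtr_gt0 => /ltW q0.
  by rewrite /vol_density sqr_sqrtr.
(* The quartic at the normal form is both the square of the density, by invariance, and -8 times
   that square times the pairing of the two fields. *)
have norm i x : im i x ->
    coef (iprod (Y2 i x) (iprod (Y1 i x) (omega i x))) finset.set0 = - (1 / 8).
  move=> ix; have f0 := density_gt0 pos ix; set f := density _ _ _ _ in f0.
  have fn0 : f != 0 by rewrite gt_eqF.
  have q := quarticG i x ix; rewrite -/f in q.
  have GS : (G r1 i x, G r2 i x) = std_pair (omega i x) (f *: Y1 i x) (f *: Y2 i x).
    rewrite GE // /std1 /std2 /phi vol_fieldE -/f /std_pair.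
    by rewrite !(iprodZr _ f) !(iprodZl f).
  move: q; rewrite GS quartic_std // !iprodZl !iprodZr !coefZ => q.
  set c := coef _ _ in q *; have : f ^+ 2 * (8 * c + 1) = 0.
    by have -> : f ^+ 2 * (8 * c + 1) = f ^+ 2 - (- 8 * (f * (f * c))) by [ring]; rewrite q subrr.
  move/eqP; rewrite mulf_eq0 expf_eq0 (negPf fn0) andbF /= => /eqP e.
  by lra.
have hats i x : im i x -> (G k1' i x, G k2' i x) =
    (4 *: iprod (Y1 i x) (omega i x) - 2 *: iprod (Y2 i x) (wedge (omega i x) (omega i x))
       - 2^-1 *: phi i x,
     4 *: (iprod (Y2 i x) (omega i x) + iprod (Y2 i x) (iprod (Y1 i x) (phi i x)))).
  move=> ix; have f0 := density_gt0 pos ix.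
  have [vf hE1 hE2] := hat_std (ho i x) f0 (norm i x ix).
  have evG : even_pairs (G r1 i x, G r2 i x).
    by case: (er' i x ix) => ? ?; split; apply: exp_even.
  have qG : 0 < quartic (G r1 i x, G r2 i x) by rewrite quarticG // exprn_gt0.
  have hG := is_hat_exp (hB i x) (er' i x ix) (is_hat_mix (er i x ix) dA (hat i x ix)).
  have hS := is_hat_hat evG qG.
  have okk (s t : R) : odd_form (wedge (exp_form (B i x)) (s *: h1 i x + t *: h2 i x)).
    apply: exp_odd => // I oI.
    by rewrite coefD !coefZ (oh1 i x ix) // (oh2 i x ix) // !mulr0 addr0.
  have ohs (t : R) v b : even_form b -> odd_form (t *: clifford v b).
    by move=> eb I oI; rewrite coefZ clifford_odd ?mulr0.
  (* The transported hats and the explicit ones are both odd hats of the same pair, so they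
     coincide. *)
  have -> : (G k1' i x, G k2' i x) = (hat1 (G r1 i x, G r2 i x), hat2 (G r1 i x, G r2 i x)).
    apply: is_hat_unique hG hS; first by split; apply: okk.
    by case: evG => ? ?; split; apply: ohs.
  by rewrite (GE i x ix); congr pair.
have hats1 i x ix := congr1 fst (hats i x ix).
have hats2 i x ix := congr1 snd (hats i x ix).
move: hats1 hats2 => /= hats1 hats2.
have h11 Y i x : homog 1%N (iprod (Y i x) (omega i x)) by apply: homog_iprod.
have h3w i x : homog 3%N (iprod (Y2 i x) (wedge (omega i x) (omega i x))).
  by apply: homog_iprod; apply: (homog_wedge (ho i x) (ho i x)).
have h3p i x : im i x -> homog 3%N (iprod (Y2 i x) (iprod (Y1 i x) (phi i x))).
  by move=> ix; do 2!apply: homog_iprod; apply: hp.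
(* Homogeneous parts of a closed form are closed, and the degree 1 part of the transported first hat
   is four times this contraction. The next two facts use the parts of degree 1 and 3 of the second
   hat. *)
have c1w : closed_form (fun i x => iprod (Y1 i x) (omega i x)).
  apply: (@closed_scaled _ _ 4); [by rewrite pnatr_eq0|exact: smooth_form_iprod|].
  apply: (eq_closed _ (closed_part 1 (sG _ sk1) (cG _ sk1 ck1))) => i x ix.
  rewrite hats1 // (part1_sub (p := 1) (q := 3)) //; last exact: hp.
  exact/homogZ/h11.
have c2w : closed_form (fun i x => iprod (Y2 i x) (omega i x)).
  apply: (@closed_scaled _ _ 4); [by rewrite pnatr_eq0|exact: smooth_form_iprod|].
  apply: (eq_closed _ (closed_part 1 (sG _ sk2) (cG _ sk2 ck2))) => i x ix.
  by rewrite hats2 // partZ (part_add (h11 Y2 i x) (h3p i x ix) isT).1.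
have c21 : closed_form (fun i x => iprod (Y2 i x) (iprod (Y1 i x) (phi i x))).
  apply: (@closed_scaled _ _ 4); [by rewrite pnatr_eq0| |].
    by apply: smooth_form_iprod => //; apply: smooth_form_iprod.
  apply: (eq_closed _ (closed_part 3 (sG _ sk2) (cG _ sk2 ck2))) => i x ix.
  by rewrite hats2 // partZ (part_add (h11 Y2 i x) (h3p i x ix) isT).2.
have c1p : closed_form (fun i x => iprod (Y1 i x) (phi i x)).
  apply: (eq_closed _ (closed_part 4 (sG _ sr1) (cG _ sr1 cr1))) => i x ix.
  by rewrite YE1.
have c2p : closed_form (fun i x => iprod (Y2 i x) (phi i x)).
  apply: (eq_closed _ (closed_part 4 (sG _ sr2) (cG _ sr2 cr2))) => i x ix.
  by rewrite YE2.
have s1p := smooth_form_iprod sY1 sp.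
have P2 : preserves Y2 phi by exact: (preserves_closed sY2 sp cp c2p).
(* The contraction of [phi] by [Y1] is closed, and so is its contraction by [Y2]; hence [Y2]
   preserves it. As [Y2] also preserves [phi], what remains is [phi] contracted by the bracket, and
   that contraction is injective. *)
have comm : commuting Y1 Y2.
  move=> i x ix; rewrite bracketC.
  have : preserves Y2 (fun i x => iprod (Y1 i x) (phi i x)) by apply: preserves_closed.
  move=> /(_ i x ix); rewrite lie_iprod; [|exact: smooth_vector_diff..|exact: smooth_form_diff].
  rewrite P2 // iprod0r addr0 /phi vol_fieldE iprodZr => /eqP.
  rewrite scaler_eq0 gt_eqF ?density_gt0 //= -(iprod0l top_form) => /eqP /iprod_top_inj ->.
  by rewrite oppr0.
exists A, B, omega, phi, Y1, Y2; split; [exact: dA|split; [split; [exact: sB|move=> i x _; exact: hB]|exact: cB]| |move=> i x _; exact: erefl|exact: GE].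
split; last exact: norm.
- split; [split; [exact: so|move=> i x _; exact: ho]|exact: co|exact: pp].
- split; [exact: sY1|exact: sY2|exact: comm].
- split; last exact: P2.
  + exact: (preserves_closed sY1 so co c1w).
  + exact: (preserves_closed sY2 so co c2w).
  + exact: (preserves_closed sY1 sp cp c1p).
Qed.

End CriticalData.

Theorem theorem5 (R : realType) (M : omanifold R 5)
    (M_nonempty : [set: M] !=set0) (M_compact : compact [set: M])
    (M_connected : connected [set: M]) :
  (forall rho1 rho2 : form_field M, critical_structure rho1 rho2 ->
     exists (A : 'M[R]_2) (B : form_field M)
            (omega phi : form_field M) (Y1 Y2 : vector_field M),
       [/\ \det A = 1,
           smooth_homog_form 2%N B /\ closed_form B,
           reduced_data omega phi Y1 Y2,
           pointwise (fun i x => vol (rho1 i x, rho2 i x) = phi i x)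
         & pointwise (fun i x => transform A B rho1 rho2 i x
              = (std1 omega phi Y1 i x, std2 phi Y2 i x))])
  /\
  (forall (omega phi : form_field M) (Y1 Y2 : vector_field M),
     reduced_data omega phi Y1 Y2 ->
     critical_structure (std1 omega phi Y1) (std2 phi Y2) /\
     pointwise (fun i x =>
       vol (std1 omega phi Y1 i x, std2 phi Y2 i x) = phi i x)).
Proof.
split; first exact: critical_data.
by move=> omega phi Y1 Y2 data; apply: (data_critical data).
Qed.
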